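(* Suppose that $n$ is odd (so $d=n$), that $\psi$ is spherical (i.e. unramified, trivial on $\mathbb O_F$ but not on $\mathbb P_F^{-1}$), and that $\psi'=\psi$. Let $\tau(i,j,\chi,s,\psi)$, $0\le i,j\le n-1$, be the coefficients defined by $\lambda^w_{i,\psi,\chi,s}=\sum_{j=0}^{n-1}\tau(i,j,\chi,s,\psi)\,\lambda_{j,\psi,\chi,s}$. 1. For the trivial character $\chi=1$, $$\tau(j,j,1,s,\psi)=L(ns,1)\times\begin{cases}1-q^{-1} & 2j<n-1,\\ L^{-1}(1-ns,1) & 2j=n-1,\\ q^{ns}(1-q^{-1}) & 2j>n-1,\end{cases}$$ and for $i\ne j$ $$\tau(i,j,1,s,\psi)=\begin{cases}q^{\,j-i+s(n-1)}\,\epsilon^{-1}\bigl(s,\eta_\varpi^{\,i-j},\psi\bigr) & i+j=n-1,\\ 0&\text{otherwise.}\end{cases}$$ 2. If $\chi$ is a character of $F^*$ such that $\chi^n$ is ramified, then $$\tau(i,j,\chi,s,\psi)=\begin{cases}\chi(-1)\,q^{\,j-i}\bigl(\chi(\varpi)q^{-s}\bigr)^{-i-j}\,\epsilon^{-1}\bigl(s,\chi\eta_\varpi^{\,i-j},\psi\bigr) & i+j+e(\chi)\equiv0 \pmod n,\\ 0&\text{otherwise.}\end{cases}$$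
   Context: Setting. $n\ge1$ is an integer (odd here), $F$ is a $p$-adic field of residual characteristic $p$ with $\gcd(p,n)=1$, and $F^*$ contains the full group $\mu_n$ of $n$-th roots of unity, identified with the $n$-th roots of unity in $\mathbb C^*$. $\mathbb O_F$ is the ring of integers, $\mathbb P_F$ its maximal ideal, $\varpi$ a fixed generator of $\mathbb P_F$, $q$ the cardinality of the residue field, $\|\varpi\|=q^{-1}$. $(\cdot,\cdot):F^*\times F^*\to\mu_n$ is the $n$-th power Hilbert symbol and $\eta_\varpi(y)=(\varpi,y)$, a character of $F^*$. $d=n/\gcd(n,2)=n$. $e(\chi)$ is the conductor of a character $\chi$ of $F^*$ ($0$ if unramified, else the least $m\ge1$ with $\chi$ trivial on $1+\mathbb P_F^m$). $L(s,\chi)=(1-\chi(\varpi)q^{-s})^{-1}$ if $\chi$ is unramified, $1$ otherwise. $\epsilon(s,\chi,\psi)$ is the Tate epsilon factor: $\gamma(s,\chi,\psi)=\epsilon(s,\chi,\psi)L(1-s,\chi^{-1})/L(s,\chi)$, where $\zeta(1-s,\chi^{-1},\widehat\phi)=\gamma(s,\chi,\psi)\zeta(s,\chi,\phi)$ for Schwartz $\phi$ on $F$, with $\zeta(s,\chi,\phi)$ the meromorphic continuation of $\int_{F^*}\phi(x)\|x\|^s\chi(x)\,d^*x$ and $\widehat\phi(x)=\int_F\phi(y)\psi(xy)\,dy$; $dx$ is the Haar measure self dual with respect to $\psi$ (so $\mathbb O_F$ has volume $1$), $d^*x=\|x\|^{-1}dx$. The cover. $n(x)=\begin{pmatrix}1&x\\0&1\end{pmatrix}$,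 $h(a)=\begin{pmatrix}a&0\\0&a^{-1}\end{pmatrix}$, $w=\begin{pmatrix}0&1\\-1&0\end{pmatrix}$ in $SL_2(F)$; $N(F)=\{n(x):x\in F\}$. $\widetilde{SL_2(F)}$ is the set $SL_2(F)\times\mu_n$ with multiplication $(g,\epsilon)(g',\epsilon')=(gg',c(g,g')\epsilon\epsilon')$, where $c(g_1,g_2)=\bigl(x(g_1g_2)x(g_1)^{-1},\,x(g_1g_2)x(g_2)^{-1}\bigr)$ and $x\begin{pmatrix}a&b\\c&d\end{pmatrix}=c$ if $c\ne0$, $=d$ if $c=0$. $\mathbf s(g)=(g,1)$, and $\widetilde A$ is the preimage of $A\subseteq SL_2(F)$. Principal series. $F_n^*$ is the group of elements of $F^*$ with valuation in $n\mathbb Z$, $H_n(F)=\{h(a):a\in F_n^*\}$, $B_n(F)=H_n(F)N(F)$. For a character $\chi$ of $F^*$ (only its restriction to $F_n^*$ matters) and $s\in\mathbb C$, let $I(\chi,s)$ be the representation of $\widetilde{SL_2(F)}$ by right translations on smooth functions $f$ on $\widetilde{SL_2(F)}$ satisfying $f\bigl((h(a),\epsilon)\,\mathbf s(n(x))\,g\bigr)=\epsilon\,\chi(a)\|a\|^{s+1}f(g)$ for $a\in F_n^*$, $x\in F$, $\epsilon\in\mu_n$ (normalized induction from $\widetilde{B_n(F)}$; since $n$ is odd no additional splitting character is needed). Whittaker functionals. For $0\le i\le n-1$, $\lambda_{i,\psi,\chi,s}(f)$ is the analytic continuation of $\int_F f\bigl(\mathbf s(h(\varpi^i))\,\mathbf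 s(wn(x))\bigr)\psi^{-1}(x)\,dx$ (absolutely convergent when $|\chi(\varpi^n)|<q^{n\mathrm{Re}(s)}$). These $n$ functionals form a basis of the space of $\psi$-Whittaker functionals on $I(\chi,s)$, i.e. functionals $\lambda$ with $\lambda(\mathbf s(n(x))f)=\psi(x)\lambda(f)$. Intertwining operator. $A_w(\chi,s):I(\chi,s)\to I(\chi^{-1},-s)$ is the meromorphic continuation of $f\mapsto\bigl(g\mapsto\int_F f(\mathbf s(w)\mathbf s(n(x))g)\,dx\bigr)$, and $\lambda^w_{i,\psi,\chi,s}=\lambda_{i,\psi,\chi^{-1},-s}\circ A_w(\chi,s)$, a $\psi$-Whittaker functional on $I(\chi,s)$. The coefficients $\tau(i,j,\chi,s,\psi)$ are rational functions of $q^{-s}$ (entries of the metaplectic analog of Shahidi's local coefficient). *)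

(* Defs.v *)
From HB Require Import structures.
From mathcomp Require Import all_boot all_order all_algebra all_field.
From mathcomp Require Import all_classical all_reals all_analysis.
From mathcomp Require Import complex.
Set Implicit Arguments.
Unset Strict Implicit.
Unset Printing Implicit Defensive.
Import Order.TTheory GRing.Theory Num.Theory.
Import numFieldNormedType.Exports.
Local Open Scope classical_set_scope.
Local Open Scope ring_scope.
Local Open Scope complex_scope.

(* The library equips a concrete [numFieldType] K with its topology only under
   the alias K^o. *)
HB.instance Definition _ (R : realType) := NormedModule.copy R[i] R[i]^o.

(* A p-adic field: a field of characteristic 0, complete for a normalized
   discrete valuation with finite residue field, together with a chosen
   uniformizer [pf_unif].  The value of [pf_val] at 0 is irrelevant.
   [pf_q] is the cardinality of the residue field, expressed through a complete
   irredundant list of representatives of the ring of integers modulo its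
   maximal ideal. *)
Record padicField := PadicField {
  pf_sort :> fieldType ;
  pf_val : pf_sort -> int ;
  pf_unif : pf_sort ;
  pf_p : nat ;
  pf_q : nat ;
  pf_char0 : forall m : nat, (m.+1%:R : pf_sort) != 0 ;
  pf_valM : forall x y : pf_sort, x != 0 -> y != 0 ->
    pf_val (x * y) = pf_val x + pf_val y ;
  pf_valD : forall x y : pf_sort, x != 0 -> y != 0 -> x + y != 0 ->
    Num.min (pf_val x) (pf_val y) <= pf_val (x + y) ;
  pf_unif_neq0 : pf_unif != 0 ;
  pf_val_unif : pf_val pf_unif = 1 ;
  pf_p_prime : prime pf_p ;
  pf_val_p : 0 < pf_val pf_p%:R ;
  pf_residue : exists reps : seq pf_sort,
    [/\ uniq reps, size reps = pf_q,
        forall r, r \in reps -> r = 0 \/ 0 <= pf_val r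
      & forall x, x = 0 \/ 0 <= pf_val x ->
          exists! r, r \in reps /\ (x - r = 0 \/ 1 <= pf_val (x - r))] ;
  pf_complete : forall u : nat -> pf_sort,
    (forall k : int, exists N : nat, forall i j : nat, (N <= i)%N -> (N <= j)%N ->
       u i - u j = 0 \/ k <= pf_val (u i - u j)) ->
    exists l : pf_sort, forall k : int, exists N : nat, forall i : nat,
      (N <= i)%N -> u i - l = 0 \/ k <= pf_val (u i - l)
}.

Section ComplexAnalysis.
Context {R : realType}.
Local Notation C := R[i].

Definition cexp (z : C) : C :=
  (expR (complex.Re z))%:C * (cos (complex.Im z) +i* sin (complex.Im z)).

Definition cpow (r : R) (s : C) : C := cexp (s * (ln r)%:C).

(* Around every point, [h] is given off that point by a convergent Laurent
   expansion with finite principal part.  As usual, the values taken by [h] at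
   isolated points carry no information. *)
Definition meromorphic (h : C -> C) : Prop :=
  forall z0 : C, exists (k : nat) (a : nat -> C),
    \forall z \near z0^',
      series (fun m => a m * (z - z0) ^+ m) @ \oo --> (z - z0) ^+ k * h z.

(* The value at [s] of the meromorphic continuation to the whole plane of a
   function [g] known on the domain [U].  The limit over the punctured
   neighbourhoods recovers the value at each regular point; nothing meaningful
   is claimed at a pole. *)
Definition mcont (U : set C) (g : C -> C) (s : C) : C :=
  let h := xget (fun=> 0)
             [set h : C -> C | meromorphic h /\ forall z, U z -> h z = g z] in
  lim (h z @[z --> s^']).

End ComplexAnalysis.

Definition pideal {F : padicField} (k : int) (x : F) : bool :=
  (x == 0) || (k <= pf_val x).

Definition pointed_field (F : padicField) : Type := F.
HB.instance Definition _ (F : padicField) := Choice.on (pointed_field F).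
HB.instance Definition _ (F : padicField) :=
  isPointed.Build (pointed_field F) (0 : F).

(* F is second countable, so its Borel sigma-algebra is generated by balls. *)
Definition pballs (F : padicField) : set (set (pointed_field F)) :=
  [set B | exists (a : F) (k : int), B = [set x : F | pideal k (x - a)]].

Notation borelF F := (g_sigma_algebraType (@pballs F)).

Section LocalField.
Context {R : realType} {F : padicField}.
Local Notation C := R[i].

Definition pnorm (x : F) : R :=
  if x == 0 then 0 else (pf_q F)%:R ^ (- pf_val x).

Definition qpow (s : C) : C := cpow (pf_q F)%:R s.

(* The unit filtration: O^* for m = 0, and 1 + P^m for m >= 1. *)
Definition ugroup (m : nat) (x : F) : bool :=
  if m == 0%N then (x != 0) && (pf_val x == 0) else pideal m%:Z (x - 1).

(* Continuous characters F^* -> C^* (not assumed unitary).  Continuity amounts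
   to triviality on some 1 + P^m.  The value at 0 is irrelevant. *)
Definition is_character (chi : F -> C) : Prop :=
  [/\ forall x y, x != 0 -> y != 0 -> chi (x * y) = chi x * chi y,
      forall x, x != 0 -> chi x != 0
    & exists m : nat, forall x, ugroup m.+1 x -> chi x = 1].

Definition unramified (chi : F -> C) : Prop :=
  forall x, ugroup 0 x -> chi x = 1.

Definition is_conductor (chi : F -> C) (m : nat) : Prop :=
  (forall x, ugroup m x -> chi x = 1) /\
  (forall k, (k < m)%N -> exists2 x, ugroup k x & chi x != 1).

Definition conductor (chi : F -> C) : nat :=
  xget 0%N [set m | is_conductor chi m].

Definition Lfactor (s : C) (chi : F -> C) : C :=
  if `[< unramified chi >] then (1 - chi (pf_unif F) * qpow (- s))^-1 else 1.

Definition spherical (psi : F -> C) : Prop :=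
  [/\ forall x y, psi (x + y) = psi x * psi y,
      forall x, `|psi x| = 1,
      forall x, pideal 0 x -> psi x = 1
    & exists2 x, pideal (- 1) x & psi x != 1].

Definition schwartz (phi : F -> C) : Prop :=
  (exists k : int, forall x, ~~ pideal k x -> phi x = 0) /\
  (exists k : int, forall x y, pideal k y -> phi (x + y) = phi x).

Definition is_haar (mu : set F -> \bar R) : Prop :=
  (forall (a : F) (A : set (borelF F)), measurable A ->
     mu [set a + x | x in (A : set F)] = mu A) /\
  (0 < mu [set x | pideal 0 x] < +oo)%E.

Section Measure.
Context (mu : {measure set (borelF F) -> \bar R}).

Definition cintegral (f : F -> C) : C :=
  Rintegral mu setT (fun x : borelF F => complex.Re (f x)) +i*
  Rintegral mu setT (fun x : borelF F => complex.Im (f x)).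

Definition fourier (psi phi : F -> C) (x : F) : C :=
  cintegral (fun y => phi y * psi (x * y)).

Definition self_dual (psi : F -> C) : Prop :=
  forall phi, schwartz phi -> forall x, fourier psi (fourier psi phi) x = phi (- x).

(* Half-plane of absolute convergence of the zeta integrals attached to chi. *)
Definition zeta_dom (chi : F -> C) : set C :=
  [set s | complex.Re `|chi (pf_unif F)| < (pf_q F)%:R `^ complex.Re s].

(* The integral over F^* against d^*x = dx / |x|. *)
Definition zeta (s : C) (chi phi : F -> C) : C :=
  mcont (zeta_dom chi)
    (fun z => cintegral (fun x => if x == 0 then 0 else
       phi x * cpow (pnorm x) z * chi x * (pnorm x)^-1%:C)) s.

Definition is_gamma (psi chi : F -> C) (gamma : C -> C) : Prop :=
  meromorphic gamma /\
  forall phi, schwartz phi -> forall s : C, \forall z \near s^',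
    zeta (1 - z) (fun x => (chi x)^-1) (fourier psi phi)
    = gamma z * zeta z chi phi.

(* The first clause fixes the values of the (entire) function [eps], which the
   second one determines only off a discrete set. *)
Definition is_epsilon (psi chi : F -> C) (eps : C -> C) : Prop :=
  (forall s : C, eps z @[z --> s^'] --> eps s) /\
  exists2 gamma : C -> C, is_gamma psi chi gamma &
    forall s : C, \forall z \near s^',
      gamma z = eps z * Lfactor (1 - z) (fun x => (chi x)^-1) / Lfactor z chi.

End Measure.

(* b is a norm from F(a^(1/n)) to F. *)
Definition is_norm_root (n : nat) (a b : F) : Prop :=
  exists (L : splittingFieldType F) (alpha x : L),
    [/\ alpha ^+ n = a%:A, <<1%VS; alpha>>%VS = fullv
      & galNorm 1%VS {: L} x = b%:A].

(* The n-th power Hilbert symbol (a, b) = sigma_b(a^(1/n)) / a^(1/n), where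
   sigma_b is the norm residue symbol of b in F(a^(1/n)) / F, for n prime to the
   residual characteristic and mu_n contained in F.  It is pinned down by the
   defining properties of sigma_b: multiplicativity, kernel the norm group, and,
   when F(a^(1/n)) / F is unramified (here, for a a unit), uniformizers map to
   the Frobenius x |-> x^q, whence (a, pi) = a^((q - 1)/n) modulo P.
   The opposite convention amounts to inverting the identification of mu_n with
   the complex roots of unity. *)
Definition is_hilbert_symbol (n : nat) (hilb : F -> F -> F) : Prop :=
  [/\ forall a b, a != 0 -> b != 0 -> hilb a b ^+ n = 1,
      forall a a' b, a != 0 -> a' != 0 -> b != 0 ->
        hilb (a * a') b = hilb a b * hilb a' b,
      forall a b b', a != 0 -> b != 0 -> b' != 0 ->
        hilb a (b * b') = hilb a b * hilb a b',
      forall a b, a != 0 -> b != 0 -> (hilb a b = 1 <-> is_norm_root n a b)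
    & forall a b, ugroup 0 a -> b != 0 -> pf_val b = 1 ->
        pideal 1 (hilb a b - a ^+ ((pf_q F).-1 %/ n))].

Definition is_root_identification (n : nat) (iota : F -> C) : Prop :=
  [/\ iota 1 = 1,
      forall x y, x ^+ n = 1 -> y ^+ n = 1 -> iota (x * y) = iota x * iota y
    & forall x y, x ^+ n = 1 -> y ^+ n = 1 -> iota x = iota y -> x = y].

Definition mx22 (a b c d : F) : 'M[F]_2 :=
  \matrix_(i < 2, j < 2)
    if i == 0 then (if j == 0 then a else b) else (if j == 0 then c else d).

Definition SL2 := {g : 'M[F]_2 | \det g == 1}.

Lemma det1_subproof : \det (1%:M : 'M[F]_2) == 1.
Proof. by rewrite det1. Qed.

Definition sl2_1 : SL2 := exist (fun g => \det g == 1) 1%:M det1_subproof.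

(* The default value of [insubd] is only reached off determinant 1, respectively
   (in [mkroot]) off the n-th roots of unity; neither happens below. *)
Definition sl2 (g : 'M[F]_2) : SL2 := insubd sl2_1 g.

Definition sl2_mul (g g' : SL2) : SL2 := sl2 (val g *m val g').
Definition sl2_n (x : F) : SL2 := sl2 (mx22 1 x 0 1).
Definition sl2_h (a : F) : SL2 := sl2 (mx22 a 0 0 a^-1).
Definition sl2_w : SL2 := sl2 (mx22 0 1 (- 1) 0).

Definition croot (n : nat) := {z : C | z ^+ n == 1}.

Lemma croot1_subproof (n : nat) : (1 : C) ^+ n == 1.
Proof. by rewrite expr1n. Qed.

Definition croot_1 (n : nat) : croot n :=
  exist (fun z => z ^+ n == 1) 1 (croot1_subproof n).

Definition mkroot (n : nat) (z : C) : croot n := insubd (croot_1 n) z.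

Section Cover.
Context (n : nat).
(* [sym] is the Hilbert symbol with values in the complex roots of unity. *)
Context (sym : F -> F -> C).
Context (mu : {measure set (borelF F) -> \bar R}).

Definition kubota_x (g : SL2) : F :=
  let g := val g in if g 1 0 != 0 then g 1 0 else g 1 1.

Definition cocycle (g g' : SL2) : C :=
  let x := kubota_x (sl2_mul g g') in
  sym (x / kubota_x g) (x / kubota_x g').

Definition cover : Type := (SL2 * croot n)%type.

Definition cover_mul (g g' : cover) : cover :=
  (sl2_mul g.1 g'.1, mkroot n (cocycle g.1 g'.1 * val g.2 * val g'.2)).

Definition sec (g : SL2) : cover := (g, mkroot n 1).

Definition congruence (m : nat) (k : SL2) : Prop :=
  forall i j, pideal m%:Z ((val k - 1%:M) i j).

(* The space of I(chi, s).  The topology of the cover is the one for which [sec]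
   is a topological isomorphism of a small congruence subgroup onto an open
   subgroup; hence the form of the smoothness condition. *)
Definition princ_series (chi : F -> C) (s : C) (f : cover -> C) : Prop :=
  (forall (a x : F) (e : croot n) (g : cover),
     a != 0 -> (n%:Z %| pf_val a)%Z ->
     f (cover_mul (cover_mul (sl2_h a, e) (sec (sl2_n x))) g)
     = val e * chi a * cpow (pnorm a) (s + 1) * f g) /\
  (exists m : nat, forall (g : cover) (k : SL2),
     congruence m.+1 k -> f (cover_mul g (sec k)) = f g).

(* If g = n(x) h(a) k with k in SL_2(O), this is |a|^-1. *)
Definition height (g : cover) : R :=
  Num.max (pnorm (val g.1 1 0)) (pnorm (val g.1 1 1)).

(* The flat section through [f] in I(chi, s): g |-> f(g) |a(g)|^(z - s), an
   element of I(chi, z), where a(g) is the Iwasawa coordinate above.  It is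
   independent of z on the preimage of SL_2(O) and equals [f] at z = s.  Analytic
   continuation in the complex parameter is taken along such sections. *)
Definition flat (s : C) (f : cover -> C) (z : C) (g : cover) : C :=
  f g * cpow (height g) (s - z).

Definition conv_dom (chi : F -> C) : set C :=
  [set s | complex.Re `|chi (pf_unif F ^+ n)|
           < (pf_q F)%:R `^ (n%:R * complex.Re s)].

Definition whittaker (i : nat) (psi chi : F -> C) (s : C) (f : cover -> C) : C :=
  mcont (conv_dom chi)
    (fun z => cintegral mu (fun x =>
       flat s f z (cover_mul (sec (sl2_h (pf_unif F ^+ i)))
                             (sec (sl2_mul sl2_w (sl2_n x)))) * (psi x)^-1)) s.

Definition intertwining (chi : F -> C) (s : C) (f : cover -> C) (g : cover) : C :=
  mcont (conv_dom chi)
    (fun z => cintegral mu (fun x =>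
       flat s f z (cover_mul (cover_mul (sec sl2_w) (sec (sl2_n x))) g))) s.

Definition whittaker_w (i : nat) (psi chi : F -> C) (s : C) (f : cover -> C) : C :=
  whittaker i psi (fun x => (chi x)^-1) (- s) (intertwining chi s f).

Definition is_coefficient_matrix (psi chi : F -> C) (s : C)
    (tau : 'I_n -> 'I_n -> C) : Prop :=
  forall (f : cover -> C), princ_series chi s f -> forall i : 'I_n,
    whittaker_w i psi chi s f = \sum_(j < n) tau i j * whittaker j psi chi s f.

End Cover.
End LocalField.

Arguments qpow {R} F s.

(* Main.v *)
(* The functionals lambda_k admit a dual family of test sections: f_j, supported
   on the big cell, with f_j(h(w^j) w n(y)) = 1_O(y).  Hence tau(i, j) is
   lambda^w_i(f_j), and only the values of A_w f_j at h(w^i) w n(y) matter.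

   Put xi = chi eta^(i - j).  If v(y) = - l < 0, the intertwining integral runs
   over the coset w^(2 i) / y (1 + P^l) and has integrand a multiple of xi^-1; it
   is an exponential in s times xi(y) if xi is trivial on 1 + P^l and n divides
   i + j + l, and 0 otherwise.  If y is integral, it is a sum over shells, which
   vanishes when xi is ramified and is a geometric series when xi = 1.

   In the outer integral, psi^-1 xi integrates to 0 over all shells v(y) = - l
   with xi trivial on 1 + P^l except for l = e(xi) (l = 1 if xi = 1).  The
   remaining Gauss integral is eps^-1 up to a power of q, by Tate's functional
   equation for the function psi^-1 1_(P^-e), whose Fourier transform is
   q^e 1_(1 + P^e).

   The Hilbert symbol enters through three facts: (a, a) = 1, because n is odd
   and a is then a norm from F(a^(1/n)); (a, u) = 1 for u in 1 + P; and
   eta^k is ramified unless n divides k, since the residue field contains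
   the n-th roots of unity.  Continuations are identified by the identity theorem
   for functions with local Laurent expansions. *)
Require Import Defs.
From HB Require Import structures.
From mathcomp Require Import all_boot all_order all_algebra all_field.
From mathcomp Require Import all_classical all_reals all_analysis.
From mathcomp Require Import complex ring lra zify.
From mathcomp Require Import measurable_realfun.
From mathcomp Require fingroup cyclic.
Import Order.TTheory GRing.Theory Num.Theory.
Import numFieldNormedType.Exports.
Local Open Scope classical_set_scope.
Local Open Scope ring_scope.
Local Open Scope complex_scope.

Set Implicit Arguments.
Unset Strict Implicit.

(** * Meromorphic continuation *)

(** A continuation is the value of a meromorphic extension picked by choice, so it can be computed
    only by exhibiting an explicit meromorphic function that agrees with the integral on a
    half-plane. Those that occur are K1 e^(a1 z) + K2 e^(a2 z) and, because of the geometric series,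
    reciprocals of such sums; their Laurent expansions come from the exponential series and from
    inverting a power series. The flat section through A_w f_j is formed at -s, after the inner
    continuation has been evaluated, so the inner value is needed for every y before the outer
    integral is continued. The outer integral is then a sum of two exponentials in z, one from
    integral y and one from a single shell, whose z-dependent factors are 1 at z = -s. Characters
    are not assumed unitary and the integrals are Lebesgue integrals, so each infinite sum over
    shells needs a geometric majorant: a character is bounded on units, and the domain of
    convergence supplies a ratio below 1. Schwartz functions reduce to finite sums of volumes of
    balls. *)

Section ComplexPlane.
Context {R : realType}.
Local Notation C := R[i].
Local Notation nm := (@Normc.normc R).

Lemma normrE (z : C) : `|z| = (nm z)%:C. Proof. by []. Qed.

Lemma nm_ge0 (z : C) : 0 <= nm z.
Proof. by case: z => a b; apply: sqrtr_ge0. Qed.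

Lemma nm0 : nm 0 = 0. Proof. exact: Normc.normc0. Qed.

Lemma nm1 : nm 1 = 1. Proof. exact: Normc.normc1. Qed.

Lemma nmM (x y : C) : nm (x * y) = nm x * nm y.
Proof. exact: Normc.normcM. Qed.

Lemma nmV (x : C) : nm x^-1 = (nm x)^-1. Proof. exact: Normc.normcV. Qed.

Lemma nmX (x : C) k : nm (x ^+ k) = nm x ^+ k.
Proof. by elim: k => [|k IH]; rewrite ?expr0 ?nm1// !exprS nmM IH. Qed.

Lemma nmN (x : C) : nm (- x) = nm x. Proof. exact: normcN. Qed.

Lemma nmB (x y : C) : nm (x - y) = nm (y - x).
Proof. by rewrite -nmN opprB. Qed.

Lemma nmD (x y : C) : nm (x + y) <= nm x + nm y. Proof. exact: le_normcD. Qed.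

Lemma nm_eq0 (x : C) : (nm x == 0) = (x == 0).
Proof. by apply/eqP/eqP => [/Normc.eq0_normc//|->]; rewrite nm0. Qed.

Lemma nm_gt0 (x : C) : (0 < nm x) = (x != 0).
Proof. by rewrite lt_neqAle eq_sym nm_eq0 nm_ge0 andbT. Qed.

Lemma nm_real (r : R) : nm r%:C = `|r|.
Proof. by rewrite /= expr0n/= addr0 sqrtr_sqr. Qed.

Lemma nm_Re (z : C) : `|complex.Re z| <= nm z.
Proof. by rewrite -lecR -normrE normc_ge_Re. Qed.

Lemma nm_Im (z : C) : `|complex.Im z| <= nm z.
Proof. by case: z => a b /=; rewrite -sqrtr_sqr ler_wsqrtr// lerDr sqr_ge0. Qed.

Lemma nm_le_ReIm (z : C) : nm z <= `|complex.Re z| + `|complex.Im z|.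
Proof.
case: z => a b; have -> : a +i* b = a%:C + 'i%C * b%:C by rewrite [LHS]complexE.
rewrite (le_trans (nmD _ _))// nmM !nm_real /= expr0n/= add0r expr1n sqrtr1 mul1r.
by rewrite !(mul0r, mul1r, subr0, addr0, add0r, mulr0).
Qed.

Lemma ler_nm_sum (I : Type) (r : seq I) (P : pred I) (f : I -> C) :
  nm (\sum_(i <- r | P i) f i) <= \sum_(i <- r | P i) nm (f i).
Proof.
elim/big_ind2 : _ => [|x1 x2 y1 y2 h1 h2|//]; first by rewrite nm0.
by rewrite (le_trans (nmD _ _))// lerD.
Qed.

Lemma cvg_nmP (T : Type) (G : set_system T) (FG : Filter G) (f : T -> C) (l : C) :
  f x @[x --> G] --> l <->
  forall e : R, 0 < e -> \forall x \near G, nm (f x - l) < e.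
Proof.
split => [/cvgrPdist_lt h e e0|h].
  have := h e%:C; rewrite ltcR => /(_ e0).
  by apply: filterS => x; rewrite normrE ltcR nmB.
apply/cvgrPdist_lt => e e0; have [r er] : exists r, e = r%:C.
  by apply/complex_realP; rewrite ger0_real// ltW.
move: e0; rewrite er ltcR => r0.
by apply: filterS (h _ r0) => x hx; rewrite normrE ltcR nmB.
Qed.

Lemma cseqD (u v : nat -> C) (a b : C) :
  u @ \oo --> a -> v @ \oo --> b -> (fun n => u n + v n) @ \oo --> a + b.
Proof. exact: cvgD. Qed.

Lemma cseqZ (c : C) (u : nat -> C) (a : C) :
  u @ \oo --> a -> (fun n => c * u n) @ \oo --> c * a.
Proof. by move=> h; exact: (cvgM (cvg_cst c) h). Qed.

Lemma cseqS (u : nat -> C) (a : C) :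
  u @ \oo --> a -> (fun n => u n.+1) @ \oo --> a.
Proof. by move=> h; rewrite cvg_shiftS. Qed.

Lemma cseq_eq (u v : nat -> C) (a b : C) :
  u @ \oo --> a -> (forall n, v n = u n) -> b = a -> v @ \oo --> b.
Proof. by move=> h /funext -> ->. Qed.

Lemma nbhs_nmP (s : C) (P : set C) :
  nbhs s P <-> exists2 r : R, 0 < r & forall z, nm (z - s) < r -> P z.
Proof.
split.
  move=> /nbhs_ballP[e /= e0 he]; have [r er] : exists r, e = r%:C.
    by apply/complex_realP; rewrite ger0_real// ltW.
  move: e0 he; rewrite er ltcR => r0 he; exists r => // z hz; apply: he.
  by rewrite -ball_normE /ball_/= normrE ltcR nmB.
move=> [r r0 h]; apply/nbhs_ballP; exists r%:C => /=; first by rewrite ltcR.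
by move=> z; rewrite -ball_normE /ball_/= normrE ltcR nmB => /h.
Qed.

Lemma dnbhs_nmP (s : C) (P : set C) :
  s^' P <-> exists2 r : R, 0 < r & forall z, 0 < nm (z - s) < r -> P z.
Proof.
split=> [/nbhs_nmP[r r0 h]|[r r0 h]].
  exists r => // z /andP[z0 zr]; apply: h => //.
  by move: z0; rewrite nm_gt0 subr_eq0.
apply/nbhs_nmP; exists r => // z zr z0; apply: h.
by rewrite nm_gt0 subr_eq0 z0.
Qed.

(** The factor 2 bounds 1 / (1 - x) for x at most 1/2. *)
Lemma geom_tail (x : R) (k N : nat) : 0 <= x <= 2^-1 ->
  \sum_(k <= m < N) x ^+ m <= 2 * x ^+ k.
Proof.
move=> /andP[x0 x1]; have [kN|Nk] := leqP k N; last first.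
  by rewrite big_geq ?(ltnW Nk)// mulr_ge0 ?exprn_ge0.
have E : \sum_(k <= m < N) x ^+ m * (1 - x) = x ^+ k - x ^+ N.
  under eq_bigr do rewrite mulrBr mulr1 -exprSr -opprB.
  by rewrite sumrN telescope_sumr// opprB.
have : (\sum_(k <= m < N) x ^+ m) * (1 - x) <= x ^+ k.
  by rewrite mulr_suml E gerBl exprn_ge0.
set S := \sum_(_ <= _ < _) _ => h.
have S0 : 0 <= S by apply: sumr_ge0 => i _; apply: exprn_ge0.
nra.
Qed.

(** The terms of a convergent series tend to 0, hence are bounded: a Cauchy estimate for the
    coefficients obtained from convergence at a single point. *)
Lemma series_bound (b : nat -> C) (w0 l : C) :
  series (fun m => b m * w0 ^+ m) @ \oo --> l ->
  exists2 M : R, 0 < M & forall m, nm (b m) * nm w0 ^+ m <= M.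
Proof.
move=> h; have /cvg_nmP/(_ 1 ltr01) [N _ hN] : (fun m => b m * w0 ^+ m) @ \oo --> (0 : C).
  by apply: cvg_series_cvg_0; apply/cvg_ex; exists l.
exists (1 + \sum_(i < N) nm (b i * w0 ^+ i)).
  by rewrite ltr_pwDl// sumr_ge0// => i _; apply: nm_ge0.
move=> m; rewrite -nmX -nmM; have [Nm|mN] := leqP N m.
  have := hN m Nm; rewrite subr0 => /ltW h1; rewrite (le_trans h1)// lerDl.
  by apply: sumr_ge0 => i _; apply: nm_ge0.
rewrite (bigD1 (Ordinal mN))//= addrCA lerDl addr_ge0//.
by apply: sumr_ge0 => i _; apply: nm_ge0.
Qed.

Lemma tail_bound (b : nat -> C) (M rho : R) (w : C) (k N : nat) :
  0 < rho -> (forall m, nm (b m) * rho ^+ m <= M) -> 2 * nm w <= rho ->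
  nm (\sum_(k <= m < N) b m * w ^+ m) <= M * (2 * (nm w / rho) ^+ k).
Proof.
move=> r0 hb hw; set x := nm w / rho.
have M0 : 0 <= M by rewrite (le_trans _ (hb 0%N))// mulr_ge0 ?nm_ge0 ?exprn_ge0 ?ltW.
have hx : 0 <= x <= 2^-1.
  rewrite /x divr_ge0 ?nm_ge0 ?(ltW r0)//= ler_pdivrMr//.
  by move: hw; lra.
rewrite (le_trans (ler_nm_sum _ _ _))//.
apply: le_trans (_ : \sum_(k <= m < N) M * x ^+ m <= _).
  apply: ler_sum => i _; rewrite nmM nmX.
  have -> : nm w = rho * x by rewrite /x mulrC divfK// gt_eqF.
  rewrite exprMn mulrA ler_wpM2r//.
  by rewrite exprn_ge0//; case/andP: hx.
by rewrite -mulr_sumr ler_wpM2l// geom_tail.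
Qed.

(* Isolated zeros: near [0] the lowest nonzero coefficient dominates. *)
Lemma pseries_dichotomy (b : nat -> C) (r : R) (g : C -> C) : 0 < r ->
  (forall w, 0 < nm w < r -> series (fun m => b m * w ^+ m) @ \oo --> g w) ->
  (forall w, 0 < nm w < r -> g w = 0) \/
  exists2 r' : R, 0 < r' & forall w, 0 < nm w < r' -> g w != 0.
Proof.
move=> r0 hg.
have [b0|/existsNP[k0 /eqP bk0]] := pselect (forall m, b m = 0).
  left => w hw; apply: (cvg_unique (@norm_hausdorff _ _) (hg w hw)).
  rewrite (_ : series _ = fun=> 0); first exact: cvg_cst.
  by apply/funext => N; rewrite seriesEnat/= big1// => i _; rewrite b0 mul0r.
right; have ex_k : exists k, b k != 0 by exists k0.
case: (ex_minnP ex_k) => k bk kmin {bk0 k0}.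
set rho := r / 2.
have rho0 : 0 < rho by rewrite divr_gt0.
have nr : nm rho%:C = rho by rewrite nm_real gtr0_norm.
have [|M M0 hM] := @series_bound b rho%:C (g rho%:C).
  by apply: hg; rewrite nr rho0/= /rho ltr_pdivrMr// ltr_pMr// ltr1n.
move: hM; rewrite nr => hM.
(* Chosen so that for |w| < rho d the tail bound 2 M (|w| / rho)^(k + 1) is at most half of the
   leading term |b k| |w|^k. *)
set d := nm (b k) * rho ^+ k / (4 * M).
have nbk : 0 < nm (b k) by rewrite nm_gt0.
have d0 : 0 < d by rewrite divr_gt0 ?mulr_gt0 ?exprn_gt0.
exists (Num.min (rho / 2) (rho * d)) => [|w].
  by rewrite lt_min divr_gt0//= mulr_gt0.
move=> /andP[w0]; rewrite lt_min => /andP[w1 w2].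
have wr : 0 < nm w < r by rewrite w0/=; move: w1; rewrite /rho; lra.
apply/negP => /eqP gw0.
have /cvg_nmP := hg w wr; rewrite gw0 => /(_ (nm (b k) * nm w ^+ k / 2)).
rewrite divr_gt0 ?mulr_gt0 ?exprn_gt0// => /(_ isT)[N _ hN].
have := hN (maxn N k.+1) (leq_maxl _ _); rewrite /= subr0 ltNge => /negP; apply.
rewrite (@big_cat_nat _ _ _ k.+1)//= ?leq_maxr//.
rewrite big_nat_recr//= big1_seq ?add0r => [|i]; last first.
  rewrite mem_index_iota => /andP[_ /= ik].
  by have [->|/kmin] := eqVneq (b i) 0; [rewrite mul0r|rewrite leqNgt ik].
set T := \sum_(_ <= _ < _) _.
have hT : nm T <= M * (2 * (nm w / rho) ^+ k.+1).
  by apply: tail_bound => //; move: w1; lra.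
have : nm (b k * w ^+ k) <= nm (b k * w ^+ k + T) + nm T.
  by rewrite -{1}(addrK T (b k * w ^+ k)) -(nmN T) nmD.
rewrite nmM nmX => h1.
have : M * (2 * (nm w / rho) ^+ k.+1) <= nm (b k) * nm w ^+ k / 2.
  rewrite exprSr expr_div_n.
  have h3 : nm w / rho <= d by rewrite ler_pdivrMr// mulrC ltW.
  have h4 : 0 < nm w ^+ k / rho ^+ k by rewrite divr_gt0 ?exprn_gt0.
  apply: le_trans (_ : M * (2 * (nm w ^+ k / rho ^+ k * d)) <= _).
    by rewrite ler_pM2l// ler_pM2l// ler_pM2l.
  rewrite le_eqVlt; apply/orP; left; apply/eqP; rewrite /d; field.
  by rewrite gt_eqF// ?expf_neq0// gt_eqF.
lra.
Qed.


(** Brings two Laurent expansions with poles of different orders to a common denominator. *)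
Lemma series_shift (a : nat -> C) (w l : C) (k : nat) :
  series (fun m => a m * w ^+ m) @ \oo --> l ->
  series (fun m => iter k (fun b m => if m is m'.+1 then b m' else 0) a m * w ^+ m)
    @ \oo --> w ^+ k * l.
Proof.
elim: k => [|k IH] h; first by rewrite mul1r.
move: {IH}(IH h) => /=; set b := iter k _ a => h'; rewrite exprS -mulrA.
rewrite -cvg_shiftS.
rewrite (_ : (fun _ => _) = fun N => w * series (fun m => b m * w ^+ m) N).
  exact: (cvgM (cvg_cst w) h').
apply/funext => N; rewrite seriesEnat/= big_nat_recl//= mul0r add0r big_distrr/=.
by apply: eq_bigr => i _; rewrite exprS; ring.
Qed.

(** Multiplied by (z - p)^(k1 + k2), the difference of the two functions is a convergent power
    series near p, and its zeros are isolated unless it vanishes identically. *)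
Lemma meromorphic_dichotomy (h1 h2 : C -> C) (p : C) :
  meromorphic h1 -> meromorphic h2 ->
  exists2 r : R, 0 < r & (forall z, 0 < nm (z - p) < r -> h1 z = h2 z) \/
                         (forall z, 0 < nm (z - p) < r -> h1 z <> h2 z).
Proof.
move=> /(_ p)[k1 [a1 /dnbhs_nmP[r1 r10 H1]]] /(_ p)[k2 [a2 /dnbhs_nmP[r2 r20 H2]]].
set r := Num.min r1 r2; have r0 : 0 < r by rewrite lt_min r10.
pose g w := w ^+ k2 * (w ^+ k1 * h1 (w + p)) - w ^+ k1 * (w ^+ k2 * h2 (w + p)).
pose sh k := iter k (fun (b : nat -> C) m => if m is m'.+1 then b m' else 0).
have gE w : g w = w ^+ (k1 + k2) * (h1 (w + p) - h2 (w + p)).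
  by rewrite /g exprD; ring.
have [|g0|[r' r'0 g0]] := @pseries_dichotomy (fun m => sh k2 a1 m - sh k1 a2 m) r g r0.
- move=> w /andP[w0]; rewrite lt_min => /andP[w1 w2].
  rewrite (_ : series _ = series (fun m => sh k2 a1 m * w ^+ m)
                        \- series (fun m => sh k1 a2 m * w ^+ m)).
    apply: cvgB; apply: series_shift.
      by have := H1 (w + p); rewrite addrK w0 w1; apply.
    by have := H2 (w + p); rewrite addrK w0 w2; apply.
  apply/funext => N; rewrite /= -sumrB; apply: eq_bigr => i _; exact: mulrBl.
- exists r => //; left => z zr; have := g0 _ zr; rewrite gE subrK => /eqP.
  rewrite mulf_eq0 expf_eq0 -nm_eq0 gt_eqF ?andbF ?subr_eq0; last by case/andP: zr.
  by move=> /eqP.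
- exists r' => //; right => z zr /eqP; rewrite -subr_eq0 => /eqP h.
  by have := g0 _ zr; rewrite gE subrK h mulr0 eqxx.
Qed.

(** A connectedness argument along the segment from sigma + 1 to s: the supremum c of the parameters
    up to which the functions agree on punctured discs is attained and equals 1. Punctured discs are
    used throughout, since values at isolated points are arbitrary. *)
Theorem identity_theorem (h1 h2 : C -> C) (sigma : R) :
  meromorphic h1 -> meromorphic h2 ->
  (forall z, sigma < complex.Re z -> h1 z = h2 z) ->
  forall s, \forall z \near s^', h1 z = h2 z.
Proof.
move=> m1 m2 h12 s.
pose good p := exists2 r : R, 0 < r & forall z, 0 < nm (z - p) < r -> h1 z = h2 z.
apply/dnbhs_nmP; rewrite -/(good s).
pose z1 : C := (sigma + 1)%:C.
pose g (t : R) := z1 + t%:C * (s - z1).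
(* A Lipschitz constant of the segment, kept positive even when s = z1. *)
pose K := nm (s - z1) + 1.
have K0 : 0 < K by rewrite ltr_wpDl// nm_ge0.
have gB t u : nm (g t - g u) <= `|t - u| * K.
  have -> : g t - g u = (t - u)%:C * (s - z1) by rewrite /g rmorphB/=; ring.
  by rewrite nmM nm_real ler_wpM2l// lerDl.
pose E := [set t : R | 0 <= t <= 1 /\ forall u, 0 <= u <= t -> good (g u)].
have E0 : E 0.
  split; first by rewrite lexx ler01.
  move=> u; rewrite -eq_le => /eqP <-; exists 1 => // z.
  rewrite /g mul0r addr0 => /andP[_ hz]; apply: h12.
  have := le_lt_trans (nm_Re _) hz; rewrite ltr_norml => /andP[+ _].
  rewrite raddfB/=; lra.
have hE : has_sup E by split; [exists 0|exists 1 => t [/andP[]]].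
set c := sup E.
have c0 : 0 <= c by apply: ub_le_sup => //; case: hE.
have c1 : c <= 1 by apply: ge_sup => [|t [/andP[]]//]; exists 0.
have [r r0 hr] := meromorphic_dichotomy (g c) m1 m2.
have rK0 : 0 < r / K by rewrite divr_gt0.
have near_g u : `|u - c| < r / K -> nm (g u - g c) < r.
  by move=> h; rewrite (le_lt_trans (gB _ _))// -ltr_pdivlMr.
have [t Et tc] := sup_adherent rK0 hE.
have tc' : t <= c by apply: ub_le_sup => //; case: hE.
have ntc : nm (g t - g c) < r.
  by apply: near_g; rewrite ler0_norm ?subr_le0//; move: tc; rewrite -/c; lra.
have {}hr : forall z, 0 < nm (z - g c) < r -> h1 z = h2 z.
  case: hr => // hr.
  have [r' r'0 hr'] : good (g t) by case: Et => /andP[t0 _]; apply; rewrite t0 lexx.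
  set d := Num.min r' (r - nm (g t - g c)).
  have d0 : 0 < d by rewrite lt_min r'0 subr_gt0.
  (* If the functions differed all around [g c], a point [g t + e] lying in both punctured discs
     would be contradictory; so every small e would land exactly on the centre [g c], which two
     different values of e cannot do. *)
  have key (e : R) : 0 < e < d -> g t + e%:C = g c.
    move=> /andP[e0]; rewrite lt_min => /andP[e1 e2]; apply/eqP/negPn/negP => ne.
    apply: (hr (g t + e%:C)).
      rewrite nm_gt0 subr_eq0 ne/= addrAC (le_lt_trans (nmD _ _))//.
      by rewrite nm_real gtr0_norm//; lra.
    by apply: hr'; rewrite addrAC subrr add0r nm_real gtr0_norm// e0 e1.
  have := key (d / 2); rewrite -(key (d / 3)); last lra.
  by move=> /(_ ltac:(lra)) /addrI /complexI; lra.
have goodc u : `|u - c| < r / K -> good (g u).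
  move=> /near_g ur; have [->|ne] := eqVneq (g u) (g c); first by exists r.
  exists (Num.min (nm (g u - g c)) (r - nm (g u - g c))).
    by rewrite lt_min nm_gt0 subr_eq0 ne subr_gt0.
  move=> z /andP[z0]; rewrite lt_min => /andP[z1' z2]; apply: hr.
  have -> : z - g c = (z - g u) + (g u - g c) by ring.
  apply/andP; split; last by rewrite (le_lt_trans (nmD _ _))//; lra.
  rewrite nm_gt0 -nm_eq0; apply/eqP => h.
  have : nm (g u - g c) <= nm (z - g u + (g u - g c)) + nm (z - g u).
    by rewrite -{1}(addKr (z - g u) (g u - g c)) addrC -(nmN (z - g u)) nmD.
  by rewrite h; lra.
(* Agreement extends beyond c by half the radius unless the end of the segment has been reached, so
   c = 1. *)
set t2 := Num.min 1 (c + r / K / 2).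
have Et2 : E t2.
  split; first by rewrite ge_min lexx le_min ler01/= addr_ge0// divr_ge0// ltW.
  move=> u /andP[u0]; rewrite le_min => /andP[_ u2].
  have [ut|tu] := leP u t; first by case: Et => _; apply; rewrite u0.
  apply: goodc; rewrite ltr_norml; move: tc; rewrite -/c; lra.
have : t2 <= c by apply: ub_le_sup => //; case: hE.
rewrite ge_min => /orP[c1'|]; last lra.
have -> : s = g 1 by rewrite /g mul1r addrC subrK.
apply: goodc; have -> : c = 1 by lra.
by rewrite subrr normr0.
Qed.

(** The chosen extension exists because H is a candidate; it agrees with H on a punctured
    neighbourhood of s, and the limit in [mcont] removes the remaining ambiguity at s itself. *)
Lemma mcontE (U : set C) (g H : C -> C) (sigma : R) (s : C) :
  (forall z, sigma < complex.Re z -> U z) -> meromorphic H ->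
  (forall z, U z -> g z = H z) -> H z @[z --> s^'] --> H s ->
  mcont U g s = H s.
Proof.
move=> hU mH gH cH; rewrite /mcont.
case: xgetP => [h _ [mh hh]|]; last first.
  by move=> /(_ H); case; split => // z Uz; rewrite gH.
have eqh := identity_theorem mh mH
  (fun z hz => etrans (hh z (hU z hz)) (gH z (hU z hz))) s.
apply: cvg_lim; first exact: norm_hausdorff.
by apply: cvg_trans cH; apply: near_eq_cvg; apply: filterS eqh.
Qed.


(** * The complex exponential and its Taylor series *)

Lemma cexpD (x y : C) : cexp (x + y) = cexp x * cexp y.
Proof.
case: x y => [a b] [c d]; rewrite /cexp /= expRD cosD sinD.
apply/eqP; rewrite eq_complex /=; apply/andP; split; apply/eqP; ring.
Qed.

Lemma cexp0 : cexp 0 = 1 :> C.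
Proof. by rewrite /cexp /= expR0 cos0 sin0 mul1r. Qed.

Lemma cexp_neq0 (x : C) : cexp x != 0.
Proof.
apply/eqP => h; have := cexpD x (- x).
by rewrite subrr cexp0 h mul0r => /eqP; rewrite oner_eq0.
Qed.

Lemma cexpN (x : C) : cexp (- x) = (cexp x)^-1.
Proof.
apply: (mulfI (cexp_neq0 x)); rewrite -cexpD subrr cexp0 divff//.
exact: cexp_neq0.
Qed.

Lemma cexp_real (r : R) : cexp r%:C = (expR r)%:C.
Proof. by rewrite /cexp /= cos0 sin0 mulr1. Qed.

Lemma nm_cexp (z : C) : nm (cexp z) = expR (complex.Re z).
Proof.
rewrite /cexp nmM nm_real /= cos2Dsin2 sqrtr1 mulr1 gtr0_norm//.
exact: expR_gt0.
Qed.

Lemma is_derive_powsum (p : nat -> R) N (t : R) :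
  is_derive t (1 : R) (fun t => \sum_(m < N.+1) p m * t ^+ m)
                (\sum_(m < N) m.+1%:R * p m.+1 * t ^+ m).
Proof.
elim: N => [|N IH].
  rewrite big_ord0 (_ : (fun _ => _) = cst (p 0%N)); first exact: is_derive_cst.
  by apply/funext => x; rewrite big_ord1 expr0 mulr1.
rewrite [X in is_derive _ _ X](_ : _ = (fun t => \sum_(m < N.+1) p m * t ^+ m)
    + p N.+1 *: (id ^+ N.+1)).
  rewrite big_ord_recr/=; apply: is_deriveD.
  apply: is_derive_eq; rewrite /GRing.scale/=; ring.
by apply/funext => x; rewrite big_ord_recr/= !fctE.
Qed.

(** Mean value theorem for the difference between the majorant and [e *: f]; the choices e = 1 and e
    = -1 give the two one-sided bounds. *)
Lemma derive_pow_bound (f df : R -> R) (c : R) N :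
  (forall t, is_derive t (1 : R) f (df t)) -> f 0 = 0 ->
  (forall t, 0 <= t <= 1 -> `|df t| <= c * t ^+ N) ->
  forall t, 0 <= t <= 1 -> `|f t| <= c * t ^+ N.+1 / N.+1%:R.
Proof.
move=> hf f0 hdf t /andP[t0 t1].
have key (e : R) : `|e| <= 1 -> e * f t <= c * t ^+ N.+1 / N.+1%:R.
  move=> e1; pose g := (c / N.+1%:R) *: (id ^+ N.+1) - e *: f.
  have hg x : is_derive x (1 : R) g (c * x ^+ N - e * df x).
    apply: is_derive_eq; rewrite /GRing.scale/=; field.
    by rewrite addrC natr1 pnatr_eq0.
  have [|x] := @MVT_segment _ g _ 0 t t0 (fun x _ => hg x).
    apply: continuous_subspaceT => x; apply: differentiable_continuous.
    by apply/derivable1_diffP; case: (hg x).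
  rewrite in_itv/= => /andP[x0 xt].
  rewrite {1 2}/g /= !fctE /GRing.scale/= f0 expr0n/= !mulr0 !subr0 => h.
  have : 0 <= (c * x ^+ N - e * df x) * t.
    rewrite mulr_ge0// subr_ge0 (le_trans (ler_norm _))// normrM.
    by rewrite (le_trans (ler_piMl _ e1))// hdf// x0 (le_trans xt).
  rewrite -h => {}h; rewrite -subr_ge0; move: h; congr (_ <= _).
  by rewrite mulrAC.
rewrite ler_norml; apply/andP; split.
  by rewrite lerNl -mulN1r key// normrN1.
by rewrite -[f t]mul1r key// normr1.
Qed.

(** The pair (u N, v N) models the real and imaginary parts of the N-th Taylor remainder of exp ((a
    + i b) t). Each pair differentiates to a linear combination of the preceding one, so N
    integrations of a bounded function produce the factor t^N / N!. *)
Lemma linear_ode_bound (u v : nat -> R -> R) (a b M : R) :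
  (forall N t, is_derive t (1 : R) (u N.+1) (a * u N t - b * v N t)) ->
  (forall N t, is_derive t (1 : R) (v N.+1) (a * v N t + b * u N t)) ->
  (forall N, u N.+1 0 = 0) -> (forall N, v N.+1 0 = 0) ->
  (forall t, 0 <= t <= 1 -> `|u 0%N t| <= M) ->
  (forall t, 0 <= t <= 1 -> `|v 0%N t| <= M) ->
  forall N t, 0 <= t <= 1 ->
    `|u N t| <= M * (`|a| + `|b|) ^+ N / N`!%:R * t ^+ N /\
    `|v N t| <= M * (`|a| + `|b|) ^+ N / N`!%:R * t ^+ N.
Proof.
move=> du dv u0 v0 hu hv; elim=> [|N IH] t ht.
  by rewrite !expr0 !mulr1 fact0 divr1; split; [exact: hu|exact: hv].
set K := `|a| + `|b|.
have -> : M * K ^+ N.+1 / N.+1`!%:R * t ^+ N.+1 =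
    (M * K ^+ N.+1 / N`!%:R) * t ^+ N.+1 / N.+1%:R.
  rewrite factS natrM; field.
  by rewrite addrC natr1 !pnatr_eq0 /= -lt0n fact_gt0.
have key (x y A : R) : `|x| <= A -> `|y| <= A -> `|a * x + b * y| <= K * A.
  move=> hx hy; rewrite (le_trans (ler_normD _ _))// !normrM mulrDl.
  by rewrite lerD// ler_wpM2l.
split.
  apply: derive_pow_bound (du N) (u0 N) _ t ht => x /IH[h1 h2].
  rewrite -mulrN (le_trans (key _ _ _ h1 _)) ?normrN//.
  by rewrite exprS le_eqVlt; apply/orP; left; apply/eqP; rewrite -/K; ring.
apply: derive_pow_bound (dv N) (v0 N) _ t ht => x /IH[h1 h2].
rewrite (le_trans (key _ _ _ h2 _))//.
by rewrite exprS le_eqVlt; apply/orP; left; apply/eqP; rewrite -/K; ring.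
Qed.


(** The exponential is followed along t w for t in [0, 1]; at t = 1 the remainder is bounded by a
    multiple of the N-th term of a real exponential series, which tends to 0. *)
Lemma cexp_series (w : C) :
  series (fun m => m`!%:R^-1 * w ^+ m) @ \oo --> cexp w.
Proof.
set a := complex.Re w; set b := complex.Im w.
pose z m : C := m`!%:R^-1 * w ^+ m.
pose p m := complex.Re (z m); pose r m := complex.Im (z m).
have zS m : m.+1%:R * z m.+1 = w * z m.
  rewrite /z factS natrM exprS; field.
  by rewrite addrC natr1 !pnatr_eq0 /= -lt0n fact_gt0.
have ReM (x y : C) : complex.Re (x * y)
    = complex.Re x * complex.Re y - complex.Im x * complex.Im y.
  by case: x y => ? ? [].
have ImM (x y : C) : complex.Im (x * y)
    = complex.Re x * complex.Im y + complex.Im x * complex.Re y.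
  by case: x y => ? ? [].
have natC m : m%:R = (m%:R : R)%:C :> C by rewrite rmorph_nat.
have pS m : m.+1%:R * p m.+1 = a * p m - b * r m.
  by rewrite /p -ReM -zS ReM natC /= mul0r subr0.
have rS m : m.+1%:R * r m.+1 = a * r m + b * p m.
  by rewrite /r -ImM -zS ImM natC /= mul0r addr0.
(* Real part of the N-th remainder at t w; [v] is the imaginary part. *)
pose u N (t : R) := expR (a * t) * cos (b * t) - \sum_(m < N) p m * t ^+ m.
pose v N (t : R) := expR (a * t) * sin (b * t) - \sum_(m < N) r m * t ^+ m.
have dlin (c : R) (t : R) : is_derive t (1 : R) (fun t => c * t) c.
  rewrite [X in is_derive _ _ X](_ : _ = c *: id)//.
  by apply: is_derive_eq; rewrite /GRing.scale/= mulr1.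
have dexp t := is_derive1_comp (is_derive_expR (a * t)) (dlin a t).
have dcos t := is_derive1_comp (is_derive_cos (b * t)) (dlin b t).
have dsin t := is_derive1_comp (is_derive_sin (b * t)) (dlin b t).
have du N t : is_derive t (1 : R) (u N.+1) (a * u N t - b * v N t).
  have h := is_deriveB (is_deriveM (dexp t) (dcos t)) (is_derive_powsum p N t).
  apply: (@is_derive_eq _ _ _ _ _ _ _ _ h).
  under eq_bigr do rewrite pS mulrBl -!mulrA.
  by rewrite sumrB -!mulr_sumr /u /v /GRing.scale/=; ring.
have dv N t : is_derive t (1 : R) (v N.+1) (a * v N t + b * u N t).
  have h := is_deriveB (is_deriveM (dexp t) (dsin t)) (is_derive_powsum r N t).
  apply: (@is_derive_eq _ _ _ _ _ _ _ _ h).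
  under eq_bigr do rewrite rS mulrDl -!mulrA.
  by rewrite big_split -!mulr_sumr /u /v /GRing.scale/=; ring.
have z0 : z 0%N = 1 by rewrite /z expr0 fact0 invr1 mulr1.
have u0 N : u N.+1 0 = 0.
  rewrite /u !mulr0 expR0 cos0 mulr1 big_ord_recl expr0 big1 => [|i _].
    by rewrite /p z0 /= mulr1 addr0 subrr.
  by rewrite expr0n mulr0.
have v0 N : v N.+1 0 = 0.
  rewrite /v !mulr0 expR0 sin0 mulr0 big_ord_recl expr0 big1 => [|i _].
    by rewrite /r z0 /= mul0r addr0 subr0.
  by rewrite expr0n mulr0.
pose M := expR `|a|.
have hM t : 0 <= t <= 1 -> expR (a * t) <= M.
  move=> /andP[t0 t1]; rewrite ler_expR (le_trans (ler_norm _))// normrM.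
  by rewrite (ger0_norm t0) ler_piMr.
have hu t : 0 <= t <= 1 -> `|u 0%N t| <= M.
  move=> ht; rewrite /u big_ord0 subr0 normrM ger0_norm ?expR_ge0//.
  by rewrite (le_trans _ (hM t ht))// ler_piMr ?expR_ge0// ler_norml cos_geN1 cos_le1.
have hv t : 0 <= t <= 1 -> `|v 0%N t| <= M.
  move=> ht; rewrite /v big_ord0 subr0 normrM ger0_norm ?expR_ge0//.
  by rewrite (le_trans _ (hM t ht))// ler_piMr ?expR_ge0// ler_norml sin_geN1 sin_le1.
have bound N := linear_ode_bound du dv u0 v0 hu hv N (t := 1).
set K := `|a| + `|b|.
have c0 : (fun N => 2 * M * exp_coeff K N) @ \oo --> (0 : R).
  rewrite -(mulr0 (2 * M)); apply: cvgM; first exact: cvg_cst.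
  by apply: cvg_series_cvg_0; exact: is_cvg_series_exp_coeff.
apply/cvg_nmP => e e0.
have /cvgrPdist_lt/(_ e e0) := c0; apply: filterS => N.
rewrite sub0r normrN => hN; apply: le_lt_trans (le_lt_trans (ler_norm _) hN).
have [h1 h2] : `|u N 1| <= M * K ^+ N / N`!%:R * 1 ^+ N /\
               `|v N 1| <= M * K ^+ N / N`!%:R * 1 ^+ N.
  by apply: bound; rewrite ler01 lexx.
have ReB (x y : C) : complex.Re (x - y) = complex.Re x - complex.Re y.
  by case: x y => ? ? [].
have ImB (x y : C) : complex.Im (x - y) = complex.Im x - complex.Im y.
  by case: x y => ? ? [].
have SE : series z N = \sum_(m < N) z m by rewrite /series/= big_mkord.
have ReS : complex.Re (cexp w - series z N) = u N 1.
  rewrite /u !mulr1 ReB SE raddf_sum; congr (_ - _).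
    by rewrite {1}/cexp ReM /= mul0r subr0.
  by apply: eq_bigr => i _; rewrite expr1n mulr1.
have ImS : complex.Im (cexp w - series z N) = v N 1.
  rewrite /v !mulr1 ImB SE raddf_sum; congr (_ - _).
    by rewrite {1}/cexp ImM /= mul0r addr0.
  by apply: eq_bigr => i _; rewrite expr1n mulr1.
rewrite nmB (le_trans (nm_le_ReIm _))// ReS ImS.
have -> : 2 * M * exp_coeff K N = M * K ^+ N / N`!%:R * 1 ^+ N + M * K ^+ N / N`!%:R * 1 ^+ N.
  by rewrite expr1n !mulr1 -mulr2n -[RHS]mulr_natl !mulrA.
exact: lerD.
Qed.

(** Since 2^m <= (m + 1)!, the terms after the constant 1 are dominated by 2 |w| 2^-m. Continuity at
    0 is enough for continuity everywhere, by the addition formula. *)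
Lemma cexp_lip : exists2 L : R, 0 < L &
  forall w : C, nm w <= 1 -> nm (cexp w - 1) <= L * nm w.
Proof.
exists 4 => // w w1; rewrite leNgt; apply/negP => hlt.
have [w0|w0] := eqVneq w 0; first by rewrite w0 cexp0 subrr nm0 mulr0 ltxx in hlt.
have /cvg_nmP := @cexp_series w; move=> /(_ (nm (cexp w - 1) - 4 * nm w)).
rewrite subr_gt0 => /(_ hlt)[N _ hN].
have : nm (\sum_(0 <= m < maxn N 1) m`!%:R^-1 * w ^+ m - cexp w) <
    nm (cexp w - 1) - 4 * nm w := hN (maxn N 1) (leq_maxl _ _).
rewrite nmB ltNge => /negP; apply.
rewrite (@big_cat_nat _ _ _ 1) ?leq_maxr// big_nat1 fact0 invr1 mul1r expr0.
set T := \sum_(_ <= _ < _) _.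
suff : nm T <= 4 * nm w.
  move=> hT; have -> : cexp w - (1 + T) = (cexp w - 1) - T by ring.
  have : nm (cexp w - 1) <= nm (cexp w - 1 - T) + nm T.
    by rewrite -{1}(subrK T (cexp w - 1)) nmD.
  lra.
rewrite (le_trans (ler_nm_sum _ _ _))//.
apply: le_trans (_ : \sum_(1 <= m < maxn N 1) 2 * nm w * 2^-1 ^+ m <= _); last first.
  rewrite -mulr_sumr; have := @geom_tail (2^-1) 1 (maxn N 1).
  rewrite expr1 lexx invr_ge0 ler0n => /(_ isT) h.
  have : 2 * nm w * \sum_(1 <= i < maxn N 1) 2^-1 ^+ i <= 2 * nm w * (2 * 2^-1).
    by rewrite ler_wpM2l// mulr_ge0 ?nm_ge0.
  by rewrite divff// mulr1 => h1; rewrite (le_trans h1)// ler_wpM2r ?nm_ge0// ler_nat.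
rewrite big_seq [leRHS]big_seq; apply: ler_sum => m; rewrite mem_index_iota => /andP[m0 _].
rewrite nmM nmX nmV.
have -> : nm m`!%:R = m`!%:R by rewrite -(rmorph_nat (real_complex R)) nm_real normr_nat.
case: m m0 => // m _; rewrite exprS mulrCA.
have h2 : (2 ^ m <= m.+1`!)%N.
  elim: m => // m IH; rewrite expnS factS; apply: leq_mul => //.
have -> : 2 * nm w * 2^-1 ^+ m.+1 = nm w * 2^-1 ^+ m :> R by rewrite exprS; field.
rewrite ler_wpM2l ?nm_ge0//.
apply: le_trans (_ : (m.+1)`!%:R^-1 * 1 <= _).
  by rewrite ler_wpM2l ?invr_ge0// exprn_ile1// nm_ge0.
by rewrite mulr1 exprVn lef_pV2 ?posrE ?exprn_gt0 ?ltr0n ?fact_gt0// -natrX ler_nat.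
Qed.

Lemma cexp_continuous (z0 : C) : cexp z @[z --> z0] --> cexp z0.
Proof.
have [L L0 hL] := cexp_lip.
have FF : Filter (nbhs z0) := nbhs_filter z0.
apply/(@cvg_nmP _ (nbhs z0) FF) => e e0.
have nz : 0 < nm (cexp z0) by rewrite nm_gt0 cexp_neq0.
have h : 0 < Num.min 1 (e / (nm (cexp z0) * L)).
  by rewrite lt_min ltr01 divr_gt0// mulr_gt0.
apply/nbhs_nmP; exists (Num.min 1 (e / (nm (cexp z0) * L))) => // z.
rewrite lt_min ltr_pdivlMr ?mulr_gt0// => /andP[z1 z2].
have -> : cexp z - cexp z0 = cexp z0 * (cexp (z - z0) - 1).
  by rewrite mulrBr -cexpD mulr1 [z0 + _]addrC subrK.
rewrite nmM; apply: le_lt_trans z2.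
rewrite [leRHS]mulrC -mulrA ler_wpM2l ?nm_ge0//.
by rewrite hL// ltW.
Qed.

Lemma cexp_affine_continuous (K al be z0 : C) :
  K * cexp (al * z + be) @[z --> z0] --> K * cexp (al * z0 + be).
Proof.
have FF : Filter (nbhs z0) := nbhs_filter z0.
apply: (@cvgM _ _ (nbhs z0) FF _ _ _ _ (cvg_cst K)).
apply: (@cvg_comp _ _ _ (fun z => al * z + be) cexp _ (nbhs (al * z0 + be))).
  apply: (@cvgD _ _ _ (nbhs z0) FF); last exact: cvg_cst.
  apply: (@cvgM _ _ (nbhs z0) FF); [exact: cvg_cst|exact: cvg_id].
exact: cexp_continuous.
Qed.


(** * Inversion of a convergent power series *)

Section Reciprocal.
Context (b : nat -> C).

(** Course-of-values recursion for the coefficients of 1 / b: the list carries all earlier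
    coefficients, on which the next one depends. *)
Fixpoint recip_seq (N : nat) : seq C :=
  if N is N'.+1 then
    let s := recip_seq N' in
    rcons s (- (b 0%N)^-1 * \sum_(i < N) b i.+1 * s`_(N' - i))
  else [:: (b 0%N)^-1].

Definition recip (m : nat) : C := (recip_seq m)`_m.

Lemma size_recip_seq N : size (recip_seq N) = N.+1.
Proof. by elim: N => //= N IH; rewrite size_rcons IH. Qed.

Lemma nth_recip_seq N m : (m <= N)%N -> (recip_seq N)`_m = recip m.
Proof.
elim: N => [|N IH]; first by rewrite leqn0 => /eqP ->.
rewrite leq_eqVlt => /orP[/eqP -> //|mN].
by rewrite /= nth_rcons size_recip_seq mN IH.
Qed.

Lemma recipS N :
  recip N.+1 = - (b 0%N)^-1 * \sum_(0 <= i < N.+1) b i.+1 * recip (N - i).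
Proof.
rewrite /recip /= nth_rcons size_recip_seq ltnn eqxx big_mkord; congr (_ * _).
by apply: eq_bigr => i _; rewrite nth_recip_seq// leq_subr.
Qed.

(** The Cauchy product of b with its formal inverse, cut off to the triangle i + j <= N; the new
    diagonal vanishes by the recursion. *)
Lemma recip_conv (w : C) N : b 0%N != 0 ->
  \sum_(0 <= i < N.+1) \sum_(0 <= j < N.+1 - i) (b i * w ^+ i) * (recip j * w ^+ j) = 1.
Proof.
move=> b0; elim: N => [|N IH].
  by rewrite !big_nat1 /recip /= !expr0 !mulr1 divff.
rewrite big_nat_recr//= subSnn big_nat1.
rewrite (eq_big_nat _ _ (F2 := fun i => \sum_(0 <= j < N.+1 - i)
    (b i * w ^+ i) * (recip j * w ^+ j) + b i * recip (N.+1 - i) * w ^+ N.+1)).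
  rewrite big_split/= IH -addrA [X in _ + X](_ : _ = 0) ?addr0//.
  rewrite -mulr_suml big_nat_recl// subn0 recipS.
  under eq_bigr do rewrite subSS.
  rewrite big_nat_recr//= subnn expr0 mulr1.
  by have -> : recip 0 = (b 0%N)^-1; [by []|field].
move=> i /andP[_ iN]; rewrite (subSn (ltnW iN)) big_nat_recr//=; congr (_ + _).
by rewrite mulrACA -exprD subnKC// ltnW.
Qed.

(** The ratio K = 2 r (1 + M / |b 0|) makes r / K at most 1/2 and 2 (M / |b 0|) (r / K) at most 1,
    which is what the induction through the recursion consumes. *)
Lemma recip_bound (M r : R) : b 0%N != 0 -> 0 < r ->
  (forall m, nm (b m) <= M * r ^+ m) ->
  forall m, nm (recip m) <=
    (nm (b 0%N))^-1 * (2 * r * (1 + M / nm (b 0%N))) ^+ m.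
Proof.
move=> b0 r0 hb; set be := nm (b 0%N); set K := _ * (1 + _).
have be0 : 0 < be by rewrite nm_gt0.
have M0 : 0 <= M by have := hb 0%N; rewrite mulr1; apply: le_trans (nm_ge0 _).
have h1 : 1 <= 1 + M / be by rewrite lerDl divr_ge0// ltW.
have K0 : 0 < K by rewrite !mulr_gt0// (lt_le_trans ltr01).
have rK : 0 <= r / K <= 2^-1.
  rewrite divr_ge0 ?(ltW r0) ?(ltW K0)//= ler_pdivrMr// /K; nra.
elim/ltn_ind => -[_|m IH]; first by rewrite /recip/= nmV expr0 mulr1.
rewrite recipS big_mkord nmM nmN nmV ler_wpM2l ?invr_ge0 ?nm_ge0//.
rewrite (le_trans (ler_nm_sum _ _ _))//.
apply: le_trans (_ : \sum_(i < m.+1) (M / be * K ^+ m.+1) * (r / K) ^+ i.+1 <= _).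
  apply: ler_sum => i _; rewrite nmM.
  have -> : M / be * K ^+ m.+1 * (r / K) ^+ i.+1 =
      (M * r ^+ i.+1) * (be^-1 * K ^+ (m - i)).
    rewrite -[in K ^+ m.+1](subnKC (ltn_ord i)) exprD expr_div_n subSS; field.
    by rewrite gt_eqF// expf_neq0// gt_eqF.
  apply: ler_pM => //; rewrite ?nm_ge0 ?hb// IH//.
  by rewrite ltnS leq_subr.
rewrite -mulr_sumr -(big_mkord xpredT (fun i => (r / K) ^+ i.+1)).
rewrite -(big_add1 _ _ 0 m.+2 xpredT (fun i => (r / K) ^+ i)).
apply: le_trans (_ : M / be * K ^+ m.+1 * (2 * (r / K) ^+ 1) <= _).
  rewrite ler_wpM2l ?geom_tail//.
  by rewrite mulr_ge0 ?divr_ge0// ?exprn_ge0// ltW.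
rewrite mulrAC ler_piMl ?exprn_ge0 ?(ltW K0)//.
rewrite expr1 !mulrA ler_pdivrMr// mul1r /K; nra.
Qed.

(** With 4 K |w| <= 1 the terms of both series are dominated by 4^-m. The product of the partial
    sums then tends to 1, and dividing by l gives the limit of the inverse series. *)
Lemma recip_series (M r : R) (w l : C) : b 0%N != 0 -> 0 < r ->
  (forall m, nm (b m) <= M * r ^+ m) ->
  4 * (2 * r * (1 + M / nm (b 0%N))) * nm w <= 1 ->
  series (fun m => b m * w ^+ m) @ \oo --> l ->
  series (fun m => recip m * w ^+ m) @ \oo --> l^-1.
Proof.
move=> b0 r0 hb; have hc := recip_bound b0 r0 hb.
move: hc; set be := nm (b 0%N); set K := _ * (1 + _) => hc hw hl.
have be0 : 0 < be by rewrite nm_gt0.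
have M0 : 0 <= M by have := hb 0%N; rewrite mulr1; apply: le_trans (nm_ge0 _).
have h1 : 1 <= 1 + M / be by rewrite lerDl divr_ge0// ltW.
have K0 : 0 < K by rewrite !mulr_gt0// (lt_le_trans ltr01).
have w0 := nm_ge0 w.
have rK : r <= K by rewrite /K; nra.
have hx : 0 <= K * nm w <= 4^-1.
  rewrite mulr_ge0 ?(ltW K0)//=; lra.
have hcw m : nm (recip m * w ^+ m) <= be^-1 * 4^-1 ^+ m.
  rewrite nmM nmX; apply: le_trans (_ : be^-1 * K ^+ m * nm w ^+ m <= _).
    by rewrite ler_wpM2r// exprn_ge0.
  rewrite -mulrA -exprMn ler_wpM2l ?invr_ge0 ?(ltW be0)//.
  by apply: lerXn2r; rewrite ?nnegrE//; case/andP: hx.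
have hbw m : nm (b m * w ^+ m) <= M * 4^-1 ^+ m.
  rewrite nmM nmX; apply: le_trans (_ : M * r ^+ m * nm w ^+ m <= _).
    by rewrite ler_wpM2r// exprn_ge0.
  rewrite -mulrA -exprMn ler_wpM2l//.
  apply: lerXn2r; rewrite ?nnegrE// ?mulr_ge0 ?(ltW r0)//.
  by case/andP: hx => _; apply: le_trans; rewrite ler_wpM2r.
set B := series _ in hl; set G := series _.
have half (N : nat) : \sum_(0 <= i < N) 2^-1 ^+ i <= 2 :> R.
  have := @geom_tail (2^-1) 0 N; rewrite expr0 mulr1 => -> //.
  by rewrite lexx invr_ge0 ler0n.
have Gb N : nm (G N) <= be^-1 * 2.
  rewrite /G /series/= (le_trans (ler_nm_sum _ _ _))//.
  apply: le_trans (_ : \sum_(0 <= i < N) be^-1 * 2^-1 ^+ i <= _).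
    apply: ler_sum => i _; rewrite (le_trans (hcw i))// ler_wpM2l ?invr_ge0 ?(ltW be0)//.
    by apply: lerXn2r; rewrite ?nnegrE; lra.
  by rewrite -mulr_sumr ler_wpM2l ?invr_ge0 ?(ltW be0).
(* The error is the sum over the square minus the triangle. There i + j >= N + 1, and splitting
   4^-(i + j) into two powers of 1/2 leaves a factor 2^-(N + 1) and a summable double series. *)
have E N : nm (B N.+1 * G N.+1 - 1) <= 4 * (M / be) * 2^-1 ^+ N.+1.
  rewrite -(recip_conv w N b0) /B /G /series/= mulr_suml.
  under [X in X - _]eq_bigr do rewrite mulr_sumr.
  rewrite -sumrB.
  rewrite (eq_big_nat _ _ (F2 := fun i => \sum_(N.+1 - i <= j < N.+1)
      (b i * w ^+ i) * (recip j * w ^+ j))); last first.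
    move=> i /andP[_ iN]; rewrite (@big_cat_nat _ _ _ (N.+1 - i)) ?leq_subr//.
    by rewrite addrC addKr.
  rewrite (le_trans (ler_nm_sum _ _ _))//.
  apply: le_trans (_ : \sum_(0 <= i < N.+1) (M / be * 2^-1 ^+ N.+1 * 2) * 2^-1 ^+ i <= _).
    rewrite big_nat [leRHS]big_nat; apply: ler_sum => i /andP[_ iN].
    rewrite (le_trans (ler_nm_sum _ _ _))//.
    apply: le_trans (_ : \sum_(N.+1 - i <= j < N.+1)
        (M / be * 2^-1 ^+ N.+1 * 2^-1 ^+ i) * 2^-1 ^+ j <= _).
      rewrite big_nat [leRHS]big_nat; apply: ler_sum => j /andP[ij jN].
      rewrite nmM; apply: le_trans (ler_pM (nm_ge0 _) (nm_ge0 _) (hbw i) (hcw j)) _.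
      have -> : M * 4^-1 ^+ i * (be^-1 * 4^-1 ^+ j) = M / be * 4^-1 ^+ (i + j).
        by rewrite exprD; field; rewrite gt_eqF.
      rewrite -!mulrA ler_wpM2l// ler_wpM2l ?invr_ge0 ?(ltW be0)//.
      rewrite -exprD (_ : 4^-1 = 2^-1 * 2^-1); last by field.
      rewrite exprMn ler_wpM2r ?exprn_ge0 ?invr_ge0//.
      have ijN : (N.+1 <= i + j)%N by rewrite -leq_subLR.
      by apply: ler_wiXn2l => //; rewrite ?invr_ge0 ?ler0n ?invf_le1 ?ler1n.
    rewrite -mulr_sumr [leRHS]mulrAC ler_wpM2l//.
      by rewrite !mulr_ge0 ?divr_ge0 ?exprn_ge0 ?invr_ge0 ?(ltW be0).
    have := @geom_tail (2^-1) (N.+1 - i) N.+1; rewrite lexx invr_ge0 ler0n => /(_ isT) h.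
    by rewrite (le_trans h)// ler_piMr// exprn_ile1 ?invr_ge0 ?ler0n ?invf_le1 ?ler1n.
  rewrite -mulr_sumr; have -> : 4 * (M / be) * 2^-1 ^+ N.+1 =
    M / be * 2^-1 ^+ N.+1 * 2 * 2 by ring.
  by rewrite ler_wpM2l// !mulr_ge0 ?divr_ge0 ?exprn_ge0 ?invr_ge0 ?(ltW be0).
have BG1 : (fun N => B N * G N) @ \oo --> (1 : C).
  apply/cvg_nmP => e e0.
  have /cvgrPdist_lt/(_ e e0) : (fun N => 4 * (M / be) * 2^-1 ^+ N) @ \oo --> (0 : R).
    rewrite -(mulr0 (4 * (M / be))); apply: cvgM; first exact: cvg_cst.
    by apply: cvg_expr; rewrite gtr0_norm ?invr_gt0 ?ltr0n// invf_lt1 ?ltr1n.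
  move=> [N0 _ hN0]; exists N0.+1 => // -[//|N] hN.
  apply: le_lt_trans (E N) _; rewrite (le_lt_trans _ (hN0 N.+1 _))//; last exact: ltnW.
  by rewrite /= sub0r normrN ler_norm.
(* The inverse series has bounded partial sums, so l = 0 would make the products tend to 0 instead
   of 1. *)
have l0 : l != 0.
  apply/eqP => l0; have /cvg_nmP/(_ (2^-1)) := BG1.
  rewrite invr_gt0 ltr0n => /(_ isT)[N1 _ hN1].
  have /cvg_nmP/(_ (be / 8)) := hl; rewrite divr_gt0// l0 => /(_ isT)[N2 _ hN2].
  have := hN1 (maxn N1 N2) (leq_maxl _ _); have := hN2 (maxn N1 N2) (leq_maxr _ _).
  rewrite /= subr0; move: (maxn _ _) => N hB hBG.
  have : nm (B N * G N) <= be / 8 * (be^-1 * 2).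
    by rewrite nmM ler_pM ?nm_ge0// ltW.
  rewrite (_ : be / 8 * (be^-1 * 2) = 4^-1) => [h|]; last by field; rewrite gt_eqF.
  have := nmD (B N * G N) (1 - B N * G N); rewrite addrC subrK nm1 nmB.
  lra.
have -> : G = (fun N => l^-1 * (B N * G N + (l - B N) * G N)).
  by apply/funext => N; rewrite -mulrDl addrC subrK mulKf.
suff lBG : (fun N => (l - B N) * G N) @ \oo --> (0 : C).
  apply: (cseq_eq (cseqZ (c := l^-1) (cseqD BG1 lBG))) => [N|]; first by [].
  by rewrite addr0 mulr1.
apply/cvg_nmP => e e0; have /cvg_nmP/(_ (e * be / 2)) := hl.
rewrite divr_gt0 ?mulr_gt0// => /(_ isT); apply: filterS => N hN.
rewrite subr0 nmM nmB (le_lt_trans (ler_wpM2l (nm_ge0 _) (Gb N)))//.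
rewrite -ltr_pdivlMr ?mulr_gt0 ?invr_gt0// (lt_le_trans hN)// le_eqVlt.
by apply/orP; left; apply/eqP; field; rewrite gt_eqF.
Qed.

End Reciprocal.


(** * Sums of two exponentials and their reciprocals *)

Lemma exp2_series (K1 a1 K2 a2 z0 z : C) :
  series (fun m => (K1 * cexp (a1 * z0) * a1 ^+ m + K2 * cexp (a2 * z0) * a2 ^+ m)
                     / m`!%:R * (z - z0) ^+ m) @ \oo
  --> K1 * cexp (a1 * z) + K2 * cexp (a2 * z).
Proof.
have zE a : cexp (a * z) = cexp (a * z0) * cexp (a * (z - z0)).
  by rewrite -cexpD mulrBr addrC subrK.
have h K a : (fun N : nat => K * cexp (a * z0) * series (fun m => m`!%:R^-1 * (a * (z - z0)) ^+ m) N)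
    @ \oo --> K * cexp (a * z0) * cexp (a * (z - z0)).
  by apply: cseqZ; exact: cexp_series.
apply: (cseq_eq (cseqD (h K1 a1) (h K2 a2))) => [N|].
  rewrite /series/= !big_distrr/= -big_split/=.
  by apply: eq_bigr => i _; rewrite !exprMn; ring.
by rewrite !zE !mulrA.
Qed.

Lemma meromorphic_exp2 (K1 a1 K2 a2 : C) :
  meromorphic (fun z => K1 * cexp (a1 * z) + K2 * cexp (a2 * z)).
Proof.
move=> z0; exists 0%N; eexists; apply/dnbhs_nmP; exists 1 => // z _.
rewrite expr0 mul1r; exact: exp2_series.
Qed.

Lemma series_unshift (b : nat -> C) (w l : C) :
  w != 0 -> b 0 = 0 -> series (fun m => b m * w ^+ m) @ \oo --> l ->
  series (fun m => b m.+1 * w ^+ m) @ \oo --> l / w.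
Proof.
move=> w0 b0 h.
apply: (cseq_eq (cseqZ (c := w^-1) (cseqS h))) => [N|]; last exact: mulrC.
rewrite /series/= big_nat_recl// b0 mul0r add0r big_distrr/=.
by apply: eq_bigr => i _; rewrite exprS; field.
Qed.

(** The sum has at most simple zeros: if it vanishes at z0, its derivative there is K1 e^(a1 z0) (a1
    - a2). After division by z - z0 where needed, the power series can be inverted. *)
Lemma meromorphic_inv_exp2 (K1 a1 K2 a2 : C) : K1 != 0 -> a1 != a2 ->
  meromorphic (fun z => (K1 * cexp (a1 * z) + K2 * cexp (a2 * z))^-1).
Proof.
move=> K10 a12 z0.
pose b m : C := (K1 * cexp (a1 * z0) * a1 ^+ m + K2 * cexp (a2 * z0) * a2 ^+ m) / m`!%:R.
pose h z := K1 * cexp (a1 * z) + K2 * cexp (a2 * z).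
have hb z : series (fun m => b m * (z - z0) ^+ m) @ \oo --> h z.
  exact: exp2_series.
suff [k [c [c0 hc]]] : exists k (c : nat -> C), c 0%N != 0 /\
    forall z, z != z0 ->
      series (fun m => c m * (z - z0) ^+ m) @ \oo --> h z / (z - z0) ^+ k.
  (* Convergence at distance 1 from z0 bounds all coefficients by one constant M, so the inversion
     applies with r = 1. *)
  have h1 : z0 + 1 != z0 by rewrite -subr_eq0 addrAC subrr add0r oner_eq0.
  have [M M0 hM] := series_bound (hc _ h1).
  exists k, (recip c); apply/dnbhs_nmP.
  set K := 4 * (2 * 1 * (1 + M / nm (c 0%N))).
  have K0 : 0 < K.
    by rewrite !mulr_gt0// ltr_pwDl// divr_ge0 ?nm_ge0// ltW.
  exists K^-1; first by rewrite invr_gt0.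
  move=> z /andP[]; rewrite nm_gt0 subr_eq0 => zz0 hz.
  have := @recip_series c M 1 (z - z0) (h z / (z - z0) ^+ k) c0 ltr01.
  rewrite invf_div; apply; last exact: hc.
    move=> m; rewrite expr1n mulr1; have := hM m.
    by rewrite addrAC subrr add0r nm1 expr1n mulr1.
  by rewrite -/K mulrC -ler_pdivlMr// mul1r ltW.
have [b0|b0] := eqVneq (b 0%N) 0; last first.
  exists 0%N, b; split=> [|z _]; first exact: b0.
  by rewrite expr0 divr1; exact: hb.
exists 1%N, (fun m => b m.+1); split => [|z zz0]; last first.
  by rewrite expr1; apply: series_unshift => //; rewrite subr_eq0.
(* The vanishing value expresses the first exponential term through the second, which turns the
   first-order coefficient into a multiple of a1 - a2. *)
move: b0; rewrite /b fact0 !expr0 !mulr1 divr1 => /eqP; rewrite addr_eq0 => /eqP b0.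
rewrite !expr1 (_ : 1`! = 1%N)// divr1 b0 mulNr addrC -mulrBr mulf_eq0 subr_eq0.
rewrite negb_or [a2 == a1]eq_sym a12 andbT -oppr_eq0 -b0 mulf_eq0 negb_or K10.
exact: cexp_neq0.
Qed.


Lemma cvg_dnbhs (f : C -> C) (s l : C) :
  f z @[z --> s] --> l -> f z @[z --> s^'] --> l.
Proof. by move=> h; apply: cvg_trans h; apply: cvg_app; exact: nbhs_dnbhs. Qed.

Lemma exp2_cvg (K1 a1 K2 a2 s : C) :
  K1 * cexp (a1 * z) + K2 * cexp (a2 * z) @[z --> s^'] -->
  K1 * cexp (a1 * s) + K2 * cexp (a2 * s).
Proof.
apply: cvg_dnbhs; have FF : Filter (nbhs s) := nbhs_filter s.
have h K a : K * cexp (a * z) @[z --> s] --> K * cexp (a * s).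
  have := @cexp_affine_continuous K a 0 s; rewrite addr0.
  by have -> : (fun z => K * cexp (a * z + 0)) = (fun z => K * cexp (a * z));
    [apply/funext => z; rewrite addr0|].
exact: (@cvgD _ _ _ (nbhs s) FF _ _ _ _ (h K1 a1) (h K2 a2)).
Qed.

Lemma exp_cvg (K a s : C) :
  K * cexp (a * z) @[z --> s^'] --> K * cexp (a * s).
Proof.
have := @exp2_cvg K a 0 0 s; rewrite mul0r addr0.
by have -> : (fun z => K * cexp (a * z) + 0 * cexp (0 * z)) =
  (fun z => K * cexp (a * z)); [apply/funext => z; rewrite mul0r addr0|].
Qed.

Lemma inv_exp2_cvg (K1 a1 K2 a2 s : C) :
  K1 * cexp (a1 * s) + K2 * cexp (a2 * s) != 0 ->
  (K1 * cexp (a1 * z) + K2 * cexp (a2 * z))^-1 @[z --> s^'] -->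
  (K1 * cexp (a1 * s) + K2 * cexp (a2 * s))^-1.
Proof. move=> h; apply: cvgV => //; exact: exp2_cvg. Qed.

Lemma mcont_exp2 (U : set C) (g : C -> C) (sigma : R) (K1 a1 K2 a2 s : C) :
  (forall z, sigma < complex.Re z -> U z) ->
  (forall z, U z -> g z = K1 * cexp (a1 * z) + K2 * cexp (a2 * z)) ->
  mcont U g s = K1 * cexp (a1 * s) + K2 * cexp (a2 * s).
Proof.
move=> hU hg.
apply: (mcontE (H := fun z => K1 * cexp (a1 * z) + K2 * cexp (a2 * z)) hU) => //.
  exact: meromorphic_exp2.
exact: exp2_cvg.
Qed.

Lemma mcont_inv_exp2 (U : set C) (g : C -> C) (sigma : R) (K1 a1 K2 a2 s : C) :
  (forall z, sigma < complex.Re z -> U z) -> K1 != 0 -> a1 != a2 ->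
  K1 * cexp (a1 * s) + K2 * cexp (a2 * s) != 0 ->
  (forall z, U z -> g z = (K1 * cexp (a1 * z) + K2 * cexp (a2 * z))^-1) ->
  mcont U g s = (K1 * cexp (a1 * s) + K2 * cexp (a2 * s))^-1.
Proof.
move=> hU K10 a12 s0 hg.
apply: (mcontE (H := fun z => (K1 * cexp (a1 * z) + K2 * cexp (a2 * z))^-1) hU) => //.
  exact: meromorphic_inv_exp2.
exact: inv_exp2_cvg.
Qed.

End ComplexPlane.

(** * Valuations and units *)

Section Valuation.
Context {F : padicField}.
Local Notation v := (@pf_val F).
Local Notation w := (pf_unif F).

Lemma val1 : v 1 = 0.
Proof.
have := pf_valM (oner_neq0 F) (oner_neq0 F); rewrite mulr1 => /eqP.
by rewrite -subr_eq0 opprD addrA subrr sub0r oppr_eq0 => /eqP.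
Qed.

Lemma valN1 : v (-1) = 0.
Proof.
have n1 : (-1 : F) != 0 by rewrite oppr_eq0 oner_neq0.
have := pf_valM n1 n1; rewrite mulrNN mulr1 val1 => h; lia.
Qed.

Lemma valN (x : F) : v (- x) = v x.
Proof.
have [->|x0] := eqVneq x 0; first by rewrite oppr0.
by rewrite -mulN1r pf_valM ?oppr_eq0 ?oner_neq0// valN1 add0r.
Qed.

Lemma valV (x : F) : x != 0 -> v x^-1 = - v x.
Proof.
by move=> x0; have := pf_valM x0 (invr_neq0 x0); rewrite divff// val1; lia.
Qed.

Lemma valX (x : F) (k : nat) : x != 0 -> v (x ^+ k) = k%:Z * v x.
Proof.
move=> x0; elim: k => [|k IH]; first by rewrite expr0 val1 mul0r.
by rewrite exprS pf_valM ?expf_neq0// IH; lia.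
Qed.

Lemma valXz (x : F) (k : int) : x != 0 -> v (x ^ k) = k * v x.
Proof.
move=> x0; case: k => k; first exact: valX.
by rewrite NegzE -exprnN valV ?expf_neq0// valX// mulNr.
Qed.

Lemma unifXz_neq0 (k : int) : w ^ k != 0.
Proof. by rewrite expfz_neq0// pf_unif_neq0. Qed.

Lemma val_unifXz (k : int) : v (w ^ k) = k.
Proof. by rewrite valXz ?pf_unif_neq0// pf_val_unif mulr1. Qed.

Lemma pideal0 k : @pideal F k 0. Proof. by rewrite /pideal eqxx. Qed.

Lemma pidealE k (x : F) : x != 0 -> pideal k x = (k <= v x).
Proof. by move=> x0; rewrite /pideal (negbTE x0). Qed.

Lemma pidealN k (x : F) : pideal k (- x) = pideal k x.
Proof. by rewrite /pideal oppr_eq0 valN. Qed.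

Lemma pideal_le k l (x : F) : l <= k -> pideal k x -> pideal l x.
Proof. by move=> lk /orP[/eqP->|kx]; rewrite ?pideal0// /pideal (le_trans lk) ?orbT. Qed.

Lemma pidealD k (x y : F) : pideal k x -> pideal k y -> pideal k (x + y).
Proof.
have [->|x0] := eqVneq x 0; first by rewrite add0r.
have [->|y0] := eqVneq y 0; first by rewrite addr0.
have [->|xy0] := eqVneq (x + y) 0; first by rewrite pideal0.
rewrite !pidealE// => kx ky; apply: le_trans (pf_valD x0 y0 xy0).
by rewrite le_min kx.
Qed.

Lemma pidealB k (x y : F) : pideal k x -> pideal k y -> pideal k (x - y).
Proof. by move=> hx hy; rewrite pidealD// pidealN. Qed.

Lemma pidealDr k (x y : F) : pideal k y -> pideal k (x + y) = pideal k x.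
Proof.
move=> hy; apply/idP/idP => [h|/pidealD]; last exact.
by rewrite -(addrK y x) pidealB.
Qed.

Lemma pidealM k l (x y : F) : pideal k x -> pideal l y -> pideal (k + l) (x * y).
Proof.
have [->|x0] := eqVneq x 0; first by move=> _ _; rewrite mul0r pideal0.
have [->|y0] := eqVneq y 0; first by move=> _ _; rewrite mulr0 pideal0.
by rewrite !pidealE ?mulf_neq0// pf_valM// => kx ky; rewrite lerD.
Qed.

Lemma pidealMl k (b x : F) : b != 0 -> pideal k (b * x) = pideal (k - v b) x.
Proof.
move=> b0; rewrite /pideal mulf_eq0 (negbTE b0)/=.
by have [//|x0] := eqVneq x 0; rewrite pf_valM// lerBlDl.
Qed.

Lemma val_eq (x : F) (l : int) : x != 0 -> (v x == l) = pideal l x && ~~ pideal (l + 1) x.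
Proof. by move=> x0; rewrite !pidealE//; lia. Qed.

Lemma val_add (x y : F) : x != 0 -> pideal (v x + 1) y -> x + y != 0 /\ v (x + y) = v x.
Proof.
move=> x0 hy; have nx : ~~ pideal (v x + 1) x by rewrite pidealE//; lia.
have xy0 : x + y != 0.
  by apply: contraNneq nx => h; rewrite -(pidealDr _ hy) h pideal0.
have hy' : pideal (v x) y by apply: pideal_le hy; lia.
split=> //; apply/eqP; rewrite val_eq//.
by rewrite !pidealDr// nx pidealE ?lexx.
Qed.

Lemma ugroupP m (x : F) : ugroup m x -> x != 0 /\ v x = 0.
Proof.
case: m => [/andP[x0 /eqP]//|m]; rewrite /ugroup /= => h.
have [] := @val_add 1 (x - 1) (oner_neq0 F); first by rewrite val1; apply: pideal_le h; lia.
by rewrite addrC subrK val1.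
Qed.

Lemma ugroup0E (x : F) : ugroup 0 x = (x != 0) && (v x == 0). Proof. by []. Qed.

Lemma ugroup_le m k (x : F) : (k <= m)%N -> ugroup m x -> ugroup k x.
Proof.
move=> km h; have [x0 vx] := ugroupP h; case: k km => [|k] km.
  by rewrite ugroup0E x0 vx eqxx.
case: m h km => // m; rewrite /ugroup/= => h km; apply: pideal_le h; lia.
Qed.

Lemma ugroup_sub1 m (x : F) : ugroup m x -> pideal m%:Z (x - 1).
Proof.
case: m => [|m]; last by [].
rewrite ugroup0E => /andP[x0 /eqP vx]; rewrite pidealB//.
  by rewrite pidealE// vx.
by rewrite pidealE ?oner_neq0// val1.
Qed.

(** The residue system in boolean form: congruence to a representative becomes an equality test,
    which evaluates sums of indicators. *)
Lemma residue_reps : exists reps : seq F,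
  [/\ uniq reps, size reps = pf_q F, {in reps, forall r, pideal 0 r}
    & forall x, pideal 0 x -> exists2 r, r \in reps &
        forall r', r' \in reps -> pideal 1 (x - r') = (r' == r)].
Proof.
have [reps [u sz rO hx]] := pf_residue F; exists reps; split=> //.
  by move=> r /rO[->|h]; rewrite ?pideal0// /pideal h orbT.
move=> x xO; have [|r [[rr hr] runiq]] := hx x.
  by case/orP: xO => [/eqP|]; [left|right].
exists r => // r' rr'; apply/idP/eqP => [h|->].
  by apply/esym/runiq; split=> //; case/orP: h => [/eqP|]; [left|right].
by case: hr => h; rewrite /pideal; [rewrite h eqxx|rewrite h orbT].
Qed.

(** The residues of 0 and 1 are distinct. *)
Lemma q_gt1 : (1 < pf_q F)%N.
Proof.
have [reps [u sz _ h]] := residue_reps; rewrite -sz.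
have [r0 hr0 h0] := h 0 (pideal0 _).
have [r1 hr1 h1] : exists2 r, r \in reps & forall r', r' \in reps -> pideal 1 (1 - r') = (r' == r).
  by apply: h; rewrite pidealE ?oner_neq0// val1.
have r01 : r0 != r1.
  apply/eqP => r01; have : @pideal F 1 (1 - 0).
    have -> : (1 - 0 : F) = (1 - r1) - (0 - r0) by rewrite r01; ring.
    by rewrite pidealB ?h0 ?h1.
  by rewrite subr0 pidealE ?oner_neq0// val1.
case: reps {h sz u} hr0 hr1 {h0 h1} => // a [|b s //].
by rewrite !inE => /eqP e0 /eqP e1; rewrite e0 e1 eqxx in r01.
Qed.

End Valuation.

(** * The Hilbert symbol *)

(** A nonconstant divisor of least degree is irreducible. *)
Lemma irreducible_factor (K : fieldType) (p : {poly K}) : (1 < size p)%N ->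
  exists2 q : {poly K}, irreducible_poly q & q %| p.
Proof.
move=> p1; pose P d := `[< exists2 q : {poly K}, (size q == d) && (1 < d)%N & q %| p >].
have exP : exists d, P d.
  by exists (size p); apply/asboolP; exists p; rewrite ?eqxx.
case: (ex_minnP exP) => d /asboolP[q /andP[/eqP sq d1] qp] dmin.
exists q => //; split; first by rewrite sq.
move=> r r1 rq; have q0 : q != 0 by rewrite -size_poly_gt0 sq ltnW.
have r0 : (0 < size r)%N by rewrite size_poly_gt0; apply: dvdpN0 rq q0.
rewrite -dvdp_size_eqp// eqn_leq dvdp_leq// sq dmin//; apply/asboolP; exists r.
  by rewrite eqxx ltn_neqAle eq_sym r1.
exact: dvdp_trans rq qp.
Qed.

(* With [alpha ^+ n = a], the Galois group of [K(alpha)] embeds into the n-th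
   roots of unity through [sigma |-> sigma alpha / alpha], so its order [d]
   divides [n]; the norm of [alpha ^+ (n %/ d)] is [a] times a power of the
   product of the embedded group, which is 1 because that group has odd order. *)
Lemma kummer_norm (K : fieldType) (L : splittingFieldType K) (n : nat) (z a : K) (al : L) :
  odd n -> n.-primitive_root z -> a != 0 -> al ^+ n = a%:A ->
  <<1%VS; al>>%VS = fullv -> exists x : L, galNorm 1%VS {: L} x = a%:A.
Proof.
move=> n_odd prim_z a0 aln gen_al.
have n0 : (0 < n)%N by case: n n_odd {aln prim_z}.
have aA0 : (a%:A : L) != 0 by rewrite scaler_eq0 negb_or a0 oner_neq0.
have al0 : al != 0.
  by apply: contraNneq aA0 => e; rewrite -aln e expr0n eqn0Ngt n0.
pose zL : L := z%:A.
have prim_zL : n.-primitive_root zL.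
  by rewrite -(fmorph_primitive_root (in_alg L)) in prim_z.
pose G := ('Gal({:L} / 1%AS))%g.
pose f (s : gal_of {:L}) : L := s al / al.
have fal (s : gal_of {:L}) : s al = f s * al by rewrite /f divfK.
have sA (s : gal_of {:L}) (c : K) : s (c%:A : L) = c%:A.
  by rewrite linearZ/= rmorph1.
have fn (s : gal_of {:L}) : f s ^+ n = 1.
  by rewrite /f expr_div_n -rmorphXn/= aln sA divff.
(* The value [f s] is an n-th root of unity, hence lies in the base field; this makes the map f
   multiplicative. *)
have fF (s t : gal_of {:L}) : t (f s) = f s.
  have [i ->] := prim_rootP prim_zL (fn s).
  by rewrite rmorphXn/= sA.
have fM : {in G &, {morph f : s t / (s * t)%g >-> s * t}}.
  move=> s t _ _; rewrite {1}/f galM ?memvf// fal rmorphM/= fF fal.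
  by rewrite -!mulrA divff// mulr1 [in RHS]mulrC mulrC.
have gen : <<1%AS; al>>%AS = {:L}%AS :> {subfield L} by apply/val_inj.
have f1 : {in G, forall s, f s = 1 <-> s = 1%g}.
  move=> s sG; split=> [fs|->]; last by rewrite /f gal_id divff.
  apply/eqP/gal_eqP => x _; rewrite gal_id.
  have : x \in <<1%AS; al>>%VS by rewrite gen_al memvf.
  move=> /Fadjoin_polyP[r /polyOver1P[r' ->] ->].
  rewrite -horner_map/= fal fs mul1r; congr (_.[_]).
  by rewrite -map_poly_comp; apply: eq_map_poly => c /=; rewrite sA.
have cG := cyclic.field_mul_group_cyclic fM f1.


have /cyclic.cyclicP[s0 Gs0] := cG.
have {}Gs0 : G = fingroup.cycle s0 by exact: Gs0.
have s0G : s0 \in G by rewrite Gs0 fingroup.cycle_id.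
set d := #|G|.
have f_1 : f 1%g = 1 by apply/f1; rewrite ?fingroup.group1.
have fX k : f (s0 ^+ k)%g = f s0 ^+ k.
  elim: k => [|k IH]; first by rewrite expg0 expr0 f_1.
  by rewrite expgS fM ?fingroup.groupX// IH exprS.
have dn : (d %| n)%N.
  rewrite /d Gs0 cyclic.order_dvdn; apply/eqP/f1; last by rewrite fX fn.
  exact: fingroup.groupX.
exists (al ^+ (n %/ d)).
pose P := \prod_(s in G) f s.
have fV s : s \in G -> f (s^-1)%g = (f s)^-1.
  move=> sG; have fs0 : f s != 0 by rewrite /f mulf_neq0 ?invr_eq0// fmorph_eq0.
  by apply: (mulIf fs0); rewrite mulVf// -fM ?fingroup.groupV// mulVg f_1.
(* Reindexing the product by s -> s^-1 gives P = P^-1. Together with P^n = 1 and n odd this yields P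
   = 1. *)
have P2 : P ^+ 2 = 1.
  have PV : P = P^-1.
    rewrite /P -prodfV (reindex_inj (@invg_inj (gal_of {:L})))/=.
    by apply: eq_big => s; [exact: fingroup.groupV|rewrite fingroup.groupV => /fV].
  have P0 : P != 0.
    apply/prodf_neq0 => s _; rewrite /f mulf_neq0 ?invr_eq0// fmorph_eq0//.
  by rewrite expr2 {1}PV mulVf.
have Pn : P ^+ n = 1 by rewrite /P -prodrXl big1.
have P1 : P = 1.
  by move: Pn; rewrite -(odd_double_half n) n_odd exprD -mul2n exprM P2 expr1n mulr1 expr1.
rewrite /galNorm (eq_bigr (fun s => (f s * al) ^+ (n %/ d))); last first.
  by move=> s _; rewrite rmorphXn/= fal.
rewrite prodrXl big_split/= -/P P1 mul1r prodr_const -/d -exprM.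
by rewrite mulnC divnK.
Qed.

(** As X^n - a may be reducible, a root of one of its irreducible factors is adjoined. The resulting
    field already contains all roots z^i alpha, so it is a splitting field and the norm computation
    applies. *)
Lemma kummer_self_norm (K : fieldType) (n : nat) (z a : K) :
  odd n -> n.-primitive_root z -> a != 0 ->
  exists (L : splittingFieldType K) (alpha x : L),
    [/\ alpha ^+ n = a%:A, <<1%VS; alpha>>%VS = fullv
      & galNorm 1%VS {: L} x = a%:A].
Proof.
move=> n_odd prim_z a0.
have n0 : (0 < n)%N by case: n n_odd {prim_z}.
pose p : {poly K} := 'X^n - a%:P.
have sp : size p = n.+1 by rewrite size_XnsubC.
have [|q irr_q qp] := @irreducible_factor K p; first by rewrite sp ltnS.
have [L0 _ [al]] := irredp_FAdjoin irr_q.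
rewrite -/(in_alg L0) => root_al gen_al.
have aln : al ^+ n = a%:A.
  have : root (map_poly (in_alg L0) p) al.
    by have /dvdpP[r ->] := qp; rewrite rmorphM/= rootM root_al orbT.
  rewrite /p rmorphB/= map_polyXn map_polyC/= /root !hornerE subr_eq0.
  by move=> /eqP.
have aA0 : (a%:A : L0) != 0 by rewrite scaler_eq0 negb_or a0 oner_neq0.
have al0 : al != 0.
  by apply: contraNneq aA0 => e; rewrite -aln e expr0n eqn0Ngt n0.
pose zL : L0 := z%:A.
have prim_zL : n.-primitive_root zL.
  by rewrite -(fmorph_primitive_root (in_alg L0)) in prim_z.
have splL : splitting_field_axiom L0.
  exists (map_poly (in_alg L0) p); first by apply/alg_polyOver.
  exists [seq zL ^+ i * al | i <- iota 0 n].
    have sp' : size (map_poly (in_alg L0) p) = (size [seq zL ^+ i * al | i <- iota 0 n]).+1.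
      by rewrite size_map_poly sp size_map size_iota.
    rewrite {1}(all_roots_prod_XsubC sp').
    - by rewrite eqp_scale// lead_coef_eq0 map_poly_eq0 -size_poly_eq0 sp.
    - apply/allP => _ /mapP[i _ ->].
      rewrite /p rmorphB/= map_polyXn map_polyC/= /root !hornerE exprMn.
      by rewrite exprAC (prim_expr_order prim_zL) expr1n mul1r aln subrr.
    - rewrite uniq_rootsE map_inj_in_uniq ?iota_uniq// => i j.
      rewrite !mem_iota !add0n /= => iN jN /(mulIf al0)/eqP.
      by rewrite (eq_prim_root_expr prim_zL) !modn_small// => /eqP.
  apply/eqP; rewrite eqEsubv subvf -gen_al; apply/FadjoinP; split.
    exact: subv_adjoin_seq.
  apply: seqv_sub_adjoin; apply/mapP; exists 0%N; first by rewrite mem_iota.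
  by rewrite expr0 mul1r.
pose L : splittingFieldType K := HB.pack L0 (FieldExt_isSplittingField.Build K L0 splL).

have [x Nx] := @kummer_norm K L n z a al n_odd prim_z a0 aln gen_al.
by exists L, al, x.
Qed.

(** * Integral matrices and roots of unity modulo P *)

Section Integrality.
Context {F : padicField}.

Lemma pideal_sum k (I : Type) (r : seq I) (P : pred I) (f : I -> F) :
  (forall i, P i -> pideal k (f i)) -> pideal k (\sum_(i <- r | P i) f i).
Proof. by move=> h; elim/big_ind: _ => //; [exact: pideal0|exact: pidealD]. Qed.

Lemma pideal_1 : @pideal F 0 1.
Proof. by rewrite pidealE ?oner_neq0// val1. Qed.

Lemma pideal_M0 (x y : F) : pideal 0 x -> pideal 0 y -> pideal 0 (x * y).
Proof. by move=> hx hy; have := pidealM hx hy; rewrite addr0. Qed.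

Lemma pideal_X0 (x : F) m : pideal 0 x -> pideal 0 (x ^+ m).
Proof.
move=> hx; elim: m => [|m IH]; first exact: pideal_1.
by rewrite exprS pideal_M0.
Qed.

Lemma pideal_det m (A : 'M[F]_m) :
  (forall i j, pideal 0 (A i j)) -> pideal 0 (\det A).
Proof.
move=> hA; rewrite /determinant; apply: pideal_sum => s _.
rewrite pideal_M0//; first by rewrite pideal_X0// pidealN pideal_1.
by elim/big_ind: _ => //; [exact: pideal_1|exact: pideal_M0].
Qed.

(* [X ^ m - 1] has at most [m] roots in the residue field; the Vandermonde
   determinant of representatives of distinct residues is a unit. *)
Lemma unity_roots_residue (m N : nat) (u : 'I_N -> F) : (0 < m)%N ->
  (forall i, pideal 0 (u i)) ->
  (forall i j, i != j -> ~~ pideal 1 (u i - u j)) ->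
  (forall i, pideal 1 (u i ^+ m - 1)) -> (N <= m)%N.
Proof.
move=> m0 uO udist um; rewrite leqNgt; apply/negP => mN.
have N0 : (0 < N)%N by apply: leq_trans mN.
pose V := Vandermonde N (\row_j u j).
have VE i j : V i j = u j ^+ i by rewrite !mxE.
have VO i j : pideal 0 (V i j) by rewrite VE pideal_X0.
have vdet : pf_val (\det V) = 0 /\ \det V != 0.
  rewrite det_Vandermonde.
  elim/big_ind: _ => [|x y [vx x0] [vy y0]|i _].
  - by rewrite val1 oner_neq0.
  - by rewrite pf_valM// vx vy mulf_neq0.
  elim/big_ind: _ => [|x y [vx x0] [vy y0]|j ij].
  - by rewrite val1 oner_neq0.
  - by rewrite pf_valM// vx vy mulf_neq0.
  rewrite !mxE; have nji : ~~ pideal 1 (u j - u i).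
    by apply: udist; rewrite neq_ltn ij orbT.
  have ne : u j - u i != 0 by apply: contraNneq nji => ->; exact: pideal0.
  split=> //; apply/eqP; rewrite val_eq// nji pidealB//.
(* Row m minus row 0 of the Vandermonde matrix has entries [u j ^+ m - 1], all in P. Multiplication
   by the adjugate turns it into the determinant in position m, so the determinant would lie in
   P. *)
pose c : 'rV[F]_N := delta_mx 0 (Ordinal mN) - delta_mx 0 (Ordinal N0).
have cV j : pideal 1 ((c *m V) 0 j).
  by rewrite mulmxBl -!rowE !mxE um.
have : pideal 1 ((c *m V *m \adj V) 0 (Ordinal mN)).
  rewrite mxE; apply: pideal_sum => j _.
  rewrite -[1]addr0 pidealM// !mxE pideal_M0//.
    by rewrite pideal_X0// pidealN pideal_1.
  by apply: pideal_det => k l; rewrite !mxE pideal_X0.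
rewrite -mulmxA mul_mx_adj mul_mx_scalar !mxE !eqxx /=.
have -> : (Ordinal mN == Ordinal N0) = false.
  by apply/negbTE; rewrite -val_eqE/= -lt0n.
by case: vdet => vd d0; rewrite subr0 mulr1 pidealE// vd.
Qed.

End Integrality.

(** * Tame properties of the Hilbert symbol in F *)

Section HilbertSymbol.
Context {F : padicField} (n : nat).
Hypothesis n_odd : odd n.
Hypothesis coprime_pn : coprime (pf_p F) n.
Hypothesis mu_n_F : exists z : F, n.-primitive_root z.
Context (hilb : F -> F -> F).
Hypothesis hilbP : is_hilbert_symbol n hilb.
Local Notation v := (@pf_val F).
Local Notation w := (pf_unif F).

Lemma hilb_n a b : a != 0 -> b != 0 -> hilb a b ^+ n = 1.
Proof. by case: hilbP => h *; exact: h. Qed.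

Lemma hilbMl a a' b : a != 0 -> a' != 0 -> b != 0 ->
  hilb (a * a') b = hilb a b * hilb a' b.
Proof. by case: hilbP => _ h *; exact: h. Qed.

Lemma hilbMr a b b' : a != 0 -> b != 0 -> b' != 0 ->
  hilb a (b * b') = hilb a b * hilb a b'.
Proof. by case: hilbP => _ _ h *; exact: h. Qed.

Lemma n_gt0 : (0 < n)%N. Proof. by case: n n_odd. Qed.

Lemma hilb_neq0 a b : a != 0 -> b != 0 -> hilb a b != 0.
Proof.
move=> a0 b0; apply: contra_eq_neq (hilb_n a0 b0) => ->.
by rewrite expr0n eqn0Ngt n_gt0 eq_sym oner_neq0.
Qed.

Lemma hilb_self a : a != 0 -> hilb a a = 1.
Proof.
move=> a0; have [z prim_z] := mu_n_F.
case: hilbP => _ _ _ h _; apply/h => //.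
exact: kummer_self_norm n_odd prim_z a0.
Qed.

(** Expansion of (a b, a b) = 1. *)
Lemma hilb_alt a b : a != 0 -> b != 0 -> hilb a b * hilb b a = 1.
Proof.
move=> a0 b0; have ab0 : a * b != 0 by rewrite mulf_neq0.
have := hilb_self ab0; rewrite hilbMl// !hilbMr// !hilb_self//.
by rewrite mul1r mulr1.
Qed.

(** A Bezout relation between p and n would put 1 into P if n were divisible by the uniformizer. *)
Lemma val_n : v n%:R = 0 /\ (n%:R : F) != 0.
Proof.
have n0 : (n%:R : F) != 0 by case: n n_odd => // m _; exact: pf_char0.
have natO m : @pideal F 0 m%:R.
  elim: m => [|m IH]; first exact: pideal0.
  by rewrite -addn1 natrD pidealD// pideal_1.
split=> //; apply/eqP; rewrite val_eq// natO/=; apply/negP => hn.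
have p0 : (0 < pf_p F)%N by apply/prime_gt0/pf_p_prime.
have hp : @pideal F 1 (pf_p F)%:R.
  by rewrite /pideal; apply/orP; right; have := pf_val_p F; lia.
have [km kn] := egcdnP n p0; rewrite (eqP (coprime_pn : gcdn _ _ == 1%N)) => e _.
have : @pideal F 1 1.
  have -> : 1 = km%:R * (pf_p F)%:R - kn%:R * n%:R :> F.
    by rewrite -!natrM e natrD addrC addKr.
  by rewrite pidealB// -[1]add0r pidealM.
by rewrite pidealE ?oner_neq0// val1.
Qed.

(** If z were different from 1, the sum 1 + z + ... + z^(n - 1) would be 0; but modulo P it is n, a
    unit. *)
Lemma root_congr1 (z : F) : z ^+ n = 1 -> pideal 1 (z - 1) -> z = 1.
Proof.
move=> zn z1; apply/eqP; rewrite -subr_eq0; apply/negPn/negP => ne.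
have [vz z0] : v z = 0 /\ z != 0.
  have [] := @ugroupP F 1 z; by rewrite /ugroup.
have hX i : pideal 1 (z ^+ i - 1).
  elim: i => [|i IH]; first by rewrite subrr pideal0.
  have -> : z ^+ i.+1 - 1 = z * (z ^+ i - 1) + (z - 1) by rewrite exprS; ring.
  by rewrite pidealD// pidealMl// vz subr0.
have : (z - 1) * (\sum_(i < n) z ^+ i) = 0 by rewrite -subrX1 zn subrr.
move/eqP; rewrite mulf_eq0 (negbTE ne)/= => /eqP s0.
have [vn nn0] := val_n.
have : pideal 1 (\sum_(i < n) (z ^+ i - 1)) by apply: pideal_sum.
rewrite sumrB s0 sumr_const card_ord sub0r pidealN.
by rewrite pidealE// vn.
Qed.

Lemma roots_congr (x y : F) : x ^+ n = 1 -> y ^+ n = 1 -> pideal 1 (x - y) -> x = y.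
Proof.
move=> xn yn xy.
have y0 : y != 0.
  apply: contra_eq_neq yn => ->.
  by rewrite expr0n eqn0Ngt n_gt0 eq_sym oner_neq0.
have vy : v y = 0.
  have := valX n y0; rewrite yn val1; move/esym/eqP.
  by rewrite mulf_eq0 eqz_nat eqn0Ngt n_gt0/= => /eqP.
apply/(divIf y0); rewrite divff//; apply: root_congr1.
  by rewrite expr_div_n xn yn divr1.
have -> : x / y - 1 = y^-1 * (x - y) by field.
by rewrite pidealMl ?invr_neq0// valV// vy oppr0 subr0.
Qed.

Lemma hilb_frob a b : ugroup 0 a -> b != 0 -> v b = 1 ->
  pideal 1 (hilb a b - a ^+ ((pf_q F).-1 %/ n)).
Proof. by case: hilbP => _ _ _ _ h; exact: h. Qed.

(** The Frobenius congruence fixes both symbols modulo P, and n-th roots of unity are determined by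
    their residues. *)
Lemma hilb_unif a b b' : ugroup 0 a -> b != 0 -> b' != 0 -> v b = 1 -> v b' = 1 ->
  hilb a b = hilb a b'.
Proof.
move=> ua b0 b'0 vb vb'; have [a0 _] := ugroupP ua.
apply: roots_congr; rewrite ?hilb_n//.
set t := a ^+ ((pf_q F).-1 %/ n).
have -> : hilb a b - hilb a b' = (hilb a b - t) - (hilb a b' - t) by ring.
by rewrite pidealB// hilb_frob.
Qed.

Lemma hilb1r a : a != 0 -> hilb a 1 = 1.
Proof.
move=> a0; have h := hilb_neq0 a0 (oner_neq0 F).
by apply: (mulfI h); rewrite mulr1 -hilbMr ?oner_neq0// mulr1.
Qed.

Lemma hilb1l b : b != 0 -> hilb 1 b = 1.
Proof.
move=> b0; have h := hilb_neq0 (oner_neq0 F) b0.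
by apply: (mulfI h); rewrite mulr1 -hilbMl ?oner_neq0// mulr1.
Qed.

Lemma hilbVr a b : a != 0 -> b != 0 -> hilb a b^-1 = (hilb a b)^-1.
Proof.
move=> a0 b0; apply: (mulfI (hilb_neq0 a0 b0)).
by rewrite -hilbMr ?invr_neq0// !divff ?hilb_neq0// hilb1r.
Qed.

Lemma hilbXzr a b (k : int) : a != 0 -> b != 0 -> hilb a (b ^ k) = hilb a b ^ k.
Proof.
move=> a0 b0.
have nat_case (m : nat) : hilb a (b ^+ m) = hilb a b ^+ m.
  elim: m => [|m IH]; first by rewrite hilb1r.
  by rewrite !exprS hilbMr ?expf_neq0// IH.
case: k => m; first exact: nat_case.
by rewrite NegzE -!exprnN hilbVr ?expf_neq0// nat_case.
Qed.

(** Writing b as a uniformizer times a power of w leaves only symbols of a against uniformizers,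
    which all coincide. *)
Lemma hilb_unit a b : ugroup 0 a -> b != 0 -> hilb a b = hilb a w ^ (v b).
Proof.
move=> ua b0; have [a0 _] := ugroupP ua.
have w0 := pf_unif_neq0 F.
have b1 : b * w ^ (1 - v b) != 0 by rewrite mulf_neq0 ?unifXz_neq0.
have vb1 : v (b * w ^ (1 - v b)) = 1.
  by rewrite pf_valM ?unifXz_neq0// val_unifXz addrC subrK.
have -> : b = (b * w ^ (1 - v b)) * w ^ (v b - 1).
  by rewrite -mulrA -expfzDr// -opprB addNr expr0z mulr1.
rewrite hilbMr ?unifXz_neq0// (hilb_unif ua b1 w0 vb1 (pf_val_unif F)) hilbXzr//.
rewrite -{1}(expr1z (hilb a w)) -expfzDr ?hilb_neq0//; congr (_ ^ _).
rewrite pf_valM// ?unifXz_neq0// val_unifXz vb1; lia.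
Qed.

(** The Frobenius congruence reads (a, w) = 1 modulo P, hence exactly. *)
Lemma hilb_ugroup1 a b : ugroup 1 a -> b != 0 -> hilb a b = 1.
Proof.
move=> ua b0; have ua0 := ugroup_le (leq0n 1) ua; have [a0 va] := ugroupP ua.
rewrite hilb_unit//; have -> : hilb a w = 1; last by rewrite exp1rz.
have w0 := pf_unif_neq0 F.
apply: root_congr1; first exact: hilb_n.
set t := a ^+ ((pf_q F).-1 %/ n).
have -> : hilb a w - 1 = (hilb a w - t) + (t - 1) by ring.
rewrite pidealD ?hilb_frob ?pf_val_unif// /t.
elim: (_ %/ _)%N => [|m IH]; first by rewrite subrr pideal0.
have -> : a ^+ m.+1 - 1 = a * (a ^+ m - 1) + (a - 1) by rewrite exprS; ring.
by rewrite pidealD// pidealMl// va subr0.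
Qed.

Lemma residue_units : exists u : 'I_(pf_q F).-1 -> F,
  (forall i, ugroup 0 (u i)) /\ (forall i j, i != j -> ~~ pideal 1 (u i - u j)).
Proof.
have [reps [uq sz rO hx]] := @residue_reps F.
have [r0 r0in hr0] := hx 0 (pideal0 _).
pose s := rem r0 reps.
have ssz : size s = (pf_q F).-1 by rewrite size_rem// sz.
have sin i : (i < size s)%N -> s`_i \in reps.
  by move=> /(mem_nth 0)/mem_rem.
exists (fun i => s`_i); split=> [i|i j ij].
  have hi : (i < size s)%N by rewrite ssz.
  have : s`_i != r0.
    by have := mem_nth 0 hi; rewrite /s mem_rem_uniq// inE => /andP[].
  rewrite -hr0 ?sin// sub0r pidealN => n1.
  have ne : s`_i != 0 by apply: contraNneq n1 => ->; exact: pideal0.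
  by rewrite ugroup0E ne val_eq// n1 rO// sin.
have hi : (i < size s)%N by rewrite ssz.
have hj : (j < size s)%N by rewrite ssz.
have [r rin hr] := hx s`_i (rO _ (sin _ hi)).
rewrite hr ?sin//.
have <- : s`_i = r by apply/eqP; rewrite -hr ?sin// subrr pideal0.
by rewrite nth_uniq ?rem_uniq// eq_sym.
Qed.

(** The n-th roots of unity together with 0 have n + 1 distinct residues. This makes the exponent (q
    - 1) / n positive. *)
Lemma leq_n_q1 : (n <= (pf_q F).-1)%N.
Proof.
have [z prim_z] := mu_n_F.
have zn i : (z ^+ i) ^+ n = 1 by rewrite exprAC (prim_expr_order prim_z) expr1n.
have [reps [uq sz rO hx]] := @residue_reps F.
have z0 : z != 0.
  apply: contra_eq_neq (zn 1%N) => ->.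
  by rewrite expr1 expr0n eqn0Ngt n_gt0 eq_sym oner_neq0.
have vz : v z = 0.
  have := valX n z0; rewrite (prim_expr_order prim_z) val1; move/esym/eqP.
  by rewrite mulf_eq0 eqz_nat eqn0Ngt n_gt0/= => /eqP.
have zO i : pideal 0 (z ^+ i) by rewrite pidealE ?expf_neq0// valX// vz mulr0.
have exr x : exists r, pideal 0 x -> r \in reps /\
    forall r', r' \in reps -> pideal 1 (x - r') = (r' == r).
  by case: (boolP (pideal 0 x)) => [/hx[r]|_]; [exists r|exists 0].
have [rr hrr] := choice exr.
have [ri hri] := hrr _ (pideal0 0).
rewrite -ltnS prednK -?sz; last by rewrite sz; have := q_gt1 (F := F); lia.
have -> : n.+1 = size (rr 0 :: [seq rr (z ^+ i) | i <- iota 0 n]).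
  by rewrite /= size_map size_iota.
have cong x y : pideal 0 x -> pideal 0 y -> rr x = rr y -> pideal 1 (x - y).
  move=> /hrr[rx hx1] /hrr[ry hy1] e.
  have -> : x - y = (x - rr x) - (y - rr y) by rewrite e; ring.
  by rewrite pidealB ?hx1 ?hy1.
apply: uniq_leq_size; last first.
  move=> x; rewrite inE => /orP[/eqP->//|/mapP[i _ ->]].
  by case: (hrr _ (zO i)).
rewrite /= map_inj_in_uniq ?iota_uniq ?andbT.
  apply/mapP => -[i _ /(cong _ _ (pideal0 0) (zO i))].
  by rewrite sub0r pidealN pidealE ?expf_neq0// valX// vz mulr0.
move=> i j; rewrite !mem_iota /= add0n => iN jN /(cong _ _ (zO i) (zO j)).
move/(roots_congr (zn i) (zn j))/eqP.
by rewrite (eq_prim_root_expr prim_z) !modn_small// => /eqP.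
Qed.

(** With m the remainder of k modulo n and e = (q - 1) / n, triviality on all units would make every
    unit residue a root of X^(e m) - 1. But 0 < e m < e n <= q - 1, too small a degree for q - 1
    roots. *)
Lemma hilb_unif_nontrivial (k : int) : ~~ (n%:Z %| k)%Z ->
  exists2 u, ugroup 0 u & hilb w u ^ k != 1.
Proof.
move=> nk; apply: contrapT => hcon.
have w0 := pf_unif_neq0 F.
have hu u : ugroup 0 u -> hilb u w ^ k = 1.
  move=> uu; have [u0 _] := ugroupP uu.
  have -> : hilb u w = (hilb w u)^-1.
    by apply: (mulIf (hilb_neq0 w0 u0)); rewrite mulVf ?hilb_neq0// hilb_alt.
  rewrite exprz_inv -invr_expz; apply/eqP; rewrite invr_eq1; apply/negPn/negP => h.
  by apply: hcon; exists u.
pose m := `|(k %% n%:Z)%Z|%N.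
have nz : (n%:Z != 0) by rewrite eqz_nat -lt0n n_gt0.
have mE : (k %% n%:Z)%Z = m%:Z by rewrite /m gez0_abs// modz_ge0.
have m0 : (0 < m)%N.
  rewrite lt0n; apply: contra nk => /eqP m0.
  by apply/dvdz_mod0P; rewrite mE m0.
have mn : (m < n)%N by rewrite -ltz_nat -mE ltz_pmod// ltz_nat n_gt0.
have hum u : ugroup 0 u -> hilb u w ^+ m = 1.
  move=> uu; have [u0 _] := ugroupP uu; rewrite -(hu u uu) (divz_eq k n%:Z) mE.
  by rewrite expfzDr ?hilb_neq0// (mulrC _ n%:Z) -exprz_exp -exprnP hilb_n// exp1rz mul1r.
have nq := leq_n_q1.
have [u [uu udist]] := residue_units.
set e := ((pf_q F).-1 %/ n)%N.
have e0 : (0 < e)%N by rewrite divn_gt0// n_gt0.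
have : ((pf_q F).-1 <= e * m)%N.
  apply: (@unity_roots_residue F (e * m) _ u).
  - by rewrite muln_gt0 e0.
  - by move=> i; have /andP[ne /eqP vi] := uu i; rewrite pidealE// vi.
  - exact: udist.
  - move=> i; rewrite exprM; have [ui0 vui] := ugroupP (uu i).
    have := hilb_frob (uu i) w0 (pf_val_unif F); rewrite -/e.
    set x := u i ^+ e; set y := hilb _ _ => xy.
    have yO : pideal 0 y.
      rewrite pidealE ?hilb_neq0//.
      have := valX n (hilb_neq0 ui0 w0); rewrite hilb_n// val1; move/esym/eqP.
      by rewrite mulf_eq0 eqz_nat eqn0Ngt n_gt0/= => /eqP ->.
    have xO : pideal 0 x by rewrite pideal_X0// pidealE// vui.
    (* Here 1 is rewritten as y^m, so that x^m - y^m is divisible by x - y, which lies in P. *)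
    rewrite -(hum _ (uu i)) -/y -opprB pidealN subrXX -[1]addr0 pidealM//.
    by apply: pideal_sum => j _; apply: pideal_M0; exact: pideal_X0.
have em : (e * m < e * n)%N by rewrite ltn_pmul2l.
have en : (e * n <= (pf_q F).-1)%N by exact: leq_divM.
lia.
Qed.

(** * The symbol with complex values *)

Section ComplexSymbol.
Context {R : realType} (iota : F -> R[i]).
Hypothesis iotaP : is_root_identification n iota.
Local Notation sym x y := (iota (hilb x y)).

Lemma iota_n z : z ^+ n = 1 -> iota z ^+ n = 1.
Proof.
case: iotaP => i1 iM _ zn.
have h k : iota (z ^+ k) = iota z ^+ k.
  elim: k => [|k IH]; first by rewrite i1.
  by rewrite !exprS iM// ?IH// exprAC zn expr1n.
by rewrite -h zn i1.
Qed.

Lemma sym_n x y : x != 0 -> y != 0 -> sym x y ^+ n = 1.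
Proof. by move=> x0 y0; rewrite iota_n ?hilb_n. Qed.

Lemma sym_neq0 x y : x != 0 -> y != 0 -> sym x y != 0.
Proof.
move=> x0 y0; apply: contra_eq_neq (sym_n x0 y0) => ->.
by rewrite expr0n eqn0Ngt n_gt0 eq_sym oner_neq0.
Qed.

Lemma symMl x x' y : x != 0 -> x' != 0 -> y != 0 ->
  sym (x * x') y = sym x y * sym x' y.
Proof.
by move=> *; case: iotaP => _ iM _; rewrite hilbMl// iM// hilb_n.
Qed.

Lemma symMr x y y' : x != 0 -> y != 0 -> y' != 0 ->
  sym x (y * y') = sym x y * sym x y'.
Proof.
by move=> *; case: iotaP => _ iM _; rewrite hilbMr// iM// hilb_n.
Qed.

Lemma sym_alt x y : x != 0 -> y != 0 -> sym x y * sym y x = 1.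
Proof.
move=> x0 y0; case: iotaP => i1 iM _.
by rewrite -iM ?hilb_n// hilb_alt.
Qed.

Lemma symC x y : x != 0 -> y != 0 -> sym x y = (sym y x)^-1.
Proof.
move=> x0 y0; apply: (mulIf (sym_neq0 y0 x0)).
by rewrite sym_alt// mulVf ?sym_neq0.
Qed.

Lemma sym_self x : x != 0 -> sym x x = 1.
Proof. by move=> x0; case: iotaP => i1 _ _; rewrite hilb_self. Qed.

Lemma sym1r x : x != 0 -> sym x 1 = 1.
Proof. by move=> x0; case: iotaP => i1 _ _; rewrite hilb1r. Qed.

Lemma sym1l x : x != 0 -> sym 1 x = 1.
Proof. by move=> x0; case: iotaP => i1 _ _; rewrite hilb1l. Qed.

Lemma symVr x y : x != 0 -> y != 0 -> sym x y^-1 = (sym x y)^-1.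
Proof.
move=> x0 y0; apply: (mulfI (sym_neq0 x0 y0)).
by rewrite -symMr ?invr_neq0// !divff ?sym_neq0// sym1r.
Qed.

Lemma symVl x y : x != 0 -> y != 0 -> sym x^-1 y = (sym x y)^-1.
Proof.
move=> x0 y0; apply: (mulfI (sym_neq0 x0 y0)).
by rewrite -symMl ?invr_neq0// !divff ?sym_neq0// sym1l.
Qed.

Lemma symXzr x y (k : int) : x != 0 -> y != 0 -> sym x (y ^ k) = sym x y ^ k.
Proof.
move=> x0 y0.
have nat_case (m : nat) : sym x (y ^+ m) = sym x y ^+ m.
  elim: m => [|m IH]; first by rewrite sym1r.
  by rewrite !exprS symMr ?expf_neq0// IH.
case: k => m; first exact: nat_case.
by rewrite NegzE -!exprnN symVr ?expf_neq0// nat_case.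
Qed.

(* [(-1, y)] is both a square root and, [n] being odd, an n-th root of 1. *)
Lemma symN1r x : x != 0 -> sym x (-1) = 1.
Proof.
move=> x0; have m1 : (-1 : F) != 0 by rewrite oppr_eq0 oner_neq0.
have h2 : sym x (-1) ^+ 2 = 1 by rewrite expr2 -symMr// mulrNN mulr1 sym1r.
have := sym_n x0 m1; rewrite -(odd_double_half n) n_odd exprD -mul2n exprM h2.
by rewrite expr1n mulr1 expr1.
Qed.

Lemma symN1l x : x != 0 -> sym (-1) x = 1.
Proof.
move=> x0; have m1 : (-1 : F) != 0 by rewrite oppr_eq0 oner_neq0.
by rewrite symC// symN1r// invr1.
Qed.

Lemma symNr x y : x != 0 -> y != 0 -> sym x (- y) = sym x y.
Proof.
move=> x0 y0; have m1 : (-1 : F) != 0 by rewrite oppr_eq0 oner_neq0.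
by rewrite -mulN1r symMr// symN1r// mul1r.
Qed.

Lemma sym_ugroup1l u y : ugroup 1 u -> y != 0 -> sym u y = 1.
Proof. by move=> uu y0; case: iotaP => i1 _ _; rewrite hilb_ugroup1. Qed.

Lemma sym_ugroup1r u x : ugroup 1 u -> x != 0 -> sym x u = 1.
Proof.
move=> uu x0; have [u0 _] := ugroupP uu.
by rewrite symC// sym_ugroup1l// invr1.
Qed.

Lemma sym_Xz_mod x y (k l : int) : x != 0 -> y != 0 -> (n%:Z %| k - l)%Z ->
  sym x y ^ k = sym x y ^ l.
Proof.
move=> x0 y0 /dvdzP[m e]; have -> : k = m * n%:Z + l by rewrite -e subrK.
by rewrite expfzDr ?sym_neq0// (mulrC _ n%:Z) -exprz_exp -exprnP sym_n// exp1rz mul1r.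
Qed.

(** The unit part of t pairs trivially with a because v a is a multiple of n; only the power of w in
    t remains, and its exponent counts modulo n. *)
Lemma sym_tame t a (j : int) : t != 0 -> a != 0 -> (n%:Z %| v a)%Z ->
  (n%:Z %| v t - j)%Z -> sym t a = sym w a ^ j.
Proof.
move=> t0 a0 na nt; have w0 := pf_unif_neq0 F.
pose u := t * w ^ (- v t).
have uu : ugroup 0 u.
  by rewrite ugroup0E /u mulf_neq0 ?unifXz_neq0//= pf_valM ?unifXz_neq0// val_unifXz subrr.
have [u0 _] := ugroupP uu.
have -> : t = u * w ^ (v t) by rewrite /u -mulrA -expfzDr// addNr expr0z mulr1.
have su : sym u a = 1.
  case: iotaP => i1 _ _; have -> : hilb u a = 1; last by [].
  rewrite hilb_unit//; have /dvdzP[m ->] := na.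
  by rewrite mulrC -exprz_exp -exprnP hilb_n// exp1rz.
rewrite symMl ?unifXz_neq0// su mul1r symC ?unifXz_neq0//.
rewrite symXzr// (symC a0 w0) invr_expz exprz_inv opprK.
exact: sym_Xz_mod.
Qed.

Lemma eta_character (k : int) : is_character (fun y => sym w y ^ k).
Proof.
have w0 := pf_unif_neq0 F; split.
- by move=> x y x0 y0; rewrite symMr// expfzMl.
- by move=> x x0; rewrite expfz_neq0// sym_neq0.
- by exists 0%N => x ux; have [x0 _] := ugroupP ux; rewrite sym_ugroup1r// exp1rz.
Qed.

Lemma eta_nontrivial (k : int) : ~~ (n%:Z %| k)%Z ->
  exists2 u, ugroup 0 u & sym w u ^ k != 1.
Proof.
move=> nk; have [u uu hu] := hilb_unif_nontrivial nk.
exists u => //; apply: contra hu => /eqP hu; apply/eqP.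
have [u0 _] := ugroupP uu; have w0 := pf_unif_neq0 F.
case: iotaP => i1 iM iI.
have := hu; rewrite -symXzr//= hilbXzr// -[1 in RHS]i1; apply: iI.
  by rewrite exprnP exprzAC -exprnP hilb_n// exp1rz.
by rewrite expr1n.
Qed.

End ComplexSymbol.

End HilbertSymbol.

(** * Integration of locally constant functions *)

Section Integration.
Context {R : realType} {F : padicField} (mu : {measure set (borelF F) -> \bar R}).
Hypothesis mu_haar : is_haar mu.
Local Notation C := R[i].
Local Notation nm := (@Normc.normc R).
Local Notation v := (@pf_val F).
Local Notation w := (pf_unif F).
Local Notation q := ((pf_q F)%:R : R).

Lemma q_gt0 : 0 < q.
Proof. by rewrite ltr0n; have := q_gt1 (F := F); lia. Qed.

Lemma q_neq0 : q != 0. Proof. by rewrite gt_eqF// q_gt0. Qed.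

Definition pball (a : F) (k : int) : set (borelF F) := [set x : F | pideal k (x - a)].

Definition ind (a : F) (k : int) (x : F) : R := (pideal k (x - a))%:R.

Lemma measurable_pball a k : measurable (pball a k).
Proof. by apply: sub_sigma_algebra; exists a, k. Qed.

Lemma indE a k : ind a k = \1_(pball a k) :> (borelF F -> R).
Proof.
apply/funext => x; rewrite indicE /ind.
have -> : (x \in pball a k) = pideal k ((x : F) - a); last by [].
by apply/idP/idP => [/set_mem//|h]; rewrite mem_set.
Qed.

Lemma measurable_ind a k : measurable_fun setT (ind a k : borelF F -> R).
Proof. by rewrite indE; apply: measurable_indic; exact: measurable_pball. Qed.

Lemma integral_ind a k :
  (\int[mu]_x (ind a k x)%:E)%E = mu (pball a k).
Proof.
rewrite indE integral_indic ?setIT//; exact: measurable_pball.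
Qed.

Lemma mu_pball_transl a k : mu (pball a k) = mu (pball 0 k).
Proof.
have [h _] := mu_haar; rewrite -(h a (pball 0 k)); last exact: measurable_pball.
congr (mu _); apply/seteqP; split=> x /=.
  by move=> hx; exists (x - a); rewrite /pball/= ?subr0// addrC subrK.
by move=> [y]; rewrite /pball/= subr0 => hy <-; rewrite addrC addKr.
Qed.

(** The partition of a ball into q balls of the next level, expressed by indicators so that it can
    be integrated termwise or iterated. *)
Lemma residue_split : exists reps : seq F, [/\ size reps = pf_q F,
  {in reps, forall r, pideal 0 r} &
  forall r m x, \sum_(t <- reps) ind (r + w ^ m * t) (m + 1) x = ind r m x].
Proof.
have [reps [uq sz rO hx]] := @residue_reps F; exists reps; split=> // r m x.
have w0 : w ^ m != 0 by exact: unifXz_neq0.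
have sub t : pideal (m + 1) (x - (r + w ^ m * t)) = pideal 1 ((x - r) / w ^ m - t).
  have -> : x - (r + w ^ m * t) = w ^ m * ((x - r) / w ^ m - t) by field.
  by rewrite pidealMl// val_unifXz; congr pideal; lia.
rewrite /ind; have [hm|hm] := boolP (pideal m (x - r)).
  have [|r0 r0in hr0] := hx ((x - r) / w ^ m).
    by rewrite mulrC pidealMl ?invr_neq0// valV// val_unifXz opprK add0r.
  rewrite (bigD1_seq r0)//= sub hr0// eqxx big_seq_cond big1 ?addr0//.
  by move=> t /andP[tin tr0]; rewrite sub hr0// (negbTE tr0).
rewrite big_seq big1// => t tin; rewrite sub.
have -> : pideal 1 ((x - r) / w ^ m - t) = false; last by [].
apply: contraNF hm => h; have -> : x - r = w ^ m * (((x - r) / w ^ m - t) + t) by field.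
rewrite pidealMl// val_unifXz subrr; apply: pidealD; last exact: rO.
exact: pideal_le h.
Qed.

Definition vol : R := fine (mu (pball 0 0)).

Lemma mu_pball00 : mu (pball 0 0) = vol%:E /\ 0 < vol.
Proof.
have [_] := mu_haar; have -> : [set x | pideal 0 x] = pball 0 0 :> set F.
  by apply/seteqP; split=> x; rewrite /pball/= subr0.
rewrite /vol; case: (mu (pball 0 0)) => [r| |] //= /andP[]; last by [].
by rewrite lte_fin.
Qed.

Lemma sume_const_seq (I : Type) (s : seq I) (c : \bar R) : (0 <= c)%E ->
  (\sum_(i <- s) c = (size s)%:R%:E * c)%E.
Proof.
move=> c0; elim: s => [|a s IH]; first by rewrite big_nil mul0e.
rewrite big_cons IH /= -[(size s).+1]addn1 natrD EFinD ge0_muleDl ?lee_fin//.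
by rewrite mul1e addeC.
Qed.

Lemma mu_pball_step k : mu (pball 0 k) = (q%:E * mu (pball 0 (k + 1)))%E.
Proof.
have [reps [sz _ hs]] := residue_split.
rewrite -integral_ind.
under eq_integral => x _ do rewrite -hs -sumEFin.
rewrite ge0_integral_sum//.
- under eq_bigr do rewrite integral_ind mu_pball_transl.
  by rewrite sume_const_seq// sz.
- by move=> t; apply/measurable_EFinP; exact: measurable_ind.
- by move=> t x _; rewrite lee_fin /ind ler0n.
Qed.

Lemma mu_pball a k : mu (pball a k) = (vol * q ^ (- k))%:E.
Proof.
rewrite mu_pball_transl.
have q0 := q_gt0; have [mu0 _] := mu_pball00.
case: k => k.
  elim: k => [|k IH]; first by rewrite oppr0 expr0z mulr1.
  have := mu_pball_step k; rewrite IH addrC intS.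
  (* Before cancelling q, the measure of the smaller ball must be known to be finite; an infinite
     value would make the larger ball infinite as well. *)
  have /gee0P[->|[r _ ->]] := measure_ge0 mu (pball 0 (1 + k%:Z)).
    by rewrite gt0_muley// lte_fin.
  rewrite -EFinM => -[h]; congr EFin; apply: (mulfI q_neq0).
  rewrite -h opprD expfzDr ?q_neq0// mulrCA; congr (_ * _).
  by rewrite exprN1 mulVKf// q_neq0.
rewrite NegzE opprK; elim: k => [|k IH].
  rewrite mu_pball_step (_ : - 1%:Z + 1 = 0)// mu0 -EFinM expr1z.
  by rewrite mulrC.
rewrite mu_pball_step (_ : - k.+2%:Z + 1 = - k.+1%:Z); last by lia.
by rewrite IH -EFinM [in RHS]intS expfzDr ?q_neq0// expr1z mulrCA.
Qed.

Lemma integrable_ind (c : R) a k :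
  mu.-integrable setT (fun x : borelF F => (c * ind a k x)%:E).
Proof.
under eq_fun do rewrite EFinM.
apply: integrableZl => //; apply/integrableP; split.
  by apply/measurable_EFinP; exact: measurable_ind.
under eq_integral => x _ do rewrite abse_EFin ger0_norm ?ler0n//.
by rewrite integral_ind mu_pball ltry.
Qed.

Definition indsum (rs : seq F) (N : int) (c : F -> R) (x : F) : R :=
  \sum_(r <- rs) c r * ind r N x.

Lemma integrable_indsum rs N c :
  mu.-integrable setT (fun x : borelF F => (indsum rs N c x)%:E).
Proof.
rewrite (_ : (fun _ => _) = (fun x : borelF F => \sum_(r <- rs) (c r * ind r N x)%:E)%E).
  by apply: integrable_sum => // r _; exact: integrable_ind.
by apply/funext => x; rewrite sumEFin.
Qed.

Lemma Rintegral_indsum rs N c :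
  Rintegral mu setT (indsum rs N c : borelF F -> R)
  = (\sum_(r <- rs) c r) * (vol * q ^ (- N)).
Proof.
rewrite /Rintegral.
under eq_integral => x _ do rewrite /indsum -sumEFin.
rewrite integral_sum//; last by move=> r; exact: integrable_ind.
rewrite (_ : \sum_(r <- rs) _ = (\sum_(r <- rs) (c r * (vol * q ^ (- N))))%:E)%E.
  by rewrite /= mulr_suml.
rewrite -sumEFin; apply: eq_bigr => r _.
under eq_integral => x _ do rewrite EFinM.
have h := integrable_ind 1 r N.
rewrite integralZl//; first by rewrite integral_ind mu_pball -EFinM.
by move: h; under eq_fun do rewrite mul1r.
Qed.

Lemma ball_reps (k : int) (d : nat) : exists rs : seq F,
  {in rs, forall r, pideal k r} /\
  forall x, \sum_(r <- rs) ind r (k + d%:Z) x = ind 0 k x.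
Proof.
have [reps [_ rO hs]] := residue_split.
elim: d => [|d [rs [hrs IH]]].
  exists [:: 0]; split; first by move=> r; rewrite inE => /eqP->; exact: pideal0.
  by move=> x; rewrite big_seq1 addr0.
exists [seq r + w ^ (k + d%:Z) * t | r <- rs, t <- reps]; split.
  move=> _ /allpairsP[[r t] /= [rin tin ->]]; apply: pidealD.
    exact: hrs.
  rewrite pidealMl ?unifXz_neq0// val_unifXz.
  by apply: pideal_le (rO _ tin); lia.
move=> x; rewrite big_allpairs_dep/= -IH; apply: eq_bigr => r _.
by rewrite -hs; apply: eq_bigr => t _; congr ind; lia.
Qed.

Lemma ind_eq (r : F) k x : pideal k (x - r) -> ind r k x = 1.
Proof. by rewrite /ind => ->. Qed.

(** The points and the level are chosen before G, so real part, imaginary part and modulus share one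
    decomposition into balls. *)
Lemma schwartz_repr (phi : F -> C) : schwartz phi -> exists rs N,
  forall G : C -> R, G 0 = 0 ->
    (fun x => G (phi x)) = indsum rs N (fun r => G (phi r)).
Proof.
move=> [[k hk] [l hl]].
(* The level k + |l - k| is at least k and at least l, so each ball lies on one side of P^k and
   [phi] is constant on it. *)
have [rs [hrs hsum]] := ball_reps k `|l - k|%N.
exists rs, (k + `|l - k|%N) => G G0; apply/funext => x; rewrite /indsum.
have [xk|xk] := boolP (pideal k x); last first.
  rewrite hk// G0 big_seq big1// => r /hrs rk; rewrite /ind.
  rewrite (_ : pideal _ _ = false) ?mulr0//; apply: contraNF xk => h.
  rewrite -(subrK r x) pidealD//; apply: pideal_le h; lia.
transitivity (G (phi x) * ind 0 k x); first by rewrite ind_eq ?mulr1// subr0.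
rewrite -hsum mulr_sumr; apply: eq_bigr => r _.
rewrite /ind; case: (boolP (pideal _ (x - r))) => [h|_]; last by rewrite !mulr0.
rewrite -{1}(subrK r x) addrC hl//; apply: pideal_le h; lia.
Qed.

Definition cintegrable (f : F -> C) : Prop :=
  mu.-integrable setT (fun x : borelF F => (complex.Re (f x))%:E) /\
  mu.-integrable setT (fun x : borelF F => (complex.Im (f x))%:E).

Lemma schwartz_integrable (phi : F -> C) : schwartz phi -> cintegrable phi.
Proof.
move=> /schwartz_repr[rs [N h]]; split.
  by rewrite (_ : (fun _ => _) = fun x : borelF F => (indsum rs N (fun r => complex.Re (phi r)) x)%:E);
    [exact: integrable_indsum | rewrite -h].
by rewrite (_ : (fun _ => _) = fun x : borelF F => (indsum rs N (fun r => complex.Im (phi r)) x)%:E);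
    [exact: integrable_indsum | rewrite -h].
Qed.

Local Notation cint := (cintegral mu).

Lemma cintD (f g : F -> C) : cintegrable f -> cintegrable g ->
  cint (fun x => f x + g x) = cint f + cint g.
Proof.
move=> [f1 f2] [g1 g2]; rewrite /cintegral.
apply/eqP; rewrite eq_complex /=; apply/andP; split; apply/eqP;
  rewrite -RintegralD//; congr Rintegral;
  by apply/funext => x; case: (f x) (g x) => ? ? [].
Qed.

Lemma cint0 : cint (fun=> 0) = 0.
Proof.
by rewrite /cintegral /Rintegral /= !integral0.
Qed.


(** Complex linearity and the affine change of variables are both read off from this one finite sum;
    x -> b x + a pulls a ball of level N back to a ball of level N - v b. *)
Lemma cint_schwartz (phi : F -> C) : schwartz phi -> exists rs N,
  forall (H : C -> C), H 0 = 0 ->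
    cint (fun x => H (phi x)) = (\sum_(r <- rs) H (phi r)) * (vol * q ^ (- N))%:C /\
    (forall a b, b != 0 -> cint (fun x => H (phi (b * x + a))) =
       (\sum_(r <- rs) H (phi r)) * (vol * q ^ (v b - N))%:C).
Proof.
move=> /schwartz_repr[rs [N h]]; exists rs, N => H H0.
have ReM (z : C) (r : R) : complex.Re (z * r%:C) = complex.Re z * r.
  by case: z => ? ? /=; rewrite mulr0 subr0.
have ImM (z : C) (r : R) : complex.Im (z * r%:C) = complex.Im z * r.
  by case: z => ? ? /=; rewrite mulr0 add0r.
have hRe : (fun x => complex.Re (H (phi x))) = indsum rs N (fun r => complex.Re (H (phi r))).
  by apply: (h (fun z => complex.Re (H z))); rewrite H0.
have hIm : (fun x => complex.Im (H (phi x))) = indsum rs N (fun r => complex.Im (H (phi r))).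
  by apply: (h (fun z => complex.Im (H z))); rewrite H0.
have sumRe : complex.Re (\sum_(r <- rs) H (phi r)) = \sum_(r <- rs) complex.Re (H (phi r)).
  by rewrite raddf_sum.
have sumIm : complex.Im (\sum_(r <- rs) H (phi r)) = \sum_(r <- rs) complex.Im (H (phi r)).
  by rewrite raddf_sum.
split.
  apply/eqP; rewrite eq_complex ReM ImM sumRe sumIm /=.
  by rewrite hRe hIm !Rintegral_indsum !eqxx.
move=> a b b0.
have aff (c : F -> R) : (fun x => indsum rs N c (b * x + a)) =
    indsum [seq (r - a) / b | r <- rs] (N - v b) (fun y => c (b * y + a)).
  apply/funext => x; rewrite /indsum big_map; apply: eq_bigr => r _.
  have -> : b * ((r - a) / b) + a = r by field.
  congr (_ * _); rewrite /ind.
  have -> : b * x + a - r = b * (x - (r - a) / b) by field.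
  by rewrite pidealMl.
have hRe' : (fun x => complex.Re (H (phi (b * x + a)))) =
    fun x => indsum rs N (fun r => complex.Re (H (phi r))) (b * x + a).
  by apply/funext => x; exact: (congr1 (fun g => g (b * x + a)) hRe).
have hIm' : (fun x => complex.Im (H (phi (b * x + a)))) =
    fun x => indsum rs N (fun r => complex.Im (H (phi r))) (b * x + a).
  by apply/funext => x; exact: (congr1 (fun g => g (b * x + a)) hIm).
have red (c : F -> R) : \sum_(y <- [seq (r - a) / b | r <- rs]) c (b * y + a) = \sum_(r <- rs) c r.
  rewrite big_map; apply: eq_bigr => r _; congr c; field; exact: b0.
apply/eqP; rewrite eq_complex ReM ImM sumRe sumIm /=.
rewrite hRe' hIm' !aff !Rintegral_indsum.
rewrite (red (fun r => complex.Re (H (phi r)))) (red (fun r => complex.Im (H (phi r)))).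
by rewrite opprB !eqxx.
Qed.

Lemma cintZ (c : C) (phi : F -> C) : schwartz phi ->
  cint (fun x => c * phi x) = c * cint phi.
Proof.
move=> /cint_schwartz[rs [N h]].
have [-> _] := h (fun z => c * z) (mulr0 c).
have [-> _] := h (fun z => z) erefl.
by rewrite -mulr_sumr mulrA.
Qed.

Lemma cint_affine (a b : F) (phi : F -> C) : b != 0 -> schwartz phi ->
  cint (fun x => phi (b * x + a)) = (q ^ v b)%:C * cint phi.
Proof.
move=> b0 /cint_schwartz[rs [N h]].
have [-> /(_ a b b0) ->] := h (fun z => z) erefl.
by rewrite expfzDr ?q_neq0// !rmorphM/=; ring.
Qed.

Lemma cint_ball (c : C) (a : F) (k : int) :
  cint (fun x => c * (ind a k x)%:C) = c * (vol * q ^ (- k))%:C.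
Proof.
have E (u : R) : Rintegral mu setT (fun x : borelF F => u * ind a k x) = u * (vol * q ^ (- k)).
  have -> : (fun x : borelF F => u * ind a k x) = indsum [:: a] k (fun=> u).
    by apply/funext => x; rewrite /indsum big_seq1.
  by rewrite Rintegral_indsum big_seq1.
case: c => u u'; rewrite /cintegral.
apply/eqP; rewrite eq_complex /=; apply/andP; split; apply/eqP.
  rewrite mulr0 subr0 -E; congr Rintegral; apply/funext => x.
  by rewrite /= ?mulr0 subr0.
rewrite mulr0 add0r -E; congr Rintegral; apply/funext => x.
by rewrite /= ?mulr0 ?add0r.
Qed.

Lemma schwartz_ind a k : schwartz (fun x => (ind a k x)%:C).
Proof.
split.
  exists (Num.min k (if a == 0 then k else v a)) => x hx; rewrite /ind.
  rewrite (_ : pideal _ _ = false)//; apply: contraNF hx => h.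
  rewrite -(subrK a x) pidealD//; first by apply: pideal_le h; rewrite ge_min lexx.
  by have [->|a0] := eqVneq a 0; rewrite ?pideal0// pidealE// ge_min lexx orbT.
exists k => x y hy; congr (real_complex_def _ _); rewrite /ind.
by rewrite (addrAC x y (- a)) (pidealDr _ hy).
Qed.

Lemma schwartzM (phi f : F -> C) : schwartz phi ->
  (exists N : int, forall x y, phi x != 0 -> pideal N y -> f (x + y) = f x) ->
  schwartz (fun x => phi x * f x).
Proof.
move=> [[k hk] [l hl]] [N hN]; split; first by exists k => x /hk ->; rewrite mul0r.
exists (Num.max l N) => x y hy; rewrite hl; last first.
  by apply: pideal_le hy; rewrite le_max lexx.
have [->|px] := eqVneq (phi x) 0; first by rewrite !mul0r.
by rewrite hN//; apply: pideal_le hy; rewrite le_max lexx orbT.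
Qed.

Lemma schwartzD (f g : F -> C) : schwartz f -> schwartz g ->
  schwartz (fun x => f x + g x).
Proof.
move=> [[k hk] [l hl]] [[k' hk'] [l' hl']]; split.
  exists (Num.min k k') => x hx; rewrite hk ?hk' ?addr0//;
    apply: contra hx => hx; apply: pideal_le hx; by rewrite ge_min lexx ?orbT.
by exists (Num.max l l') => x y hy; rewrite hl ?hl'//; apply: pideal_le hy;
  rewrite le_max lexx ?orbT.
Qed.

Lemma schwartzZ (c : C) (f : F -> C) : schwartz f -> schwartz (fun x => c * f x).
Proof.
move=> [[k hk] [l hl]]; split; first by exists k => x /hk ->; rewrite mulr0.
by exists l => x y /hl ->.
Qed.

Lemma schwartz0 : schwartz (fun _ : F => 0 : C).
Proof. by split; [exists 0|exists 0]. Qed.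

Lemma schwartz_sum (f : nat -> F -> C) N : (forall m, schwartz (f m)) ->
  schwartz (fun x => \sum_(m < N) f m x).
Proof.
move=> hf; elim: N => [|N IH].
  by under eq_fun do rewrite big_ord0; exact: schwartz0.
under eq_fun do rewrite big_ord_recr/=.
exact: schwartzD.
Qed.

Lemma cint_sum (f : nat -> F -> C) N : (forall m, schwartz (f m)) ->
  cint (fun x => \sum_(m < N) f m x) = \sum_(m < N) cint (f m).
Proof.
move=> hf; elim: N => [|N IH].
  by under eq_fun do rewrite big_ord0; rewrite cint0 big_ord0.
under eq_fun do rewrite big_ord_recr/=.
rewrite cintD ?IH ?big_ord_recr//; apply: schwartz_integrable => //.
exact: schwartz_sum.
Qed.

Lemma schwartz_nm_integrable (phi : F -> C) : schwartz phi ->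
  mu.-integrable setT (fun x : borelF F => (nm (phi x))%:E).
Proof.
move=> /schwartz_repr[rs [N h]].
by rewrite (_ : (fun _ => _) = fun x : borelF F => (indsum rs N (fun r => nm (phi r)) x)%:E);
    [exact: integrable_indsum | rewrite -h// nm0].
Qed.

Lemma schwartz_nm_bound (phi : F -> C) (b : R) k : schwartz phi ->
  (forall x, nm (phi x) <= b * ind 0 k x) ->
  Rintegral mu setT (fun x : borelF F => nm (phi x)) <= b * (vol * q ^ (- k)).
Proof.
move=> hphi hb.
have -> : b * (vol * q ^ (- k)) = Rintegral mu setT (indsum [:: 0] k (fun=> b) : borelF F -> R).
  by rewrite Rintegral_indsum big_seq1.
apply: le_Rintegral => //; first exact: schwartz_nm_integrable.
  exact: integrable_indsum.
by move=> x _; rewrite /indsum big_seq1.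
Qed.

(** Monotone convergence of the moduli shows that |f| is integrable; it then serves as majorant in
    dominated convergence for the real and imaginary parts. Integrability is kept in the conclusion
    because additivity of the integral asks for it. *)
Lemma exhaustion (f : F -> C) (g : nat -> F -> C) (M : R) (c : C) :
  (forall N, schwartz (g N)) ->
  (forall x, exists N0, forall N, (N0 <= N)%N -> g N x = f x) ->
  (forall N x, nm (g N x) <= nm (g N.+1 x)) ->
  (forall N, Rintegral mu setT (fun x : borelF F => nm (g N x)) <= M) ->
  (fun N => cint (g N)) @ \oo --> c ->
  cintegrable f /\ cint f = c.
Proof.
move=> sg gf gmono gM gc.
have evcvg (T : ptopologicalType) (H : C -> T) x : (fun N => H (g N x)) @ \oo --> H (f x).
  apply: cvg_near_cst; have [N0 hN0] := gf x; exists N0 => // N hN.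
  by rewrite /= hN0.
have mnm N : measurable_fun setT (fun x : borelF F => (nm (g N x))%:E : \bar R).
  by have /integrableP[] := schwartz_nm_integrable (sg N).
have mono x : {homo (fun N => (nm (g N x))%:E : \bar R) : a b / (a <= b)%N >-> (a <= b)%E}.
  move=> a b ab; rewrite lee_fin; elim: b ab => [|b IH].
    by rewrite leqn0 => /eqP ->.
  rewrite leq_eqVlt => /orP[/eqP -> //|/IH h]; exact: le_trans h (gmono _ _).
have limE x : limn (fun N => (nm (g N x))%:E : \bar R) = (nm (f x))%:E.
  by apply/cvg_lim => //; exact: (evcvg _ (fun z => (nm z)%:E : \bar R)).
have fin_nm : (\int[mu]_x (nm (f x))%:E <= M%:E)%E.
  have := @cvg_monotone_convergence _ _ _ mu setT measurableT _ mnm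
    (fun N x _ => ltac:(by rewrite lee_fin nm_ge0)) (fun x _ => mono x).
  rewrite (eq_integral (fun x : borelF F => (nm (f x))%:E : \bar R)); last by move=> x _; rewrite limE.
  move=> h; apply: (lee_cvg_to h (@cvg_cst _ M%:E _ _ _)).
  apply: nearW => N /=; have := gM N; rewrite /Rintegral -lee_fin fineK//.
  exact: integrable_fin_num (schwartz_nm_integrable (sg N)).
have mnmf : measurable_fun setT (fun x : borelF F => (nm (f x))%:E : \bar R).
  apply: (emeasurable_fun_cvg (fun N (x : borelF F) => (nm (g N x))%:E : \bar R)) => //.
  by move=> x _; exact: (evcvg _ (fun z => (nm z)%:E : \bar R)).
have inm : mu.-integrable setT (fun x : borelF F => (nm (f x))%:E : \bar R).
  apply/integrableP; split => //.
  under eq_integral => x _ do rewrite abse_EFin ger0_norm ?nm_ge0//.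
  by apply: le_lt_trans fin_nm _; rewrite ltry.
have part (P : C -> R) : P 0 = 0 -> (forall z, `|P z| <= nm z) ->
    (forall x y, P (x - y) = P x - P y) ->
    (forall N, P (cint (g N)) = Rintegral mu setT (fun x : borelF F => P (g N x))) ->
    mu.-integrable setT (fun x : borelF F => (P (f x))%:E : \bar R) /\
    Rintegral mu setT (fun x : borelF F => P (f x)) = P c.
  move=> P0 Ple PB Pint.
  have iP N : mu.-integrable setT (fun x : borelF F => (P (g N x))%:E : \bar R).
    have [rs [l h]] := schwartz_repr (sg N).
    by rewrite (_ : (fun _ => _) = fun x : borelF F => (indsum rs l (fun r => P (g N r)) x)%:E);
      [exact: integrable_indsum | rewrite -h].
  have mP N : measurable_fun setT (fun x : borelF F => (P (g N x))%:E : \bar R).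
    by have /integrableP[] := iP N.
  have mPf : measurable_fun setT (fun x : borelF F => (P (f x))%:E : \bar R).
    apply: (emeasurable_fun_cvg (fun N (x : borelF F) => (P (g N x))%:E : \bar R)) => //.
    by move=> x _; exact: (evcvg _ (fun z => (P z)%:E : \bar R)).
  have iPf : mu.-integrable setT (fun x : borelF F => (P (f x))%:E : \bar R).
    apply: (le_integrable measurableT mPf _ inm) => x _.
    by rewrite !abse_EFin lee_fin (ger0_norm (nm_ge0 _)).
  split=> //.
  have gfle N x : nm (g N x) <= nm (f x).
    have [N0 hN0] := gf x; rewrite -(hN0 (maxn N0 N)) ?leq_maxl//.
    by rewrite -lee_fin; apply: mono; rewrite leq_maxr.
  have := @dominated_cvg _ _ _ mu setT measurableT
    (fun N (x : borelF F) => (P (g N x))%:E : \bar R) (fun x => (P (f x))%:E : \bar R) (fun x => (nm (f x))%:E : \bar R)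
    mP (fun x _ => evcvg _ (fun z => (P z)%:E : \bar R) x) (fun _ _ => isT) inm
    (fun N x _ => ltac:(by rewrite abse_EFin lee_fin (le_trans (Ple _))//)).
  rewrite -(fineK (integrable_fin_num measurableT iPf)) => /fine_cvg h.
  have h2 : (fun N => P (cint (g N))) @ \oo --> P c.
    apply/cvgrPdist_lt => e e0; have /cvg_nmP/(_ e e0) := gc.
    apply: filterS => N hN; rewrite distrC -PB.
    exact: le_lt_trans (Ple _) hN.
  apply: (cvg_unique (@Rhausdorff R) h); apply: cvg_trans h2.
  by apply: near_eq_cvg; apply: nearW => N; rewrite Pint.
have [i1 r1] := part (@complex.Re R) erefl (@nm_Re R)
  (fun x y => ltac:(by case: x y => ? ? [])) (fun N => erefl).
have [i2 r2] := part (@complex.Im R) erefl (@nm_Im R)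
  (fun x y => ltac:(by case: x y => ? ? [])) (fun N => erefl).
split=> //; rewrite /cintegral r1 r2.
by case: c {gc part r1 r2}.
Qed.

End Integration.

(** * Integrals over shells *)

Section ShellIntegrals.
Context {R : realType} {F : padicField} (mu : {measure set (borelF F) -> \bar R}).
Hypothesis mu_haar : is_haar mu.
Local Notation C := R[i].
Local Notation nm := (@Normc.normc R).
Local Notation v := (@pf_val F).
Local Notation w := (pf_unif F).
Local Notation q := ((pf_q F)%:R : R).
Local Notation cint := (cintegral mu).

Definition shell (l : int) (x : F) : bool := (x != 0) && (v x == l).

Lemma shellE l x : shell l x = pideal l x && ~~ pideal (l + 1) x.
Proof.
rewrite /shell; have [->|x0] := eqVneq x 0; first by rewrite !pideal0.
by rewrite val_eq.
Qed.

Lemma shellP l x : shell l x -> x != 0 /\ v x = l.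
Proof. by move=> /andP[? /eqP]. Qed.

Lemma shell_add l (x y : F) : pideal (l + 1) y -> shell l (x + y) = shell l x.
Proof.
move=> hy; rewrite !shellE !pidealDr//; apply: pideal_le hy; lia.
Qed.

Lemma shellM_unit l (u x : F) : u != 0 -> v u = 0 -> shell l (u * x) = shell l x.
Proof.
move=> u0 vu; rewrite /shell mulf_eq0 negb_or u0 /=.
by have [//|x0] := eqVneq x 0; rewrite pf_valM// vu add0r.
Qed.

Lemma shell_ind l x : (shell l x)%:R = (ind 0 l x)%:C - (ind 0 (l + 1) x)%:C :> C.
Proof.
rewrite shellE /ind !subr0; case: (boolP (pideal (l + 1) x)) => [h|_] /=.
  by rewrite andbF (pideal_le _ h) ?subrr//; lia.
by rewrite andbT subr0 rmorph_nat.
Qed.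

Lemma schwartz_shell l : schwartz (fun x => (shell l x)%:R : C).
Proof.
under eq_fun do rewrite shell_ind.
under eq_fun do rewrite -(mulN1r (ind 0 (l + 1) _)%:C).
by apply: schwartzD; [|apply: schwartzZ]; exact: schwartz_ind.
Qed.

Lemma schwartz_shellM l (f : F -> C) :
  (exists N : int, forall x y, shell l x -> pideal N y -> f (x + y) = f x) ->
  schwartz (fun x => (shell l x)%:R * f x).
Proof.
move=> [N hN]; apply: schwartzM; first exact: schwartz_shell.
by exists N => x y; case: (boolP (shell l x)) => [sx _|_]; [exact: hN|rewrite eqxx].
Qed.

(** The sign s is the direction in which shells are added from l0: 1 towards 0, -1 towards infinity.
    On disjoint shells the partial sums grow in modulus, and the hypothesis bounds value times
    volume geometrically, as exhaustion requires. *)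
Lemma shell_series (s l0 : int) (f : F -> C) (B rho : R) (c : C) :
  s = 1 \/ s = -1 ->
  (forall x, f x != 0 -> x != 0 /\ 0 <= s * (v x - l0)) ->
  (forall m : nat, schwartz (fun x => (shell (l0 + s * m%:Z) x)%:R * f x)) ->
  0 <= B -> 0 <= rho < 1 ->
  (forall (m : nat) x, shell (l0 + s * m%:Z) x ->
     nm (f x) * q ^ (- (l0 + s * m%:Z)) <= B * rho ^+ m) ->
  (fun N => \sum_(m < N) cint (fun x => (shell (l0 + s * m%:Z) x)%:R * f x)) @ \oo --> c ->
  cintegrable mu f /\ cint f = c.
Proof.
move=> s1 hf hs B0 /andP[r0 r1] hB hc.
have [_ vol0] := mu_pball00 mu_haar.
pose sh (m : nat) x := shell (l0 + s * m%:Z) x.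
pose g N x : C := \sum_(m < N) (sh m x)%:R * f x.
have shE (m : nat) x : x != 0 -> sh m x = (s * (v x - l0) == m%:Z).
  move=> x0; rewrite /sh /shell x0 /=; apply/eqP/eqP; case: s1 => ->; lia.
have gE N x : g N x = ((x != 0) && (0 <= s * (v x - l0) < N%:Z))%:R * f x.
  rewrite /g -mulr_suml; congr (_ * _).
  have [->|x0] /= := eqVneq x 0.
    by rewrite big1// => m _; rewrite /sh /shell eqxx.
  under eq_bigr do rewrite shE//.
  case: (s * (v x - l0)) => k; last by rewrite big1.
  have [kN|Nk] := ltnP k N.
    rewrite (bigD1 (Ordinal kN))//= eqxx big1 ?addr0 ?ltz_nat ?kN// => m.
    by rewrite -val_eqE /= eq_sym eqz_nat => /negbTE ->.
  rewrite big1 => [|m _]; first by rewrite ltz_nat ltnNge Nk.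
  by rewrite eqz_nat gtn_eqF// (leq_trans (ltn_ord m)).
have sg N : schwartz (g N).
  exact: (@schwartz_sum R F (fun m x => (sh m x)%:R * f x) N hs).
apply: (@exhaustion _ _ _ mu_haar f g (vol mu * B / (1 - rho)) c) => //.
- move=> x; have [fx|/hf[x0 hx]] := eqVneq (f x) 0.
    by exists 0%N => N _; rewrite gE fx mulr0.
  have [k hk] : exists k : nat, s * (v x - l0) = k%:Z.
    by exists (absz (s * (v x - l0))%R); rewrite gez0_abs.
  by exists k.+1 => N hN; rewrite gE x0 hk ltz_nat hN mul1r.
- move=> N x; rewrite !gE !nmM ler_wpM2r ?nm_ge0//.
  case: (boolP (_ && _)) => [/andP[-> /andP[-> h]]|_]; last by rewrite nm0 nm_ge0.
  by rewrite /= (lt_trans h)// ltz_nat.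
- have key N : Rintegral mu setT (fun x : borelF F => nm (g N x)) <=
      vol mu * B * \sum_(m < N) rho ^+ m.
    elim: N => [|N IH].
      rewrite big_ord0 mulr0 /Rintegral.
      under eq_integral => x _ do rewrite /g big_ord0 nm0.
      by rewrite integral0.
    have -> : (fun x : borelF F => nm (g N.+1 x)) =
        (fun x : borelF F => nm (g N x) + nm ((sh N x)%:R * f x)).
      apply/funext => x; rewrite /g big_ord_recr /= -/(g N x).
      case: (boolP (sh N x)) => [hx|_]; last by rewrite mul0r addr0 nm0 addr0.
      have [x0 _] := shellP hx; move: hx; rewrite shE// => /eqP hx.
      by rewrite gE x0 hx ltxx andbF mul0r nm0 !add0r.
    rewrite RintegralD//; last 2 first.
    - exact: (schwartz_nm_integrable mu_haar (sg N)).
    - exact: (schwartz_nm_integrable mu_haar (hs N)).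
    rewrite big_ord_recr/= mulrDr lerD//.
    pose l := l0 + s * N%:Z.
    have := @schwartz_nm_bound _ _ _ mu_haar _ (B * rho ^+ N * q ^ l) l (hs N).
    rewrite (_ : B * rho ^+ N * q ^ l * _ = vol mu * B * rho ^+ N); last first.
      have : q ^ l * q ^ (- l) = 1 by rewrite -expfzDr ?q_neq0// subrr expr0z.
      move=> h; rewrite (_ : _ * _ = (B * rho ^+ N * vol mu) * (q ^ l * q ^ (- l))); last by ring.
      by rewrite h; ring.
    apply => x; rewrite -/(sh N x) -/l.
    case: (boolP (sh N x)) => [hx|_]; last first.
      rewrite mul0r nm0 mulr_ge0 ?ler0n//.
      by rewrite !mulr_ge0 ?exprn_ge0// exprz_ge0// ltW// q_gt0.
    rewrite mul1r ind_eq; last by move: hx; rewrite /sh shellE subr0 => /andP[].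
    have := hB N x hx; rewrite mulr1 -ler_pdivlMr ?exprz_gt0 ?q_gt0//.
    by rewrite -/l invr_expz opprK.
  move=> N; apply: le_trans (key N) _; rewrite ler_wpM2l ?mulr_ge0// ?(ltW vol0)//.
  rewrite -[leRHS]mul1r ler_pdivlMr ?subr_gt0// mulr_suml.
  under eq_bigr do rewrite mulrBr mulr1 -exprSr.
  have -> : \sum_(m < N) (rho ^+ m - rho ^+ m.+1) = 1 - rho ^+ N.
    elim: N => [|N IH]; first by rewrite big_ord0 subrr.
    by rewrite big_ord_recr/= IH addrA subrK.
  by rewrite gerBl exprn_ge0.
- apply: cvg_trans hc; apply: near_eq_cvg; apply: nearW => N /=.
  by rewrite -(cint_sum mu_haar (f := fun m x => (sh m x)%:R * f x) N hs).
Qed.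

Lemma vol_gt0 : 0 < vol mu. Proof. by have [] := mu_pball00 mu_haar. Qed.

(** * Orthogonality for the additive character *)

Section AdditiveCharacter.
Context (psi : F -> C).
Hypothesis psi_spherical : spherical psi.

Lemma psiD x y : psi (x + y) = psi x * psi y.
Proof. by case: psi_spherical. Qed.

Lemma psi_O x : pideal 0 x -> psi x = 1.
Proof. by case: psi_spherical => _ _ h _; exact: h. Qed.

Lemma nm_psi x : nm (psi x) = 1.
Proof. by case: psi_spherical => _ h _ _; have := h x; rewrite normrE => /complexI. Qed.

Lemma psi_neq0 x : psi x != 0.
Proof. by rewrite -nm_eq0 nm_psi oner_neq0. Qed.

Lemma psi_lc x y : pideal 0 y -> psi (x + y) = psi x.
Proof. by move=> hy; rewrite psiD (psi_O hy) mulr1. Qed.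

Lemma psi_nontrivial k x : ~~ pideal (- k) x ->
  exists2 y, pideal k y & psi (x * y) != 1.
Proof.
move=> hx; case: psi_spherical => _ _ _ [b hb pb].
have x0 : x != 0 by apply: contraNneq hx => ->; exact: pideal0.
exists (b / x); last by rewrite mulrC divfK.
rewrite mulrC pidealMl ?invr_neq0// valV//; apply: pideal_le hb.
by move: hx; rewrite pidealE//; lia.
Qed.

Lemma schwartz_psi_ball (a x : F) k : schwartz (fun y => (ind a k y)%:C * psi (x * y)).
Proof.
apply: schwartzM; first exact: schwartz_ind.
exists (- v x) => y y' _ hy; rewrite mulrDr psi_lc//.
have [->|x0] := eqVneq x 0; first by rewrite mul0r pideal0.
by rewrite pidealMl// sub0r.
Qed.

(** If psi (x y) is nontrivial on P^k, translation by a witness multiplies the integral by a number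
    other than 1, so it is 0. *)
Lemma cint_psi_ball k (x : F) :
  cint (fun y => (ind 0 k y)%:C * psi (x * y)) =
  if pideal (- k) x then (vol mu * q ^ (- k))%:C else 0.
Proof.
case: ifPn => [hx|/psi_nontrivial[y0 hy0 py0]].
  rewrite -[RHS]mul1r -(cint_ball mu_haar 1 0 k); congr cintegral; apply/funext => y.
  rewrite mul1r /ind subr0; case: (boolP (pideal k y)) => [hy|_]; last by rewrite mul0r.
  by rewrite psi_O ?mulr1//; have := pidealM hx hy; rewrite addNr.
have := @cint_affine _ _ _ mu_haar y0 1 _ (oner_neq0 F) (schwartz_psi_ball 0 x k).
rewrite val1 expr0z mul1r.
under eq_fun => y.
  have -> : ind 0 k (1 * y + y0) = ind 0 k y.
    by rewrite /ind !subr0 mul1r pidealDr.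
  rewrite (_ : _ * _ = psi (x * y0) * ((ind 0 k y)%:C * psi (x * y))); last first.
    by rewrite mul1r mulrDr psiD; ring.
  over.
rewrite cintZ//; last exact: schwartz_psi_ball.
move/eqP; rewrite -subr_eq0 -{2}[cint _]mul1r -mulrBl mulf_eq0 subr_eq0 (negbTE py0).
by move=> /eqP.
Qed.

Lemma fourier_ball x : fourier mu psi (fun y => (ind 0 0 y)%:C) x
  = (vol mu)%:C * (ind 0 0 x)%:C.
Proof.
rewrite /fourier cint_psi_ball oppr0 expr0z mulr1 /ind subr0.
by case: ifP => _; rewrite ?mulr1 ?mulr0.
Qed.

(** The transform of the indicator of O is [vol mu] times itself; applying it twice and evaluating
    at 0 gives vol^2 = 1. *)
Lemma vol1 : self_dual mu psi -> vol mu = 1.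
Proof.
move=> /(_ _ (schwartz_ind 0 0) 0).
have -> : fourier mu psi (fun y => (ind 0 0 y)%:C) = fun x => (vol mu)%:C * (ind 0 0 x)%:C.
  by apply/funext => x; exact: fourier_ball.
rewrite /fourier.
under eq_fun do rewrite -mulrA.
rewrite cintZ//; last exact: schwartz_psi_ball.
rewrite cint_psi_ball pideal0 !oppr0 expr0z mulr1 /ind subr0 pideal0 -rmorphM/= => /complexI.
have := vol_gt0; nra.
Qed.

End AdditiveCharacter.

Lemma spherical_inv (psi : F -> C) : spherical psi -> spherical (fun x => (psi x)^-1).
Proof.
move=> [pD p1 pO [b hb pb]]; split.
- by move=> x y; rewrite pD invfM.
- by move=> x; rewrite normfV p1 invr1.
- by move=> x /pO ->; rewrite invr1.
- by exists b => //; rewrite invr_eq1.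
Qed.

Hypothesis vol_1 : vol mu = 1.

(** * Multiplicative characters on shells and cosets *)

Section MultiplicativeCharacter.
Context (xi : F -> C).
Hypothesis xi_char : is_character xi.

Lemma charM x y : x != 0 -> y != 0 -> xi (x * y) = xi x * xi y.
Proof. by case: xi_char => h *; exact: h. Qed.

Lemma char_neq0 x : x != 0 -> xi x != 0.
Proof. by case: xi_char => _ h *; exact: h. Qed.

Lemma char1 : xi 1 = 1.
Proof.
have n1 := char_neq0 (oner_neq0 F).
by apply: (mulfI n1); rewrite -charM ?oner_neq0// !mulr1.
Qed.

Lemma charV x : x != 0 -> xi x^-1 = (xi x)^-1.
Proof.
move=> x0; apply: (mulfI (char_neq0 x0)).
by rewrite -charM ?invr_neq0// !divff ?char_neq0// char1.
Qed.

Lemma charXz x (k : int) : x != 0 -> xi (x ^ k) = xi x ^ k.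
Proof.
move=> x0; have nat_case (m : nat) : xi (x ^+ m) = xi x ^+ m.
  elim: m => [|m IH]; first by rewrite char1.
  by rewrite !exprS charM ?expf_neq0// IH.
case: k => m; first exact: nat_case.
by rewrite NegzE -!exprnN charV ?expf_neq0// nat_case.
Qed.

Lemma char_add e (x y : F) : (forall u, ugroup e u -> xi u = 1) -> (0 < e)%N ->
  x != 0 -> pideal (v x + e%:Z) y -> xi (x + y) = xi x.
Proof.
move=> he e0 x0 hy; have -> : x + y = x * (1 + x^-1 * y) by field.
have hu : ugroup e (1 + x^-1 * y).
  case: e e0 {he} hy => // e _ hy; rewrite /ugroup/= addrC addKr.
  by rewrite pidealMl ?invr_neq0// valV// opprK addrC.
by have [u0 _] := ugroupP hu; rewrite charM// (he _ hu) mulr1.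
Qed.

Lemma char_trivial_pos : exists2 e, (0 < e)%N & forall u, ugroup e u -> xi u = 1.
Proof. by case: xi_char => _ _ [m hm]; exists m.+1. Qed.

Lemma schwartz_char_shell l (f : F -> C) :
  (exists N : int, forall x y, pideal N y -> f (x + y) = f x) ->
  schwartz (fun x => (shell l x)%:R * (xi x * f x)).
Proof.
move=> [N hN]; have [e e0 he] := char_trivial_pos.
apply: schwartz_shellM; exists (Num.max N (l + e%:Z)) => x y /shellP[x0 vx] hy.
rewrite hN; last by apply: pideal_le hy; rewrite le_max lexx.
rewrite (char_add he)// vx; apply: pideal_le hy.
by rewrite le_max lexx orbT.
Qed.

(** Being locally constant, xi takes finitely many values on units, which bounds it there without
    unitarity; each shell is a translate of the units by a power of w. *)
Lemma char_unit_bound : exists2 B : R, 0 <= B &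
  forall l x, shell l x -> nm (xi x) <= B * nm (xi w) ^ l.
Proof.
have hs : schwartz (fun x => (shell 0 x)%:R * (xi x * 1)).
  by apply: schwartz_char_shell; exists 0.
have [rs [N h]] := schwartz_repr hs.
exists (\sum_(r <- rs) nm ((shell 0 r)%:R * (xi r * 1))).
  by apply: sumr_ge0 => r _; exact: nm_ge0.
move=> l x /shellP[x0 vx]; have w0 := pf_unif_neq0 F.
have nw : nm (xi w) != 0 by rewrite nm_eq0 char_neq0.
pose u := x * w ^ (- l).
have su : shell 0 u by rewrite /shell mulf_neq0 ?unifXz_neq0// pf_valM ?unifXz_neq0// val_unifXz vx subrr.
have xE : nm (xi x) = nm (xi u) * nm (xi w) ^ l.
  have -> : x = u * w ^ l by rewrite /u -mulrA -expfzDr// addNr expr0z mulr1.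
  rewrite charM ?unifXz_neq0//; last by case/shellP: su.
  rewrite charXz// nmM; congr (_ * _).
  have nX (z : C) (m : nat) : nm (z ^+ m) = nm z ^+ m := nmX z m.
  by case: (l) => m; [rewrite -!exprnP nX|rewrite !NegzE -!exprnN nmV nX].
rewrite xE ler_wpM2r ?exprz_ge0 ?nm_ge0//.
have := congr1 (fun g => g u) (h nm nm0); rewrite /= su mul1r mulr1 => ->.
rewrite /indsum; apply: ler_sum => r _.
by rewrite ler_piMr ?nm_ge0// /ind lern1 leq_b1.
Qed.

Lemma cint_char_shell l : (exists2 u, ugroup 0 u & xi u != 1) ->
  cint (fun x => (shell l x)%:R * (xi x * 1)) = 0.
Proof.
move=> [u uu xu]; have [u0 vu] := ugroupP uu.
have hs : schwartz (fun x => (shell l x)%:R * (xi x * 1)).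
  by apply: schwartz_char_shell; exists 0.
have := cint_affine mu_haar 0 u0 hs; rewrite vu expr0z mul1r.
under eq_fun => x.
  rewrite addr0 shellM_unit// (_ : _ * _ = xi u * ((shell l x)%:R * (xi x * 1))); last first.
    case: (boolP (shell l x)) => [/shellP[x0 _]|_]; last by rewrite !mul0r mulr0.
    by rewrite !mul1r !mulr1 charM.
  over.
rewrite cintZ// => /eqP; rewrite -subr_eq0 -{2}[cint _]mul1r -mulrBl mulf_eq0 subr_eq0.
by rewrite (negbTE xu) => /eqP.
Qed.

(* For [l < - e] translate by an element of [P^-1] on which [psi] is nontrivial,
   for [l > - e] rescale by an element of [1 + P^(e - 1)] on which [xi] is. *)
Lemma cint_char_psi_shell_low (psi : F -> C) e l : spherical psi -> (0 < e)%N ->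
  (forall u, ugroup e u -> xi u = 1) -> l < - e%:Z ->
  cint (fun x => (shell l x)%:R * (xi x * psi x)) = 0.
Proof.
move=> sp e0 he le; have [pD _ pO [b hb pb]] := sp.
have hs : schwartz (fun x => (shell l x)%:R * (xi x * psi x)).
  by apply: schwartz_char_shell; exists 0 => x y hy; rewrite pD (pO y hy) mulr1.
have := cint_affine mu_haar b (oner_neq0 F) hs; rewrite val1 expr0z mul1r.
under eq_fun => x.
  rewrite mul1r shell_add; last by apply: pideal_le hb; lia.
  rewrite (_ : _ * _ = psi b * ((shell l x)%:R * (xi x * psi x))); last first.
    case: (boolP (shell l x)) => [/shellP[x0 vx]|_]; last by rewrite !mul0r mulr0.
    rewrite !mul1r pD (char_add he)//; first by ring.
    by rewrite vx; apply: pideal_le hb; lia.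
  over.
rewrite cintZ// => /eqP; rewrite -subr_eq0 -{2}[cint _]mul1r -mulrBl mulf_eq0 subr_eq0.
by rewrite (negbTE pb) => /eqP.
Qed.

Lemma cint_char_psi_shell_high (psi : F -> C) e l : spherical psi ->
  (exists2 u, ugroup e u & xi u != 1) -> - e.+1%:Z < l ->
  cint (fun x => (shell l x)%:R * (xi x * psi x)) = 0.
Proof.
move=> sp [u uu xu] le; have [u0 vu] := ugroupP uu; have [pD _ pO _] := sp.
have hs : schwartz (fun x => (shell l x)%:R * (xi x * psi x)).
  by apply: schwartz_char_shell; exists 0 => x y hy; rewrite pD (pO y hy) mulr1.
have := cint_affine mu_haar 0 u0 hs; rewrite vu expr0z mul1r.
under eq_fun => x.
  rewrite addr0 shellM_unit//.
  rewrite (_ : _ * _ = xi u * ((shell l x)%:R * (xi x * psi x))); last first.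
    case: (boolP (shell l x)) => [/shellP[x0 vx]|_]; last by rewrite !mul0r mulr0.
    rewrite !mul1r charM// -mulrA; congr (_ * (_ * _)).
    have -> : u * x = x + (u - 1) * x by ring.
    rewrite pD (pO (_ * x)) ?mulr1//.
    have h := ugroup_sub1 uu; have hx : pideal l x by rewrite pidealE// vx.
    by apply: pideal_le (pidealM h hx); lia.
  over.
rewrite cintZ// => /eqP; rewrite -subr_eq0 -{2}[cint _]mul1r -mulrBl mulf_eq0 subr_eq0.
by rewrite (negbTE xu) => /eqP.
Qed.

(** The ball is the coset a (1 + P^l). It is stable under 1 + P^l, so rescaling by an element where
    xi is nontrivial kills the integral. *)
Lemma cint_char_coset (a : F) l : a != 0 -> (0 < l)%N ->
  cint (fun x => (ind a (v a + l%:Z) x)%:C * xi x) =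
  if `[< forall u, ugroup l u -> xi u = 1 >]
  then xi a * (q ^ (- (v a + l%:Z)))%:C else 0.
Proof.
move=> a0 l0; case: asboolP => [hl|/existsNP[u /not_implyP[uu /eqP xu]]].
  have := cint_ball mu_haar (xi a) a (v a + l%:Z); rewrite vol_1 mul1r => <-.
  congr cintegral; apply/funext => x; rewrite /ind.
  case: (boolP (pideal _ (x - a))) => [h|_]; last by rewrite mul0r mulr0.
  rewrite mul1r mulr1 -{1}(subrK a x) addrC.
  exact: (char_add hl).
have [u0 vu] := ugroupP uu.
have xnz x : pideal (v a + l%:Z) (x - a) -> x != 0 /\ v x = v a.
  move=> h; have [|] := @val_add _ a (x - a) a0; first by apply: pideal_le h; lia.
  by rewrite addrC subrK.
have hs : schwartz (fun x => (ind a (v a + l%:Z) x)%:C * xi x).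
  have [e e0 he] := char_trivial_pos.
  apply: schwartzM; first exact: schwartz_ind.
  exists (v a + e%:Z) => x y hx hy.
  have h : pideal (v a + l%:Z) (x - a).
    by move: hx; rewrite /ind; case: (pideal _ _) => //; rewrite eqxx.
  by have [x0 vx] := xnz x h; rewrite (char_add he)// vx.
have := cint_affine mu_haar 0 u0 hs; rewrite vu expr0z mul1r.
under eq_fun => x.
  rewrite addr0 (_ : _ * _ = xi u * ((ind a (v a + l%:Z) x)%:C * xi x)); last first.
    have -> : ind a (v a + l%:Z) (u * x) = ind a (v a + l%:Z) x.
      rewrite /ind; have -> : u * x - a = u * (x - a) + a * (u - 1) by ring.
      have hu : pideal (v a + l%:Z) (a * (u - 1)).
        by rewrite pidealMl// addrC addKr ugroup_sub1.
      by rewrite (pidealDr _ hu) pidealMl// vu subr0.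
    rewrite /ind; case: (boolP (pideal _ (x - a))) => [/xnz[x0 _]|_]; last by rewrite !mul0r mulr0.
    by rewrite !mul1r charM.
  over.
rewrite cintZ// => /eqP; rewrite -subr_eq0 -{2}[cint _]mul1r -mulrBl mulf_eq0 subr_eq0.
by rewrite (negbTE xu) => /eqP.
Qed.

End MultiplicativeCharacter.

Lemma cint_shell l : cint (fun x => (shell l x)%:R) = (q ^ (- l) * (1 - q^-1))%:C.
Proof.
under eq_fun do rewrite shell_ind -(mulN1r (ind 0 (l + 1) _)%:C) -(mul1r (ind 0 l _)%:C).
rewrite cintD; last 2 first.
- by apply: schwartz_integrable => //; apply: schwartzZ; exact: schwartz_ind.
- by apply: schwartz_integrable => //; apply: schwartzZ; exact: schwartz_ind.
rewrite !cint_ball// vol_1 !mul1r mulN1r -rmorphB/=; congr (_%:C).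
by rewrite opprD expfzDr ?q_neq0// exprN1; ring.
Qed.

(** The shell is P^-1 minus O: the first integral vanishes and the second is 1. *)
Lemma cint_psi_shellN1 (psi : F -> C) : spherical psi ->
  cint (fun x => (shell (-1) x)%:R * psi x) = -1.
Proof.
move=> sp.
under eq_fun => x.
  have -> : (shell (-1) x)%:R * psi x =
      (ind 0 (-1) x)%:C * psi (1 * x) + (-1) * ((ind 0 0 x)%:C * psi (1 * x)).
    by rewrite shell_ind addNr mul1r; ring.
  over.
rewrite cintD; last 2 first.
- by apply: schwartz_integrable => //; exact: schwartz_psi_ball.
- by apply: schwartz_integrable => //; apply: schwartzZ; exact: schwartz_psi_ball.
rewrite cintZ//; last exact: schwartz_psi_ball.
rewrite !cint_psi_ball// opprK oppr0 pideal_1 pidealE ?oner_neq0// val1 /=.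
by rewrite vol_1 expr0z mulr1 add0r mulr1.
Qed.

End ShellIntegrals.

(** * Epsilon factors as Gauss integrals *)

Section PowersOfQ.
Context {R : realType} {F : padicField}.
Local Notation C := R[i].
Local Notation nm := (@Normc.normc R).
Local Notation v := (@pf_val F).
Local Notation q := ((pf_q F)%:R : R).
Local Notation qp := (@qpow R F).
Local Notation L := ((ln q)%:C : C).

Lemma qpowE s : qp s = cexp (s * L). Proof. by []. Qed.

Opaque qpow.

Lemma qpowD s t : qp (s + t) = qp s * qp t.
Proof. by rewrite !qpowE mulrDl cexpD. Qed.

Lemma qpow0 : qp 0 = 1. Proof. by rewrite qpowE mul0r cexp0. Qed.

Lemma qpow_neq0 s : qp s != 0. Proof. exact: cexp_neq0. Qed.

Lemma qpowN s : qp (- s) = (qp s)^-1. Proof. by rewrite !qpowE mulNr cexpN. Qed.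

Lemma qpowXz (k : int) y : qp (k%:~R * y) = qp y ^ k.
Proof.
have nat_case (j : nat) : qp (j%:R * y) = qp y ^+ j.
  elim: j => [|j IH]; first by rewrite mul0r qpow0.
  by rewrite -addn1 natrD mulrDl mul1r qpowD IH exprD expr1.
case: k => k; first exact: nat_case.
by rewrite NegzE mulrNz mulNr qpowN nat_case exprnN.
Qed.

Lemma nmXz (y : C) (k : int) : nm (y ^ k) = nm y ^ k.
Proof. by case: k => k; [exact: nmX|rewrite !NegzE -!exprnN nmV nmX]. Qed.

Lemma q_gt1R : 1 < q. Proof. by rewrite ltr1n q_gt1. Qed.

Lemma lnq_gt0 : 0 < ln q. Proof. by rewrite ln_gt0// q_gt1R. Qed.

Lemma qpow_int (k : int) : qp k%:~R = (q ^ k)%:C.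
Proof.
have h1 : qp 1 = q%:C by rewrite qpowE mul1r cexp_real lnK// posrE q_gt0.
have nat_case (m : nat) : qp m%:R = (q ^+ m)%:C.
  elim: m => [|m IH]; first exact: qpow0.
  by rewrite -addn1 natrD qpowD IH h1 -rmorphM/= exprD expr1.
case: k => m; first exact: nat_case.
by rewrite NegzE mulrNz qpowN nat_case -exprnN fmorphV.
Qed.

Lemma ln_qXz (k : int) : ln (q ^ k) = k%:~R * ln q.
Proof.
have := qpow_int k; rewrite qpowE -(rmorph_int (real_complex R)) -rmorphM/= cexp_real.
by move=> /complexI <-; rewrite expRK.
Qed.

Lemma pnormE (x : F) : x != 0 -> pnorm x = q ^ (- v x) :> R.
Proof. by rewrite /pnorm => /negbTE ->. Qed.

Lemma cpow_qXz (k : int) z : cpow (q ^ k) z = qp (k%:~R * z).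
Proof.
rewrite /cpow qpowE ln_qXz rmorphM/= rmorph_int; congr cexp; ring.
Qed.

Lemma nm_qpow z : nm (qp z) = expR (complex.Re z * ln q).
Proof.
rewrite qpowE nm_cexp; congr expR; case: z => a b /=; by rewrite mulr0 subr0.
Qed.

Lemma pnorm_le (x y : F) : x != 0 -> pideal (v x) y -> pnorm y <= pnorm x :> R.
Proof.
move=> x0; have [->|y0] := eqVneq y 0.
  by move=> _; rewrite {1}/pnorm eqxx pnormE// exprz_ge0// ltW// q_gt0.
by rewrite pidealE// !pnormE// ler_eXz2l ?q_gt1R//; lia.
Qed.

(** From exp x >= 1 + x. It places a right half-plane inside every domain of convergence, as the
    identity theorem requires. *)
Lemma pow_dominates (c : R) (m : nat) : (0 < m)%N ->
  exists sigma : R, forall z : C, sigma < complex.Re z ->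
    c < q `^ (m%:R * complex.Re z).
Proof.
move=> m0; have mL : 0 < m%:R * ln q by rewrite mulr_gt0 ?ltr0n ?lnq_gt0.
exists (c / (m%:R * ln q)) => z; rewrite ltr_pdivrMr// => h.
rewrite /powR gt_eqF ?q_gt0//.
apply: lt_le_trans (expR_ge1Dx _); move: h; lra.
Qed.

Lemma conv_dom_halfplane n (chi : F -> C) : (0 < n)%N ->
  exists sigma : R, forall z, sigma < complex.Re z -> conv_dom n chi z.
Proof. exact: pow_dominates. Qed.

Lemma zeta_dom_halfplane (chi : F -> C) :
  exists sigma : R, forall z, sigma < complex.Re z -> zeta_dom chi z.
Proof.
have [sigma h] := pow_dominates (nm (chi (pf_unif F))) (ltn0Sn 0).
by exists sigma => z /h; rewrite mul1r.
Qed.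

Lemma powRq (x : R) : q `^ x = expR (x * ln q).
Proof. by rewrite /powR gt_eqF// q_gt0. Qed.

Lemma zeta_dom_ratio (chi : F -> C) z : zeta_dom chi z ->
  nm (chi (pf_unif F)) * nm (qp (- z)) < 1.
Proof.
move=> hz; have h : nm (chi (pf_unif F)) < expR (complex.Re z * ln q).
  by rewrite -powRq.
by rewrite qpowN nmV nm_qpow ltr_pdivrMr ?expR_gt0// mul1r.
Qed.

(** The domain is stated for chi (w^n); taking n-th roots gives the ratio between neighbouring
    shells. *)
Lemma conv_dom_ratio n (chi : F -> C) z : is_character chi -> (0 < n)%N ->
  conv_dom n chi z -> nm (chi (pf_unif F)) * nm (qp (- z)) < 1.
Proof.
move=> hchi n0 hz; rewrite qpowN nmV nm_qpow.
have h : nm (chi (pf_unif F ^+ n)) < expR (n%:R * complex.Re z * ln q).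
  by rewrite -powRq.
have w0 := pf_unif_neq0 F.
have := charXz hchi n%:Z w0; rewrite -!exprnP => hX.
have {}h : nm (chi (pf_unif F)) ^+ n < expR (complex.Re z * ln q) ^+ n.
  by rewrite -nmX -hX -expRM_natl mulrA.
rewrite ltr_pdivrMr ?expR_gt0// mul1r.
by rewrite -(ltr_pXn2r n0) ?nnegrE ?nm_ge0 ?expR_ge0.
Qed.

Lemma mcont_qpow2 (U : set C) (g : C -> C) (sigma : R) (K1 a1 b1 K2 a2 b2 s : C) :
  (forall z, sigma < complex.Re z -> U z) ->
  (forall z, U z -> g z = K1 * qp (a1 * z + b1) + K2 * qp (a2 * z + b2)) ->
  mcont U g s = K1 * qp (a1 * s + b1) + K2 * qp (a2 * s + b2).
Proof.
have E K a b z : K * qp (a * z + b) = (K * qp b) * cexp ((a * L) * z).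
  by rewrite qpowD (qpowE (a * z)) (mulrAC a); ring.
move=> hU hg; rewrite (E K1) (E K2).
have h z : U z -> g z = (K1 * qp b1) * cexp ((a1 * L) * z) + (K2 * qp b2) * cexp ((a2 * L) * z).
  by move=> /hg ->; rewrite (E K1) (E K2).
exact: (@mcont_exp2 R U g sigma _ _ _ _ s hU h).
Qed.

Lemma mcont_qpow (U : set C) (g : C -> C) (sigma : R) (K a b s : C) :
  (forall z, sigma < complex.Re z -> U z) ->
  (forall z, U z -> g z = K * qp (a * z + b)) ->
  mcont U g s = K * qp (a * s + b).
Proof.
move=> hU hg; rewrite (@mcont_qpow2 U g sigma K a b 0 0 0)// ?mul0r ?addr0//.
by move=> z /hg ->; rewrite mul0r addr0.
Qed.

Lemma mcont_0 (U : set C) (g : C -> C) (sigma : R) (s : C) :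
  (forall z, sigma < complex.Re z -> U z) ->
  (forall z, U z -> g z = 0) -> mcont U g s = 0.
Proof.
move=> hU hg; rewrite (@mcont_qpow U g sigma 0 0 0)// ?mul0r//.
by move=> z /hg ->; rewrite mul0r.
Qed.

(** The function is the reciprocal of a multiple of q^(-a z) - q^(-(a + n) z), a sum of two
    exponentials with distinct rates because n > 0 and ln q > 0. *)
Lemma mcont_geom (U : set C) (g : C -> C) (sigma : R) (n : nat) (K a b s : C) :
  (forall z, sigma < complex.Re z -> U z) -> (0 < n)%N -> K != 0 ->
  qp (- (n%:R * s)) != 1 ->
  (forall z, U z -> g z = K * qp (a * z + b) / (1 - qp (- (n%:R * z)))) ->
  mcont U g s = K * qp (a * s + b) / (1 - qp (- (n%:R * s))).
Proof.
move=> hU n0 K0 hs hg.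
pose K1 := K^-1 * qp (- b).
have K10 : K1 != 0 by rewrite mulf_neq0 ?invr_eq0 ?qpow_neq0.
have E z : K * qp (a * z + b) / (1 - qp (- (n%:R * z))) =
    (K1 * cexp (- a * L * z) + (- K1) * cexp (- (a + n%:R) * L * z))^-1.
  have -> : cexp (- a * L * z) = (qp (a * z))^-1.
    by rewrite -qpowN qpowE; congr cexp; ring.
  have -> : cexp (- (a + n%:R) * L * z) = (qp (a * z))^-1 * qp (- (n%:R * z)).
    by rewrite -qpowN -qpowD qpowE; congr cexp; ring.
  rewrite /K1 qpowN qpowD; move: (qpow_neq0 (a * z)) (qpow_neq0 b).
  move: (qp (a * z)) (qp b) (qp (- _)) => X Y Z X0 Y0.
  rewrite mulNr -mulrBr -{1}[X^-1]mulr1 -mulrBr !invfM !invrK; ring.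
rewrite E; apply: mcont_inv_exp2 hU K10 _ _ _.
- rewrite -subr_eq0 -mulrBl mulf_eq0 negb_or opprK addrC subr_eq0.
  rewrite -[X in _ == X]addr0 (inj_eq (addrI a)) pnatr_eq0 -lt0n n0 /=.
  by rewrite -(rmorph0 (real_complex R)) (inj_eq (@complexI R)) gt_eqF// lnq_gt0.
- have h1 : 1 - qp (- (n%:R * s)) != 0 by rewrite subr_eq0 eq_sym.
  rewrite -invr_eq0 -E; apply: mulf_neq0; last by rewrite invr_eq0.
  by apply: mulf_neq0 => //; exact: qpow_neq0.
- by move=> z /hg ->; rewrite E.
Qed.

End PowersOfQ.

Section EpsilonFactor.
Context {R : realType} {F : padicField} (mu : {measure set (borelF F) -> \bar R}).
Hypothesis mu_haar : is_haar mu.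
Local Notation C := R[i].
Local Notation nm := (@Normc.normc R).
Local Notation v := (@pf_val F).
Local Notation w := (pf_unif F).
Local Notation q := ((pf_q F)%:R : R).
Local Notation qp := (@qpow R F).
Local Notation cint := (cintegral mu).
Hypothesis vol_1 : vol mu = 1.

(** The partial sums are constant once the shell m0 is included; the geometric bound still has to be
    checked on all shells. *)
Lemma shell_single (s l0 : int) (f : F -> C) (B rho : R) (m0 : nat) :
  s = 1 \/ s = -1 ->
  (forall x, f x != 0 -> x != 0 /\ 0 <= s * (v x - l0)) ->
  (forall m : nat, schwartz (fun x => (shell (l0 + s * m%:Z) x)%:R * f x)) ->
  0 <= B -> 0 <= rho < 1 ->
  (forall (m : nat) x, shell (l0 + s * m%:Z) x ->
     nm (f x) * q ^ (- (l0 + s * m%:Z)) <= B * rho ^+ m) ->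
  (forall m : nat, m != m0 -> cint (fun x => (shell (l0 + s * m%:Z) x)%:R * f x) = 0) ->
  cintegrable mu f /\
  cint f = cint (fun x => (shell (l0 + s * m0%:Z) x)%:R * f x).
Proof.
move=> s1 hf hs B0 r01 hB h0; apply: (shell_series mu_haar s1 hf hs B0 r01 hB).
apply: cvg_near_cst; exists m0.+1 => // N /= hN; apply/eqP.
by rewrite (bigD1 (Ordinal hN))//= big1 ?addr0// => m hm; apply: h0.
Qed.

(** * The Gauss integral of a ramified character *)

Section GaussIntegral.
Context (psi : F -> C) (xi : F -> C) (e : nat).
Hypothesis psi_spherical : spherical psi.
Hypothesis xi_char : is_character xi.
Hypothesis xi_cond : is_conductor xi e.+1.

Definition gauss : C := cint (fun x => (shell (- e.+1%:Z) x)%:R * (xi x * (psi x)^-1)).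

Lemma cint_gauss_shell l : l != - e.+1%:Z ->
  cint (fun x => (shell l x)%:R * (xi x * (psi x)^-1)) = 0.
Proof.
move=> hl; have sp := spherical_inv psi_spherical; have [h1 h2] := xi_cond.
have [lt|le] := ltP l (- e.+1%:Z).
  exact: (cint_char_psi_shell_low mu_haar xi_char sp (ltn0Sn e) h1 lt).
apply: (cint_char_psi_shell_high mu_haar xi_char sp (h2 e (ltnSn e))).
by rewrite lt_neqAle eq_sym hl.
Qed.

(** Only the shell of valuation -(e + 1) contributes, and there |x|^(z - 1) = q^((e + 1) (z - 1));
    the zeta integral is therefore a single exponential. *)
Lemma zeta_gauss s :
  zeta mu s xi (fun x => (ind 0 (- e.+1%:Z) x)%:C * (psi x)^-1)
  = gauss * qp (e.+1%:R * s + (- e.+1%:R)).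
Proof.
have [sigma hsig] := @zeta_dom_halfplane R F xi.
rewrite /zeta; apply: mcont_qpow hsig _ => z hz; rewrite mulrC.
have sp := spherical_inv psi_spherical.
set f := (X in cint X).
have fE l x : shell l x -> - e.+1%:Z <= l ->
    f x = qp (- l%:~R * (z - 1)) * (xi x * (psi x)^-1).
  move=> /shellP[x0 vx] hl; rewrite /f (negbTE x0) pnormE// vx cpow_qXz.
  rewrite ind_eq ?mul1r; last by rewrite subr0 pidealE// vx.
  rewrite fmorphV/= -qpow_int -qpowN mulrBr mulr1 qpowD opprK mulrNz.
  by rewrite opprK; ring.
have f_low x : ~~ pideal (- e.+1%:Z) x -> f x = 0.
  by move=> hx; rewrite /f; case: eqP => // _; rewrite /ind subr0 (negbTE hx) !mul0r.
have hshell (m : nat) : (fun x => (shell (- e.+1%:Z + 1 * m%:Z) x)%:R * f x) =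
   (fun x => qp (- (- e.+1%:Z + 1 * m%:Z)%:~R * (z - 1)) *
     ((shell (- e.+1%:Z + 1 * m%:Z) x)%:R * (xi x * (psi x)^-1))).
  have le : - e.+1%:Z <= - e.+1%:Z + 1 * m%:Z by lia.
  move: le; set l := - e.+1%:Z + _ => le; apply/funext => x.
  case: (boolP (shell l x)) => [hx|_]; last by rewrite !mul0r mulr0.
  by rewrite !mul1r (fE _ _ hx).
have sch l : schwartz (fun x => (shell l x)%:R * (xi x * (psi x)^-1)).
  apply: schwartz_char_shell => //; exists 0 => x y hy; exact: (psi_lc sp).
have [B B0 hB] := char_unit_bound xi_char.
have rho1 := zeta_dom_ratio hz; set rho := nm (xi w) * _ in rho1.
have nw : 0 < nm (xi w) by rewrite nm_gt0 char_neq0// pf_unif_neq0.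
have nq : 0 < nm (qp (- z)) by rewrite nm_gt0 qpow_neq0.
have rho0 : 0 < rho by rewrite mulr_gt0.
have [|||||||_ ->] := @shell_single 1 (- e.+1%:Z) f (B * rho ^ (- e.+1%:Z)) rho 0.
- by left.
- move=> x fx; have x0 : x != 0 by apply: contraNneq fx => ->; rewrite /f eqxx.
  split=> //; rewrite mul1r subr_ge0 -pidealE//.
  by apply: contraNT fx => /f_low ->.
- by move=> m; rewrite hshell; apply: schwartzZ.
- by rewrite mulr_ge0// exprz_ge0// ltW.
- by rewrite (ltW rho0).
- move=> m x hx; rewrite (fE _ _ hx); last by lia.
  have := hB _ _ hx; set l := _ + _.
  rewrite (nmM (qp _)) (nmM (xi x)) nmV (nm_psi psi_spherical) invr1 mulr1 => h.
  have -> : B * rho ^ (- e.+1%:Z) * rho ^+ m = B * rho ^ l.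
    by rewrite -mulrA /l expfzDr ?gt_eqF// mul1r.
  have -> : nm (qp (- l%:~R * (z - 1))) = nm (qp (- z)) ^ l * q ^ l.
    have -> : - l%:~R * (z - 1) = l%:~R * - z + l%:~R by ring.
    rewrite qpowD nmM qpowXz nmXz qpow_int nm_real ger0_norm//.
    by rewrite exprz_ge0// ltW// q_gt0.
  rewrite mulrAC -(mulrA _ (q ^ l)) -expfzDr ?q_neq0// subrr expr0z mulr1 mulrC.
  by rewrite /rho expfzMl mulrA; apply: ler_wpM2r => //; rewrite exprz_ge0// ltW.
- move=> m m0; rewrite hshell cintZ// cint_gauss_shell ?mulr0//.
  by lia.
rewrite hshell cintZ// mulr0 addr0; congr (qp _ * _); ring.
Qed.

(** The product psi (x y) psi (y)^-1 is psi ((x - 1) y), which centres the resulting ball at 1. *)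
Lemma fourier_gauss :
  fourier mu psi (fun x => (ind 0 (- e.+1%:Z) x)%:C * (psi x)^-1)
  = fun x => (q ^+ e.+1)%:C * (ind 1 e.+1%:Z x)%:C.
Proof.
apply/funext => x; rewrite /fourier.
under eq_fun => y.
  rewrite (_ : _ * _ = (ind 0 (- e.+1%:Z) y)%:C * psi ((x - 1) * y)); last first.
    have -> : x * y = (x - 1) * y + y by ring.
    by rewrite (psiD psi_spherical) -mulrA; congr (_ * _); rewrite mulrC mulfK// (psi_neq0 psi_spherical).
  over.
rewrite (cint_psi_ball mu_haar psi_spherical) opprK vol_1 mul1r /ind.
by case: ifP => _; rewrite ?mulr1 ?mulr0.
Qed.

Lemma zeta_fourier_gauss s :
  zeta mu s (fun x => (xi x)^-1)
    (fourier mu psi (fun x => (ind 0 (- e.+1%:Z) x)%:C * (psi x)^-1)) = 1.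
Proof.
rewrite fourier_gauss.
have [sigma hsig] := @zeta_dom_halfplane R F (fun x => (xi x)^-1).
have E1 : 1 = 1 * qp (0 * s + 0) by rewrite mul0r addr0 qpow0 mul1r.
rewrite /zeta [RHS]E1; apply: mcont_qpow hsig _ => z _.
have -> : 1 * qp (0 * z + 0) = (q ^+ e.+1)%:C * (vol mu * q ^ (- e.+1%:Z))%:C.
  rewrite mul0r addr0 qpow0 vol_1 !mul1r -rmorphM/= exprnP.
  by rewrite -expfzDr ?q_neq0// subrr expr0z.
rewrite -(cint_ball mu_haar _ 1); congr cintegral; apply/funext => x.
have [->|x0] := eqVneq x 0.
  rewrite /ind sub0r pidealN pidealE ?oner_neq0// val1.
  by rewrite (_ : (e.+1%:Z <= 0) = false) ?mulr0//; lia.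
rewrite /ind; case: (boolP (pideal _ (x - 1))) => [ux|_]; last by rewrite !mulr0 !mul0r.
have ugx : ugroup e.+1 x by [].
have [_ vx] := ugroupP ugx; have [h1 _] := xi_cond.
by rewrite (h1 _ ugx) pnormE// vx cpow_qXz mul0r qpow0 expr0z !invr1 !mulr1.
Qed.

Lemma schwartz_gauss : schwartz (fun x => (ind 0 (- e.+1%:Z) x)%:C * (psi x)^-1).
Proof.
apply: schwartzM; first exact: schwartz_ind.
by exists 0 => x y _ hy; rewrite (psi_lc psi_spherical).
Qed.

Lemma ramified_of_conductor : ~ unramified xi.
Proof.
by move=> h; case: xi_cond => _ /(_ 0%N isT)[u /h ->]; rewrite eqxx.
Qed.

(** Both L-factors are 1, so gamma is eps off isolated points. The functional equation holds only on
    a punctured neighbourhood of s; the limit clause for [eps] carries it to s. The product being 1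
    also shows that [eps s] is nonzero. *)
Lemma epsilon_gauss (eps : C -> C) s : is_epsilon mu psi xi eps ->
  eps s * (gauss * qp (e.+1%:R * s + (- e.+1%:R))) = 1.
Proof.
move=> [eps_lim [gamma [_ hgamma] heps]].
have ram := ramified_of_conductor.
have ramV : ~ unramified (fun x => (xi x)^-1).
  by move=> h; apply: ram => x ux; have /eqP := h x ux; rewrite invr_eq1 => /eqP.
have near1 : \forall z \near s^', eps z * (gauss * qp (e.+1%:R * z + (- e.+1%:R))) = 1.
  have h1 := hgamma _ schwartz_gauss s; have h2 := heps s.
  apply: filterS2 h1 h2 => z; rewrite zeta_fourier_gauss zeta_gauss.
  rewrite /Lfactor; case: asboolP => // _; case: asboolP => // _.
  by rewrite mulr1 divr1 => h <-.
have lim1 : eps z * (gauss * qp (e.+1%:R * z + (- e.+1%:R))) @[z --> s^'] --> (1 : C).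
  have h : (fun=> 1 : C) z @[z --> s^'] --> (1 : C) by exact: cvg_cst.
  apply: cvg_trans h; apply: near_eq_cvg; apply: filterS near1 => z /esym.
  by [].
have lim2 : eps z * (gauss * qp (e.+1%:R * z + (- e.+1%:R))) @[z --> s^']
    --> eps s * (gauss * qp (e.+1%:R * s + (- e.+1%:R))).
  apply: cvgM; first exact: eps_lim.
  have E z : gauss * qp (e.+1%:R * z + (- e.+1%:R)) =
     (gauss * qp (- e.+1%:R)) * cexp ((e.+1%:R * (ln q)%:C) * z).
    by rewrite qpowD (qpowE (e.+1%:R * z)) (mulrAC e.+1%:R); ring.
  have -> : (fun z => gauss * qp (e.+1%:R * z + (- e.+1%:R))) =
     (fun z => (gauss * qp (- e.+1%:R)) * cexp ((e.+1%:R * (ln q)%:C) * z)).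
    by apply/funext => z; exact: E.
  rewrite (E s); exact: exp_cvg.
exact: (cvg_unique (@norm_hausdorff _ _) lim2 lim1).
Qed.

End GaussIntegral.
End EpsilonFactor.

(** * Test sections of the principal series *)

Lemma geom_progression_cvg (R : realType) (X : R[i]) (n r : nat) : (r < n)%N ->
  Normc.normc X < 1 -> 1 - X ^+ n != 0 ->
  (fun N => \sum_(m < N) if (m == r %[mod n])%N then X ^+ m else 0) @ \oo -->
    X ^+ r / (1 - X ^+ n).
Proof.
move=> rn X1 Xn.
(* Here e is the next exponent of the progression that has not yet been summed. *)
have closed N : exists e, [/\ (N <= e < N + n)%N, (e == r %[mod n])%N &
    \sum_(m < N) (if (m == r %[mod n])%N then X ^+ m else 0) =
    (X ^+ r - X ^+ e) / (1 - X ^+ n)].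
  elim: N => [|N [e [/andP[Ne eN] er IH]]].
    by exists r; rewrite big_ord0 subrr mul0r.
  rewrite big_ord_recr/= IH; case: ifP => hN.
    have eE : e = N.
      have := er; rewrite -(eqP hN) eqn_mod_dvd// => /dvdnP[k hk].
      have k0 : k = 0%N by nia.
      by move: hk; rewrite k0; lia.
    exists (N + n)%N; split; first by lia.
      by rewrite modnDr.
    rewrite eE -{2}[X ^+ N](mulfK Xn) -mulrDl; congr (_ / _).
    by rewrite exprD; ring.
  exists e; split=> //; last by rewrite addr0.
  rewrite addSn (ltn_trans eN)// ltn_neqAle Ne !andbT.
  by apply: contraFneq hN => ->.
apply/cvg_nmP => eps eps0.
have /cvgrPdist_lt/(_ eps eps0) :
    (fun N => Normc.normc (1 - X ^+ n)^-1 * Normc.normc X ^+ N) @ \oo --> (0 : R).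
  rewrite -(mulr0 (Normc.normc (1 - X ^+ n)^-1)); apply: cvgM; first exact: cvg_cst.
  by apply: cvg_expr; rewrite ger0_norm ?nm_ge0.
move=> [N0 _ hN0]; exists N0 => // N hN.
have [e [/andP[Ne _] _ ->]] := closed N.
rewrite -mulrBl addrAC subrr sub0r nmM nmN mulrC.
have := hN0 N hN; rewrite /= sub0r normrN => h; apply: le_lt_trans h.
rewrite ger0_norm ?mulr_ge0 ?exprn_ge0 ?nm_ge0// ler_wpM2l ?nm_ge0//.
by rewrite nmX ler_wiXn2l ?nm_ge0// ltW.
Qed.

(** * Bottom rows and the Kubota cocycle *)

Section Cover.
Context {R : realType} {F : padicField} (n : nat).
Hypothesis n_odd : odd n.
Hypothesis coprime_pn : coprime (pf_p F) n.
Hypothesis mu_n_F : exists z : F, n.-primitive_root z.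
Context (hilb : F -> F -> F).
Hypothesis hilbP : is_hilbert_symbol n hilb.
Context (iota : F -> R[i]).
Hypothesis iotaP : is_root_identification n iota.
Local Notation C := R[i].
Local Notation v := (@pf_val F).
Local Notation w := (pf_unif F).
Local Notation sym := (fun x y => iota (hilb x y)).
Local Notation SL2 := (@SL2 F).
Local Notation cover := (@Defs.cover R F n).
Local Notation mul := (@cover_mul R F n sym).
Local Notation sec := (@sec R F n).

Lemma ord2P (i : 'I_2) : i = 0 \/ i = 1.
Proof. by case: i => [[|[|m]] hi]; [left|right|]; try exact: val_inj. Qed.

Lemma det2 (A : 'M[F]_2) : \det A = A 0 0 * A 1 1 - A 0 1 * A 1 0.
Proof.
rewrite (expand_det_row A 0) big_ord_recl big_ord1 /cofactor !det_mx11 !mxE/=.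
have -> : lift 0 0 = 1 :> 'I_2 by exact: val_inj.
have -> : lift 1 0 = 0 :> 'I_2 by exact: val_inj.
by rewrite expr0 expr1; ring.
Qed.

Lemma mulmx2 (A B : 'M[F]_2) i k : (A *m B) i k = A i 0 * B 0 k + A i 1 * B 1 k.
Proof.
rewrite mxE big_ord_recl big_ord1.
by have -> : lift 0 0 = 1 :> 'I_2 by exact: val_inj.
Qed.

Lemma val_sl2 (A : 'M[F]_2) : \det A = 1 -> val (sl2 A) = A.
Proof. by move=> h; rewrite /sl2 insubdK// unfold_in h eqxx. Qed.

Lemma det_sl2 (g : SL2) : \det (val g) = 1.
Proof. by apply/eqP; case: g. Qed.

Lemma val_sl2_mul (g k : SL2) : val (sl2_mul g k) = val g *m val k.
Proof. by rewrite val_sl2// det_mulmx !det_sl2 mulr1. Qed.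

Lemma val_sl2_n (x : F) : val (sl2_n x) = mx22 1 x 0 1.
Proof. by rewrite val_sl2// det2 !mxE/=; ring. Qed.

Lemma val_sl2_h (a : F) : a != 0 -> val (sl2_h a) = mx22 a 0 0 a^-1.
Proof. by move=> a0; rewrite val_sl2// det2 !mxE/= divff//; ring. Qed.

Lemma val_sl2_w : val (@sl2_w F) = mx22 0 1 (-1) 0.
Proof. by rewrite val_sl2// det2 !mxE/=; ring. Qed.

(** Left multiplication by n(x) fixes the bottom row and h(a) scales it by a^-1; the Kubota function
    and the height depend on it alone. Sections can thus be described on bottom rows. *)
Definition bot (g : SL2) : F * F := (val g 1 0, val g 1 1).


Lemma bot_mul g k : bot (sl2_mul g k) =
  ((bot g).1 * val k 0 0 + (bot g).2 * val k 1 0,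
   (bot g).1 * val k 0 1 + (bot g).2 * val k 1 1).
Proof. by rewrite /bot val_sl2_mul !mulmx2. Qed.

Lemma bot_n x : bot (sl2_n x) = (0, 1).
Proof. by rewrite /bot val_sl2_n !mxE. Qed.

Lemma bot_h a : a != 0 -> bot (sl2_h a) = (0, a^-1).
Proof. by move=> a0; rewrite /bot val_sl2_h// !mxE. Qed.

Lemma bot_w : bot (@sl2_w F) = (-1, 0).
Proof. by rewrite /bot val_sl2_w !mxE. Qed.

Lemma bot_hM a g : a != 0 -> bot (sl2_mul (sl2_h a) g) = (a^-1 * (bot g).1, a^-1 * (bot g).2).
Proof. by move=> a0; rewrite bot_mul bot_h// !mul0r !add0r. Qed.

Lemma bot_wn x : bot (sl2_mul (@sl2_w F) (sl2_n x)) = (-1, - x).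
Proof.
rewrite bot_mul bot_w/= val_sl2_n !mxE/=.
by rewrite !mul0r !addr0 mulr1 mulN1r.
Qed.

Lemma bot_wnM x g : bot (sl2_mul (sl2_mul (@sl2_w F) (sl2_n x)) g) =
  (- val g 0 0 - x * (bot g).1, - val g 0 1 - x * (bot g).2).
Proof. by rewrite bot_mul bot_wn !mulN1r !mulNr. Qed.

Definition xb (b : F * F) : F := if b.1 != 0 then b.1 else b.2.

Lemma xb_neq0 (g : SL2) : xb (bot g) != 0.
Proof.
rewrite /xb/=; case: ifP => // /negbFE/eqP h.
apply/eqP => h1; have := det_sl2 g; rewrite det2 h h1 !mulr0 subrr => /esym/eqP.
by rewrite oner_eq0.
Qed.

Lemma xbM (a : F) b : a != 0 -> xb (a * b.1, a * b.2) = a * xb b.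
Proof. by move=> a0; rewrite /xb/= mulf_eq0 (negbTE a0)/=; case: ifP. Qed.

Lemma cocycleE g k : cocycle sym g k =
  sym (xb (bot (sl2_mul g k)) / xb (bot g)) (xb (bot (sl2_mul g k)) / xb (bot k)).
Proof. by []. Qed.

Lemma cocycle_n g k : cocycle sym g k ^+ n = 1.
Proof.
by rewrite cocycleE (sym_n hilbP iotaP)// mulf_neq0 ?invr_neq0 ?xb_neq0.
Qed.

Lemma val_mkroot (z : C) : z ^+ n = 1 -> val (mkroot n z) = z.
Proof. by move=> h; rewrite /mkroot insubdK// unfold_in h eqxx. Qed.

Lemma croot_n (z : croot n) : (val z : C) ^+ n = 1.
Proof. by apply/eqP; case: z. Qed.

Lemma mul2E (g k : cover) : val (mul g k).2 = cocycle sym g.1 k.1 * val g.2 * val k.2.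
Proof. by rewrite val_mkroot// !exprMn !croot_n cocycle_n !mulr1. Qed.

Lemma sec2E g : val (sec g).2 = 1 :> C.
Proof. by rewrite val_mkroot// expr1n. Qed.

Let sV := symVr n_odd hilbP iotaP.

Lemma borel_mul2 a x (e : croot n) (g : cover) : a != 0 ->
  val (mul (mul (sl2_h a, e) (sec (sl2_n x))) g).2
  = sym (xb (bot g.1)) a^-1 * val e * val g.2.
Proof.
move=> a0; have a10 : a^-1 != 0 by rewrite invr_neq0.
rewrite !mul2E sec2E mulr1/=; have hb : bot (sl2_mul (sl2_h a) (sl2_n x)) = (0, a^-1).
  by rewrite bot_hM// bot_n mulr0 mulr1.
have xb0 d : xb (0, d) = d by rewrite /xb/= eqxx.
have bg : bot (sl2_mul (sl2_mul (sl2_h a) (sl2_n x)) g.1)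
    = (a^-1 * (bot g.1).1, a^-1 * (bot g.1).2).
  rewrite bot_mul hb; have -> : (0, a^-1).1 = 0 :> F by [].
  by rewrite !mul0r !add0r.
rewrite !cocycleE bg hb bot_h// bot_n (xbM (bot g.1))// !xb0.
rewrite divff// (sym1l n_odd hilbP iotaP) ?divr1// mul1r; congr (_ * _ * _).
by congr (iota (hilb _ _)); [rewrite mulrC mulKf//|rewrite mulfK// xb_neq0].
Qed.

(** The new left entry is c (k00 + (d / c) k10), and d / c is integral. *)
Lemma iwahori_unit (m : nat) (c d : F) (g k : SL2) : bot g = (c, d) -> congruence m.+1 k ->
  c != 0 -> pideal (v c) d ->
  exists2 u, ugroup m.+1 u & (bot (sl2_mul g k)).1 = c * u /\
    pideal (v c) (bot (sl2_mul g k)).2.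
Proof.
move=> hg hk c0 hd; have h00 := hk 0 0; have h01 := hk 0 1; have h10 := hk 1 0.
have h11 := hk 1 1; rewrite bot_mul hg; move: h00 h01 h10 h11.
rewrite !mxE/= !mulr0n !mulr1n !subr0 => h00 h01 h10 h11.

have O11 : pideal 0 (sval k 1 1).
  rewrite -(subrK 1 (sval k 1 1)); apply: pidealD; first exact: pideal_le h11.
  by rewrite pidealE ?oner_neq0// val1.
have dc : pideal 0 (d / c) by rewrite mulrC pidealMl ?invr_neq0// valV// opprK add0r.
exists (sval k 0 0 + (d / c) * sval k 1 0).
  rewrite /ugroup/= addrAC pidealD//.
  by rewrite -[_%:Z]add0r pidealM.
split; first by rewrite mulrDr mulrA mulrCA divff// mulr1 (mulrC d).
apply: pidealD; first by rewrite pidealMl// subrr; exact: pideal_le h01.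
by rewrite -[v c]addr0 pidealM.
Qed.

Definition sl2_inv (k : SL2) : SL2 := sl2 (mx22 (val k 1 1) (- val k 0 1) (- val k 1 0) (val k 0 0)).

Lemma val_sl2_inv k : val (sl2_inv k) = mx22 (val k 1 1) (- val k 0 1) (- val k 1 0) (val k 0 0).
Proof.
rewrite val_sl2// det2 !mxE/=; apply: etrans (det_sl2 k); rewrite det2/=; ring.
Qed.

Lemma bot_mulK g k : bot (sl2_mul (sl2_mul g k) (sl2_inv k)) = bot g.
Proof.
have hk := det_sl2 k; rewrite det2 in hk.
rewrite !bot_mul/= val_sl2_inv !mxE/=; move: hk.
move: (sval k 0 0) (sval k 0 1) (sval k 1 0) (sval k 1 1) => k00 k01 k10 k11 hk.
rewrite [RHS]surjective_pairing/=.
move: (sval g 1 0) (sval g 1 1) => c d.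
by congr pair; [rewrite -[RHS]mulr1|rewrite -[RHS]mulr1]; rewrite -hk; ring.
Qed.

Lemma congruence_inv m k : congruence m.+1 k -> congruence m.+1 (sl2_inv k).
Proof.
move=> hk; have h00 := hk 0 0; have h01 := hk 0 1; have h10 := hk 1 0.
have h11 := hk 1 1; move: h00 h01 h10 h11.
rewrite !mxE/= !mulr0n !mulr1n !subr0 => h00 h01 h10 h11.
rewrite /congruence val_sl2_inv => i l.
have [->|->] := ord2P i; have [->|->] := ord2P l; rewrite !mxE/= ?mulr0n ?mulr1n ?subr0//.
  by rewrite pidealN.
by rewrite pidealN.
Qed.

(** The first argument of the cocycle is a unit of 1 + P, which pairs trivially with everything. *)
Lemma congruence_mul2 m (g : cover) k : congruence m.+1 k -> (bot g.1).1 != 0 ->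
  pideal (v (bot g.1).1) (bot g.1).2 -> val (mul g (sec k)).2 = val g.2 :> C.
Proof.
move=> hk c0 hd; rewrite mul2E sec2E mulr1/= cocycleE.
have [u uu [hu _]] := iwahori_unit (surjective_pairing _) hk c0 hd.
have [u0 _] := ugroupP uu.
have -> : xb (bot (sl2_mul g.1 k)) = (bot g.1).1 * u by rewrite /xb hu mulf_neq0.
have -> : xb (bot g.1) = (bot g.1).1 by rewrite /xb c0.
rewrite (mulrAC _ u) divff// mul1r (sym_ugroup1l n_odd coprime_pn hilbP iotaP) ?mul1r//.
  exact: ugroup_le uu.
by rewrite mulf_neq0 ?invr_neq0 ?xb_neq0// mulf_neq0.
Qed.

Local Notation qp := (@qpow R F).

Lemma character_mul (a b : F -> C) : is_character a -> is_character b ->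
  is_character (fun y => a y * b y).
Proof.
move=> ha hb; split.
- by move=> x y x0 y0; rewrite (charM ha)// (charM hb)//; ring.
- by move=> x x0; rewrite mulf_neq0// char_neq0.
- have [[|e] // _ he] := char_trivial_pos ha; have [[|f] // _ hf] := char_trivial_pos hb.
  exists (maxn e f) => u uu; rewrite he ?hf ?mulr1//; apply: ugroup_le uu; lia.
Qed.

Lemma character_inv (a : F -> C) : is_character a -> is_character (fun y => (a y)^-1).
Proof.
move=> ha; split.
- by move=> x y x0 y0; rewrite (charM ha)// invfM.
- by move=> x x0; rewrite invr_neq0// char_neq0.
- have [[|e] // _ he] := char_trivial_pos ha.
  by exists e => u uu; rewrite he// invr1.
Qed.

Section TestFunction.
Context (chi : F -> C) (s : C) (j : nat).
Hypothesis chi_char : is_character chi.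

(** Bottom rows (c, d) of h(a) h(w^j) w n(y) with y = d / c integral and a = - c^-1 w^-j of
    valuation divisible by n. *)
Definition good (b : F * F) : bool :=
  [&& b.1 != 0, pideal (v b.1) b.2 & (n%:Z %| v b.1 + j%:Z)%Z].

(* The section of I(chi, s) supported on the big cell, with value [1_O(y)] at
   h(w^j) w n(y), written in terms of the bottom row of the matrix. *)
Definition tphi (b : F * F) : C :=
  if good b then chi (- b.1^-1 * w ^ (- j%:Z)) * qp ((v b.1 + j%:Z)%:~R * (s + 1))
    * sym w b.1 ^ j%:Z
  else 0.

Definition testf (g : cover) : C := val g.2 * tphi (bot g.1).

Lemma good_scale a (b : F * F) : a != 0 -> (n%:Z %| v a)%Z ->
  good (a^-1 * b.1, a^-1 * b.2) = good b.
Proof.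
move=> a0 na; rewrite /good/= mulf_eq0 invr_eq0 (negbTE a0)/=.
have [//|c0] := eqVneq b.1 0; rewrite /= pf_valM ?invr_neq0// valV//.
rewrite pidealMl ?invr_neq0// valV// (_ : - v a + v b.1 - - v a = v b.1); last by ring.
by rewrite -addrA rpredDl// rpredN.
Qed.

(* Here [n | v a] and [v c = - j] modulo n, so tameness makes the cocycle
   [(c, a^-1)] cancel the factor by which [(w, c)^j] changes. *)
Lemma testf_left a x (e : croot n) (g : cover) : a != 0 -> (n%:Z %| v a)%Z ->
  testf (mul (mul (sl2_h a, e) (sec (sl2_n x))) g)
  = val e * chi a * cpow (pnorm a) (s + 1) * testf g.
Proof.
move=> a0 na; rewrite /testf borel_mul2//.
have -> : bot (mul (mul (sl2_h a, e) (sec (sl2_n x))) g).1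
    = (a^-1 * (bot g.1).1, a^-1 * (bot g.1).2).
  rewrite /= bot_mul bot_hM// bot_n.
  by congr pair; rewrite /= mulr0 mul0r add0r mulr1.
rewrite /tphi good_scale//; case: ifP => [gd|_]; last by rewrite !mulr0.
move: gd; rewrite /good => /and3P[].
have -> : xb (bot g.1) = if (bot g.1).1 != 0 then (bot g.1).1 else (bot g.1).2 by [].
move: (bot g.1) (val g.2) => [c d] t; move: (val e) => e' /=.
move=> c0 hd hn; rewrite c0.
have w0 := pf_unif_neq0 F; have a10 : a^-1 != 0 by rewrite invr_neq0.
have c10 : - c^-1 * w ^ (- j%:Z) != 0.
  by rewrite mulf_neq0 ?oppr_eq0 ?invr_eq0 ?unifXz_neq0.
have -> : - (a^-1 * c)^-1 * w ^ (- j%:Z) = a * (- c^-1 * w ^ (- j%:Z)).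
  by rewrite invfM invrK; ring.
rewrite charM//.
rewrite (symMr hilbP iotaP w0 a10 c0) expfzMl pf_valM// valV//.
have -> : (- v a + v c + j%:Z)%:~R * (s + 1) = (- v a)%:~R * (s + 1) + (v c + j%:Z)%:~R * (s + 1) :> C.
  by rewrite -mulrDl -rmorphD/= addrA.
rewrite qpowD pnormE// cpow_qXz.
have hs : iota (hilb c a^-1) * iota (hilb w a^-1) ^ j%:Z = 1.
  rewrite !sV// (sym_tame (j := - j%:Z) n_odd coprime_pn mu_n_F hilbP iotaP c0 a0 na); last first.
    by rewrite opprK.
  have e0 : iota (hilb w a) != 0 by exact: (sym_neq0 n_odd hilbP iotaP).
  by rewrite -invr_expz invrK exprz_inv -expfzDr// subrr.
move: (qp _) (qp _) (chi a) (chi (- _ * _)) (iota (hilb w c) ^ _) hs => A B D E G.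
move: (iota (hilb c _)) (iota (hilb w _) ^ _) => Y X XY.
transitivity ((Y * X) * (e' * t * (D * E * (B * A) * G))); first ring.
by rewrite XY; ring.
Qed.

Lemma testf_smooth e (g : cover) (k : SL2) : (forall u, ugroup e.+1 u -> chi u = 1) ->
  congruence e.+1 k -> testf (mul g (sec k)) = testf g.
Proof.
move=> he hk; rewrite /testf.
have bK : bot (sl2_mul (sl2_mul g.1 k) (sl2_inv k)) = bot g.1 by exact: bot_mulK.
have step (h : SL2) (k' : SL2) : congruence e.+1 k' -> good (bot h) ->
    exists2 u, ugroup e.+1 u & (bot (sl2_mul h k')).1 = (bot h).1 * u /\ good (bot (sl2_mul h k')).
  move=> hk' /and3P[c0 hd hn].
  have [u uu [hu hd']] := iwahori_unit (surjective_pairing _) hk' c0 hd.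
  have [u0 vu] := ugroupP uu.
  exists u => //; split=> //; rewrite /good hu mulf_neq0//= pf_valM// vu addr0 hn.
  by rewrite hd'.
rewrite /tphi; case: (boolP (good (bot g.1))) => [gd|ngd]; last first.
  case: ifP => [gd|_]; last by rewrite !mulr0.
  have [_ _ [_]] := step _ _ (congruence_inv hk) gd.
  by rewrite bK (negbTE ngd).
have [u uu [hu gd']] := step _ _ hk gd.
have -> : bot (mul g (sec k)).1 = bot (sl2_mul g.1 k) by [].
rewrite gd' hu; case/and3P : gd => c0 hd hn.
rewrite (congruence_mul2 hk)//.
have [u0 vu] := ugroupP uu; have w0 := pf_unif_neq0 F.
rewrite pf_valM// vu addr0 (symMr hilbP iotaP w0 c0 u0).
rewrite (sym_ugroup1r n_odd coprime_pn mu_n_F hilbP iotaP (ugroup_le _ uu) w0)// mulr1.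
move: (bot g.1).1 c0 => c c0.
have -> : - (c * u)^-1 * w ^ (- j%:Z) = u^-1 * (- c^-1 * w ^ (- j%:Z)).
  by rewrite invfM; ring.
rewrite charM ?invr_neq0//; last by rewrite mulf_neq0 ?oppr_eq0 ?invr_eq0 ?unifXz_neq0.
by rewrite charV// (he u uu) invr1 mul1r.
Qed.

Lemma testf_princ_series : princ_series sym chi s testf.
Proof.
split; first by move=> a x e g a0 na; exact: testf_left.
have [[|e] // _ he] := char_trivial_pos chi_char.
by exists e => g k hk; exact: testf_smooth he hk.
Qed.

Local Notation P i x :=
  (mul (sec (sl2_h (w ^+ i))) (sec (sl2_mul (@sl2_w F) (sl2_n x)))).

Lemma unifX_neq0 i : w ^+ i != 0 :> F.
Proof. by rewrite expf_neq0// pf_unif_neq0. Qed.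

Lemma val_unifX i : v (w ^+ i) = i%:Z.
Proof. exact: (val_unifXz i%:Z). Qed.

Lemma bot_P i x : bot (P i x).1 = (- (w ^+ i)^-1, - ((w ^+ i)^-1 * x)).
Proof. by rewrite /= bot_hM ?unifX_neq0// bot_wn mulrN1 mulrN. Qed.

Lemma top_P i x : val (P i x).1 0 0 = 0 /\ val (P i x).1 0 1 = w ^+ i.
Proof.
rewrite /= !val_sl2_mul val_sl2_w val_sl2_n val_sl2_h ?unifX_neq0//.
by rewrite !mulmx2 !mxE/=; split; ring.
Qed.

Lemma bot_wnP i x y : bot (mul (mul (sec (@sl2_w F)) (sec (sl2_n x))) (P i y)).1
   = (x * (w ^+ i)^-1, x * ((w ^+ i)^-1 * y) - w ^+ i).
Proof.
have [h00 h01] := top_P i y;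
rewrite [LHS]bot_wnM h00 h01 bot_P/=.
by rewrite oppr0 add0r !mulrN !opprK addrC.
Qed.

Lemma P2E i x : val (P i x).2 = 1 :> C.
Proof.
have t0 := unifX_neq0 i.
rewrite mul2E !sec2E !mulr1 cocycleE bot_hM// bot_wn bot_h//= mulrN1 /xb/=.
rewrite eqxx/= !oppr_eq0 invr_eq0 t0 oner_neq0/= mulNr divff ?invr_neq0//.
by rewrite (symN1l n_odd mu_n_F hilbP iotaP)// invrN1 mulrN1 opprK invr_neq0.
Qed.

Lemma wnP2E i x y : x != 0 ->
  val (mul (mul (sec (@sl2_w F)) (sec (sl2_n x))) (P i y)).2 = iota (hilb w x) ^ (- i%:Z) :> C.
Proof.
move=> x0; have t0 := unifX_neq0 i; have w0 := pf_unif_neq0 F.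
have N0 : (-1 : F) != 0 by rewrite oppr_eq0 oner_neq0.
rewrite mul2E P2E mulr1 mul2E !sec2E !mulr1 !cocycleE.
have -> : bot (sl2_mul (mul (sec (@sl2_w F)) (sec (sl2_n x))).1 (P i y).1) = _ := bot_wnP i x y.
rewrite bot_P /= bot_wn bot_w bot_n /xb/= mulf_neq0 ?invr_neq0// !oppr_eq0 invr_eq0 t0 oner_neq0 eqxx/=.
rewrite divff// divr1 (sym1l n_odd hilbP iotaP)// mulr1 invrN1 mulrN1 invrN invrK mulrN mulfVK//.
have xt0 : x * (w ^+ i)^-1 != 0 by rewrite mulf_neq0 ?invr_neq0.
rewrite (symNr n_odd hilbP iotaP) ?oppr_eq0// -(mulN1r (x / _)) (symMl hilbP iotaP)//.
rewrite (symN1l n_odd mu_n_F hilbP iotaP)// mul1r (symMl hilbP iotaP) ?invr_neq0//.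
rewrite (sym_self n_odd mu_n_F hilbP iotaP)// mul1r.
rewrite (symVl n_odd hilbP iotaP)// (symC n_odd mu_n_F hilbP iotaP t0 x0) invrK.
by rewrite (symXzr n_odd hilbP iotaP i%:Z x0 w0) (symC n_odd mu_n_F hilbP iotaP x0 w0) exprz_inv.
Qed.

Lemma height_l (g : cover) : (bot g.1).1 != 0 -> pideal (v (bot g.1).1) (bot g.1).2 ->
  height g = pnorm (bot g.1).1 :> R.
Proof. by move=> c0 hd; rewrite /height; apply/max_idPl; exact: pnorm_le. Qed.

Lemma height_r (g : cover) : (bot g.1).2 != 0 -> pideal (v (bot g.1).2) (bot g.1).1 ->
  height g = pnorm (bot g.1).2 :> R.
Proof. by move=> c0 hd; rewrite /height; apply/max_idPr; exact: pnorm_le. Qed.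

(** On the support d / c is integral, so the height is |c|. *)
Lemma flat_testf z (g : cover) : flat s testf z g =
  if good (bot g.1) then
    val g.2 * tphi (bot g.1) * qp ((- v (bot g.1).1)%:~R * (s - z)) else 0.
Proof.
rewrite /flat /testf; case: ifP => [gd|ngd]; last by rewrite /tphi ngd mulr0 mul0r.
by case/and3P: gd => c0 hd _; rewrite height_l// pnormE// cpow_qXz.
Qed.

Context (mu : {measure set (borelF F) -> \bar R}).
Hypothesis mu_haar : is_haar mu.
Hypothesis vol_1 : vol mu = 1.
Local Notation cint := (cintegral mu).
Local Notation q := ((pf_q F)%:R : R).
Local Notation nm := (@Normc.normc R).
Context (psi : F -> C).
Hypothesis psi_spherical : spherical psi.

Lemma whittaker_testf (i : nat) : (i < n)%N -> (j < n)%N ->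
  whittaker sym mu i psi chi s testf = (i == j)%:R.
Proof.
move=> ilt jlt.
have [sigma hsig] := conv_dom_halfplane chi (n_gt0 n_odd).
have t0 := unifX_neq0 i; have w0 := pf_unif_neq0 F.
have integrandE z x : flat s testf z (P i x) * (psi x)^-1 =
    (i == j)%:R * qp ((- j%:R) * z + j%:R * s) * (ind 0 0 x)%:C.
  rewrite flat_testf P2E mul1r bot_P /good/= oppr_eq0 invr_eq0 t0/= !valN.
  rewrite !pidealN pidealMl ?invr_eq0// subrr /ind subr0 valV// val_unifX.
  case: (boolP (pideal 0 x)) => xO; last by rewrite mul0r mulr0.
  (* Both indices are below n, so their difference is a multiple of n only if it is 0. *)
  have -> : (n%:Z %| - i%:Z + j%:Z)%Z = (i == j).
    apply/idP/eqP => [|->]; last by rewrite addNr dvdz0.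
    move=> /dvdzP[m hm]; have : m = 0 by nia.
    by move=> m0; move: hm; rewrite m0; lia.
  case: eqP => [ij|_]; last by rewrite !mul0r.
  rewrite -ij (psi_O psi_spherical xO) invr1 !mulr1 mul1r /tphi /good/=.
  rewrite oppr_eq0 invr_eq0 t0/= !valN !pidealN pidealMl ?invr_eq0// subrr xO.
  rewrite valV// val_unifX -ij addNr dvdz0 /= mul0r qpow0 mulr1.
  rewrite invrN invrK opprK -exprnN divff// (char1 chi_char) mul1r.
  rewrite (symNr n_odd hilbP iotaP) ?invr_neq0//.
  have -> : (w ^+ i)^-1 = w ^ (- i%:Z) by rewrite exprnN.
  rewrite (symXzr n_odd hilbP iotaP _ w0 w0) (sym_self n_odd mu_n_F hilbP iotaP)//.
  by rewrite !exp1rz mul1r opprK; congr qp; ring.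
rewrite /whittaker (@mcont_qpow R F _ _ sigma (i == j)%:R (- j%:R) (j%:R * s) s hsig).
  by rewrite mulNr addNr qpow0 mulr1.
move=> z hz; under eq_fun do rewrite integrandE.
by rewrite (cint_ball mu_haar) oppr0 expr0z vol_1 mulr1 mulr1.
Qed.

(** * The intertwining integral of a test section *)

Context (i : nat).

(* The twist by eta^(i - j) collects the two cocycles and the factor of [tphi]. *)
Definition xi (y : F) : C := chi y * iota (hilb w y) ^ (i%:Z - j%:Z).

Lemma xi_character : is_character xi.
Proof.
apply: character_mul => //.
exact: (eta_character n_odd coprime_pn mu_n_F hilbP iotaP).
Qed.

Let xiV_character := character_inv xi_character.

Lemma xi_unif : xi w = chi w.
Proof.
by rewrite /xi (sym_self n_odd mu_n_F hilbP iotaP) ?exp1rz ?mulr1// pf_unif_neq0.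
Qed.

(** For v x = l the left bottom entry x w^-i has valuation l - i; this is the product of the factor
    |a|^(s + 1) in [tphi] and the power of the height in [flat], sorted by the dependence on l. *)
Definition coef (z : C) (l : int) : C :=
  qp ((j%:R - i%:R) * (s + 1) + i%:R * (s - z)) * qp (l%:~R * (z + 1)).

Definition K0 : C := chi (-1) * chi w ^ (i%:Z - j%:Z).

Notation integrand z y := (fun x =>
  flat s testf z (mul (mul (sec (@sl2_w F)) (sec (sl2_n x))) (P i y))).

(** The bottom row of w n(x) h(w^i) w n(y) is (x w^-i, x y w^-i - w^i). The Borel coordinate is -
    x^-1 w^(i - j), whence the constant [K0] and the factor chi (x)^-1. *)
Lemma integrandE z x y : integrand z y x =
  if [&& x != 0, pideal (v x - i%:Z) (x * ((w ^+ i)^-1 * y) - w ^+ i)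
      & (n%:Z %| v x - i%:Z + j%:Z)%Z]
  then K0 * coef z (v x) * (xi x)^-1 else 0.
Proof.
have t0 := unifX_neq0 i; have w0 := pf_unif_neq0 F.
rewrite flat_testf bot_wnP; have [->|x0] := eqVneq x 0; first by rewrite /good/= mul0r eqxx.
have vE : v (x * (w ^+ i)^-1) = v x - i%:Z.
  by rewrite pf_valM ?invr_neq0// valV// val_unifX.
have -> : good (x * (w ^+ i)^-1, x * ((w ^+ i)^-1 * y) - w ^+ i) =
    pideal (v x - i%:Z) (x * ((w ^+ i)^-1 * y) - w ^+ i) && (n%:Z %| v x - i%:Z + j%:Z)%Z.
  by rewrite /good mulf_neq0 ?invr_neq0//= vE.
rewrite /=; case: ifP => // gd; rewrite wnP2E//= /tphi.
have -> : good (x * (w ^+ i)^-1, x * ((w ^+ i)^-1 * y) - w ^+ i).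
  by rewrite /good mulf_neq0 ?invr_neq0//= vE.
rewrite /= vE (symMr hilbP iotaP) ?invr_neq0// exprnN (symXzr n_odd hilbP iotaP)//.
rewrite (sym_self n_odd mu_n_F hilbP iotaP)// exp1rz mulr1.
have N0 : (-1 : F) != 0 by rewrite oppr_eq0 oner_neq0.
have -> : - (x * w ^ (- i%:Z))^-1 * w ^ (- j%:Z) = -1 * (x^-1 * w ^ (i%:Z - j%:Z)).
  by rewrite invfM invr_expz opprK expfzDr//; ring.
rewrite !(charM chi_char) ?mulf_neq0 ?invr_neq0 ?unifXz_neq0// (charV chi_char)//.
rewrite (charXz chi_char)//.
have e0 : iota (hilb w x) != 0 by exact: (sym_neq0 n_odd hilbP iotaP).
rewrite /K0 /coef /xi invfM invr_expz (opprB i%:Z).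
have -> : iota (hilb w x) ^ (j%:Z - i%:Z) = iota (hilb w x) ^ j%:Z * iota (hilb w x) ^ (- i%:Z).
  exact: expfzDr.
have hq : qp ((v x - i%:Z + j%:Z)%:~R * (s + 1)) * qp ((- (v x - i%:Z))%:~R * (s - z)) =
   qp ((j%:R - i%:R) * (s + 1) + i%:R * (s - z)) * qp ((v x)%:~R * (z + 1)).
  by rewrite -!qpowD; congr qp; ring.
rewrite -hq; move: (qp _) (qp _) (iota _ ^ j%:Z) (iota _ ^ _) (chi w ^ _) (chi (-1)) (chi x)^-1.
by move=> *; ring.
Qed.
Lemma triv_inv l : `[< forall u, ugroup l u -> (xi u)^-1 = 1 >] =
  `[< forall u, ugroup l u -> xi u = 1 >].
Proof.
apply: asbool_equiv_eq; split=> h u /h; last by move->; rewrite invr1.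
by move=> /eqP; rewrite invr_eq1 => /eqP.
Qed.

(* As [v y < 0], the second bottom entry is small enough only if [x y] cancels
   w^(2 i), which confines x to the coset of 1 + P^l through w^(2 i) / y. *)
Lemma integrand_low z y (l : nat) : y != 0 -> v y = - l%:Z -> (0 < l)%N ->
  integrand z y = fun x =>
    (if (n %| i + j + l)%N then K0 * coef z (2 * i%:Z + l%:Z) else 0) *
    ((ind (w ^+ (2 * i) / y) (2 * i%:Z + l%:Z + l%:Z) x)%:C * (xi x)^-1).
Proof.
move=> y0 vy l0; apply/funext => x; rewrite integrandE.
have t0 := unifX_neq0 i; have b0 : w ^+ (2 * i) / y != 0.
  by rewrite mulf_neq0 ?invr_neq0// unifX_neq0.
have vb : v (w ^+ (2 * i) / y) = 2 * i%:Z + l%:Z.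
  rewrite pf_valM ?invr_neq0 ?unifX_neq0// valV// val_unifX vy; lia.
have [->|x0] := eqVneq x 0.
  rewrite /= /ind sub0r pidealN pidealE// vb.
  by rewrite (_ : (_ <= _) = false) ?mul0r ?mulr0//; lia.
have shift : x * ((w ^+ i)^-1 * y) - w ^+ i = ((w ^+ i)^-1 * y) * (x - w ^+ (2 * i) / y).
  rewrite mulrBr mulrC; congr (_ - _).
  by rewrite mul2n -addnn exprD; field; rewrite y0 t0.
have cond : pideal (v x - i%:Z) (x * ((w ^+ i)^-1 * y) - w ^+ i) =
    pideal (2 * i%:Z + l%:Z + l%:Z) (x - w ^+ (2 * i) / y).
  have c0 : (w ^+ i)^-1 * y != 0 by rewrite mulf_neq0 ?invr_neq0.
  have vc : v ((w ^+ i)^-1 * y) = - i%:Z - l%:Z.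
    by rewrite pf_valM ?invr_neq0// valV// val_unifX vy.
  rewrite shift pidealMl// vc.
  have E : v x = 2 * i%:Z + l%:Z -> v x - i%:Z - (- i%:Z - l%:Z) = 2 * i%:Z + l%:Z + l%:Z by lia.
  apply/idP/idP => h.
    suff : v x = 2 * i%:Z + l%:Z by move=> /E <-.
    have hN : pideal (v x + 1) (w ^+ (2 * i) / y - x).
      by rewrite -pidealN opprB; apply: pideal_le h; lia.
    by have [_] := val_add x0 hN; rewrite addrC subrK vb => ->.
  have hN : pideal (v (w ^+ (2 * i) / y) + 1) (x - w ^+ (2 * i) / y).
    by apply: pideal_le h; rewrite vb; lia.
  have [_] := val_add b0 hN; rewrite addrC subrK vb => vx.
  by rewrite E.
rewrite /= cond /ind; case: (boolP (pideal _ (x - _))) => [h|_]; last by rewrite mul0r mulr0.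
have vx : v x = 2 * i%:Z + l%:Z.
  have hN : pideal (v (w ^+ (2 * i) / y) + 1) (x - w ^+ (2 * i) / y).
    by apply: pideal_le h; rewrite vb; lia.
  by have [_] := val_add b0 hN; rewrite addrC subrK vb.
rewrite vx; have -> : (n%:Z %| 2 * i%:Z + l%:Z - i%:Z + j%:Z)%Z = (n %| i + j + l)%N.
  rewrite (_ : 2 * i%:Z + l%:Z - i%:Z + j%:Z = (i + j + l)%N%:Z)//; lia.
have -> : (true%:R : R)%:C = 1 by [].
by rewrite (mul1r (xi x)^-1) /=; case: ifP; rewrite ?mul0r.
Qed.

Lemma intertwining_low y (l : nat) : y != 0 -> v y = - l%:Z -> (0 < l)%N ->
  intertwining sym mu chi s testf (P i y) =
  if `[< forall u, ugroup l u -> xi u = 1 >] && (n %| i + j + l)%N then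
    chi (-1) * chi w ^ (- i%:Z - j%:Z) * qp (j%:R - i%:R + s * (i%:R + j%:R))
    * xi y * qp (l%:R * (s - 1))
  else 0.
Proof.
move=> y0 vy l0; have [sigma hsig] := conv_dom_halfplane chi (n_gt0 n_odd).
have w0 := pf_unif_neq0 F; have b0 : w ^+ (2 * i) / y != 0.
  by rewrite mulf_neq0 ?invr_neq0// unifX_neq0.
have vb : v (w ^+ (2 * i) / y) = 2 * i%:Z + l%:Z.
  rewrite pf_valM ?invr_neq0 ?unifX_neq0// valV// val_unifX vy; lia.
have sch : schwartz (fun x => (ind (w ^+ (2 * i) / y) (2 * i%:Z + l%:Z + l%:Z) x)%:C * (xi x)^-1).
  apply: schwartzM; first exact: schwartz_ind.
  have [e e0 he] := char_trivial_pos xiV_character.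
  exists (2 * i%:Z + l%:Z + e%:Z) => x u; rewrite /ind.
  case: (boolP (pideal _ _)) => [h _ hu|_]; last by case/eqP.
  have hN : pideal (v (w ^+ (2 * i) / y) + 1) (x - w ^+ (2 * i) / y).
    by apply: pideal_le h; rewrite vb; lia.
  have [] := val_add b0 hN; rewrite addrC subrK vb => x0 vx.
  by apply: (char_add xiV_character he) => //; rewrite vx.
have val z : cint (integrand z y) =
    (if (n %| i + j + l)%N then K0 * coef z (2 * i%:Z + l%:Z) else 0) *
    if `[< forall u, ugroup l u -> xi u = 1 >] then
      (xi (w ^+ (2 * i) / y))^-1 * (q ^ (- (2 * i%:Z + l%:Z + l%:Z)))%:C else 0.
  rewrite (integrand_low z y0 vy l0) (cintZ mu_haar)//; congr (_ * _).
  by rewrite -triv_inv -vb; exact: (cint_char_coset mu_haar vol_1 xiV_character b0 l0).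
rewrite /intertwining; case: (boolP (_ && _)) => [/andP[tr dv]|hn]; last first.
  apply: (@mcont_0 R F _ _ sigma s hsig) => z _; rewrite val.
  by move: hn; case: ifP; case: ifP; rewrite // ?mulr0 ?mul0r.
rewrite tr dv in val.
pose K := K0 * (xi (w ^+ (2 * i) / y))^-1.
rewrite (@mcont_qpow R F _ _ sigma K (2 * i%:R + l%:R - i%:R)
  ((j%:R - i%:R) * (s + 1) + i%:R * s - l%:R) s hsig).
  (* The centre w^(2 i) / y of the coset contributes chi (w)^(-2 i) xi (y), because (w, w) = 1 gives
     xi (w) = chi (w). *)
  have -> : K = chi (-1) * chi w ^ (- i%:Z - j%:Z) * xi y.
    rewrite /K /K0 (charM xi_character) ?invr_neq0 ?unifX_neq0// (charV xi_character)//.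
    rewrite (charXz xi_character (2 * i)%:Z)// xi_unif invfM invrK.
    have c0 : chi w != 0 by exact: char_neq0.
    have -> : chi w ^ (- i%:Z - j%:Z) = chi w ^ (i%:Z - j%:Z) * (chi w ^ (2 * i)%:Z)^-1.
      by rewrite invr_expz -expfzDr//; congr (_ ^ _); lia.
    by ring.
  have -> : qp ((2 * i%:R + l%:R - i%:R) * s + ((j%:R - i%:R) * (s + 1) + i%:R * s - l%:R))
      = qp (j%:R - i%:R + s * (i%:R + j%:R)) * qp (l%:R * (s - 1)).
    by rewrite -qpowD; congr qp; ring.
  move: (qp _) (qp _) (chi (-1)) (chi w ^ _) (xi y) => *; ring.
move=> z _; rewrite val /K /coef -qpow_int.
have -> : qp ((2 * i%:R + l%:R - i%:R) * z + ((j%:R - i%:R) * (s + 1) + i%:R * s - l%:R))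
    = qp ((j%:R - i%:R) * (s + 1) + i%:R * (s - z)) * (qp ((2 * i%:Z + l%:Z)%:~R * (z + 1))
      * qp (- (2 * i%:Z + l%:Z + l%:Z))%:~R).
  by rewrite -!qpowD; congr qp; rewrite rmorphN/= !rmorphD/= rmorphM/=; ring.
move: (qp _) (qp _) (qp _) K0 (xi _)^-1 => *; ring.
Qed.

Definition shell_coef (z : C) (l : int) : C :=
  if (n%:Z %| l - i%:Z + j%:Z)%Z then K0 * coef z l else 0.

(** For integral y the term x y w^-i always lies in P^(v x - i), so the condition falls on w^i alone
    and reads v x <= 2 i. *)
Lemma integrand_O z x y : pideal 0 y -> integrand z y x =
  if (x != 0) && (v x <= 2 * i%:Z) then shell_coef z (v x) * (xi x)^-1 else 0.
Proof.
move=> yO; cbv beta; rewrite integrandE /shell_coef; have [//|x0] := eqVneq x 0.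
have t0 := unifX_neq0 i.
have -> : pideal (v x - i%:Z) (x * ((w ^+ i)^-1 * y) - w ^+ i) = (v x <= 2 * i%:Z).
  rewrite [x * _ - _]addrC pidealDr; first by rewrite pidealN pidealE// val_unifX; lia.
  rewrite mulrA pidealMl ?mulf_neq0 ?invr_neq0// pf_valM ?invr_neq0// valV// val_unifX.
  by rewrite subrr.
by rewrite /=; case: (v x <= _) => //=; case: ifP => // _; rewrite mul0r.
Qed.

(** Shells are summed outwards from v x = 2 i. The weight q^(-l) cancels the 1 in q^(l (z + 1)), and
    the ratio of neighbouring shells is |chi (w) q^-z| < 1. *)
Lemma cint_integrand_O z y c : conv_dom n chi z -> pideal 0 y ->
  (fun N => \sum_(m < N) shell_coef z (2 * i%:Z + -1 * m%:Z) *
     cint (fun x => (shell (2 * i%:Z + -1 * m%:Z) x)%:R * ((xi x)^-1 * 1))) @ \oo --> c ->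
  cint (integrand z y) = c.
Proof.
have le_shell (m : nat) : 2 * i%:Z + -1 * m%:Z <= 2 * i%:Z by lia.
have opp_shell (m : nat) : - (2 * i%:Z) = - (2 * i%:Z + -1 * m%:Z) - m%:Z by lia.
have shell_le (k : int) : k <= 2 * i%:Z -> 0 <= -1 * (k - 2 * i%:Z) by lia.
move=> hz yO hc.
have sch l : schwartz (fun x => (shell l x)%:R * ((xi x)^-1 * 1)).
  by apply: (schwartz_char_shell xiV_character); exists 0.
have shE (m : nat) : (fun x => (shell (2 * i%:Z + -1 * m%:Z) x)%:R * integrand z y x) =
    fun x => shell_coef z (2 * i%:Z + -1 * m%:Z) *
      ((shell (2 * i%:Z + -1 * m%:Z) x)%:R * ((xi x)^-1 * 1)).
  apply/funext => x; case: (boolP (shell _ x)) => [hx|_]; last by rewrite !mul0r mulr0.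
  have [x0 vx] := shellP hx; rewrite integrand_O// x0 vx /=.
  by rewrite le_shell ?mul1r ?mulr1.
have [B B0 hB] := char_unit_bound xiV_character.
have w0 := pf_unif_neq0 F.
have c0 : 0 < nm (chi w) by rewrite nm_gt0 char_neq0.
have q0 : 0 < nm (qp z) by rewrite nm_gt0 qpow_neq0.
have rho1 := conv_dom_ratio chi_char (n_gt0 n_odd) hz.
have rhoE : nm (chi w) * nm (qp (- z)) = nm (chi w) / nm (qp z) by rewrite qpowN nmV.
rewrite rhoE in rho1; set rho := nm (chi w) / nm (qp z) in rho1.
have rho0 : 0 < rho by rewrite divr_gt0.
pose E := qp ((j%:R - i%:R) * (s + 1) + i%:R * (s - z)).
have nE (l : int) : nm (shell_coef z l) <= nm K0 * nm E * (nm (qp z) * q) ^ l.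
  rewrite /shell_coef; case: ifP => _; last first.
    rewrite nm0; apply: mulr_ge0; first by rewrite mulr_ge0 ?nm_ge0.
    by rewrite exprz_ge0// mulr_ge0 ?ltW// q_gt0.
  have q1 : qp 1 = q%:C by exact: (qpow_int 1).
  rewrite /coef -/E (nmM K0) (nmM E) qpowXz nmXz qpowD (nmM (qp z)) q1.
  by rewrite nm_real gtr0_norm ?q_gt0// mulrA.
have [] := @shell_series R F mu mu_haar (-1) (2 * i%:Z) (integrand z y)
  (nm K0 * nm E * B * rho ^ (- (2 * i%:Z))) rho c.
- by right.
- move=> x; rewrite integrand_O//; case: ifP; last by rewrite eqxx.
  by move=> /andP[x0 vx] _; split=> //; exact: shell_le.
- by move=> m; rewrite shE; apply: schwartzZ.
- by rewrite !mulr_ge0 ?nm_ge0// exprz_ge0// ltW.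
- by rewrite ltW.
- move=> m x hx; have [x0 vx] := shellP hx.
  have -> : integrand z y x = shell_coef z (2 * i%:Z + -1 * m%:Z) * (xi x)^-1.
    rewrite (integrand_O z x yO) x0 vx.
    by rewrite le_shell.
  have := nE (2 * i%:Z + -1 * m%:Z); have := hB _ _ hx.
  have -> : rho ^ (- (2 * i%:Z)) = rho ^ (- (2 * i%:Z + -1 * m%:Z)) / rho ^+ m.
    by rewrite exprnP invr_expz -expfzDr ?gt_eqF// -opp_shell.
  move: (2 * i%:Z + _) => l h1 h2; rewrite nmM.
  rewrite -(mulrA _ (_ / _)) divfK; last by rewrite expf_neq0// gt_eqF.
  have -> : nm K0 * nm E * B * rho ^ (- l) =
      (nm K0 * nm E * (nm (qp z) * q) ^ l) * (B * nm (xi w)^-1 ^ l) * q ^ (- l).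
    rewrite xi_unif nmV exprz_inv /rho exprzMl ?unitfE ?invr_eq0 ?gt_eqF//.
    rewrite expfzMl exprz_inv opprK.
    rewrite -[q ^ (- l)]invr_expz.
    have : q ^ l != 0 by rewrite expfz_neq0// q_neq0.
    move: (q ^ l) => Q Q0; field; exact: Q0.
  rewrite ler_wpM2r//; first by rewrite exprz_ge0// ltW// q_gt0.
  by rewrite ler_pM// nm_ge0.
- rewrite (_ : (fun N => _) = (fun N => \sum_(m < N) shell_coef z (2 * i%:Z + -1 * m%:Z) *
     cint (fun x => (shell (2 * i%:Z + -1 * m%:Z) x)%:R * ((xi x)^-1 * 1))))//.
  apply/funext => N; apply: eq_bigr => m _.
  by rewrite shE (cintZ mu_haar).
by [].
Qed.

Lemma intertwining_O_ramified y : (exists2 u, ugroup 0 u & xi u != 1) -> pideal 0 y ->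
  intertwining sym mu chi s testf (P i y) = 0.
Proof.
move=> [u uu hu] yO; have [sigma hsig] := conv_dom_halfplane chi (n_gt0 n_odd).
apply: (@mcont_0 R F _ _ sigma s hsig) => z hz; apply: cint_integrand_O => //.
have ram : exists2 u, ugroup 0 u & (xi u)^-1 != 1 by exists u => //; rewrite invr_eq1.
apply: (cseq_eq (u := fun=> 0) (a := 0)) => //; first exact: cvg_cst.
by move=> N; rewrite big1// => m _; rewrite (cint_char_shell mu_haar xiV_character _ ram) mulr0.
Qed.

(** On the shell v x = 2 i - m the divisibility condition is m = 2 i modulo n, so the geometric
    series starts at the remainder of 2 i and has ratio q^(-n z). *)
Lemma intertwining_O_trivial y : (forall x, x != 0 -> chi x = 1) -> i = j -> pideal 0 y ->
  qp (- (n%:R * s)) != 1 ->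
  intertwining sym mu chi s testf (P i y) =
    (1 - q^-1)%:C * qp ((2 * i)%:R * s - (2 * i %% n)%:R * s) / (1 - qp (- (n%:R * s))).
Proof.
move=> chi1 ij yO hs; have [sigma hsig] := conv_dom_halfplane chi (n_gt0 n_odd).
have N0 : (-1 : F) != 0 by rewrite oppr_eq0 oner_neq0.
have w0 := pf_unif_neq0 F.
have K1 : K0 = 1 by rewrite /K0 !chi1// exp1rz mulr1.
have xi1 x : x != 0 -> xi x = 1 by move=> x0; rewrite /xi chi1// ij subrr expr0z mulr1.
have E : (2 * i)%:R * s - (2 * i %% n)%:R * s =
    ((2 * i)%:R - i%:R - (2 * i %% n)%:R) * s + i%:R * s :> C.
  by ring.
rewrite E; apply: (mcont_geom hsig (n_gt0 n_odd)) => //.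
  rewrite -(rmorph0 (real_complex R)) (inj_eq (@complexI R)) subr_eq0 eq_sym.
  by rewrite invr_eq1 pnatr_eq1 gtn_eqF// q_gt1.
move=> z hz; apply: cint_integrand_O => //.
have X1 : nm (qp (- z)) < 1.
  by have := conv_dom_ratio chi_char (n_gt0 n_odd) hz; rewrite chi1// nm1 mul1r.
have XnE : qp (- z) ^+ n = qp (- (n%:R * z)).
  by rewrite -[RHS]/(qp (- (n%:Z%:~R * z))) -mulrN qpowXz.
have Xn : 1 - qp (- z) ^+ n != 0.
  rewrite subr_eq0 eq_sym; apply: contraTneq X1 => /(congr1 nm); rewrite nmX nm1 => h.
  rewrite -leNgt -(@ler_pXn2r _ n) ?n_gt0 ?nnegrE ?nm_ge0// ?expr1n ?h//.
have rn : (2 * i %% n < n)%N by rewrite ltn_mod n_gt0.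
have := geom_progression_cvg rn X1 Xn.
move=> /(cseqZ (c := (1 - q^-1)%:C * qp (i%:R * (s - z) + (2 * i)%:R * z))) h.
apply: (cseq_eq h).
  move=> N; rewrite mulr_sumr; apply: eq_bigr => m _.
  rewrite -[2 * i%:Z]/((2 * i)%N%:Z) mulN1r.
  have -> : (fun x => (shell ((2 * i)%N%:Z - m%:Z) x)%:R * ((xi x)^-1 * 1)) =
     (fun x => (shell ((2 * i)%N%:Z - m%:Z) x)%:R : C).
    apply/funext => x; case: (boolP (shell _ x)) => [hx|_]; last by rewrite mul0r.
    by have [x0 _] := shellP hx; rewrite xi1// invr1 !mulr1.
  rewrite (cint_shell mu_haar vol_1) /shell_coef -ij subrK -eqz_mod_dvd !modz_nat.
  rewrite eqz_nat eq_sym modn_mod.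
  case: ifP => _; last by rewrite mul0r mulr0.
  rewrite K1 mul1r /coef -ij subrr mul0r add0r.
  have -> : qp (- z) ^+ m = qp (- (m%:R * z)).
    by rewrite -[RHS]/(qp (- (m%:Z%:~R * z))) -mulrN qpowXz.
  rewrite (rmorphM (real_complex R))/= -qpow_int.
  have hq : qp (i%:R * (s - z) + (2 * i)%:R * z) * qp (- (m%:R * z)) =
     qp (i%:R * (s - z)) *
     (qp (((2 * i)%N%:Z - m%:Z)%:~R * (z + 1)) * qp (- ((2 * i)%N%:Z - m%:Z))%:~R).
    rewrite -!qpowD; congr qp; rewrite rmorphN/= rmorphB/=; ring.
  rewrite -[RHS]mulrA hq; move: (qp _) (qp _) (qp _) (_ - _)%:C => *; ring.
rewrite XnE; have -> : qp (- z) ^+ (2 * i %% n) = qp (- ((2 * i %% n)%:R * z)).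
  by rewrite -[RHS]/(qp (- ((2 * i %% n)%:Z%:~R * z))) -mulrN qpowXz.
have -> : qp (((2 * i)%:R - i%:R - (2 * i %% n)%:R) * z + i%:R * s) =
   qp (i%:R * (s - z) + (2 * i)%:R * z) * qp (- ((2 * i %% n)%:R * z)).
  by rewrite -qpowD; congr qp; ring.
by rewrite !mulrA.
Qed.

Lemma height_P_O y : pideal 0 y -> height (P i y) = q ^ i%:Z :> R.
Proof.
move=> yO; have t0 := unifX_neq0 i.
rewrite height_l bot_P/=; first by rewrite pnormE ?oppr_eq0 ?invr_eq0// valN valV// val_unifX opprK.
  by rewrite oppr_eq0 invr_eq0.
by rewrite valN pidealN pidealMl ?invr_eq0// subrr.
Qed.

Lemma height_P_low y (l : nat) : y != 0 -> v y = - l%:Z ->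
  height (P i y) = q ^ (i + l)%N%:Z :> R.
Proof.
move=> y0 vy; have t0 := unifX_neq0 i.
have vE : v ((w ^+ i)^-1 * y) = - (i + l)%N%:Z.
  by rewrite pf_valM ?invr_eq0// valV// val_unifX vy; lia.
have n0 : (w ^+ i)^-1 * y != 0 by rewrite mulf_neq0 ?invr_eq0.
rewrite height_r bot_P/=; first by rewrite pnormE ?oppr_eq0// valN vE opprK.
  by rewrite oppr_eq0.
by rewrite valN vE pidealN pidealE ?invr_eq0// valV// val_unifX; lia.
Qed.

(** * The outer Whittaker integral *)

Lemma qpowX (l : nat) y : qp (l%:R * y) = qp y ^+ l.
Proof. exact: (qpowXz l%:Z). Qed.

Definition K1 : C := chi (-1) * chi w ^ (- i%:Z - j%:Z) * qp (j%:R - i%:R + s * (i%:R + j%:R)).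

Definition Gint (l : nat) : C := cint (fun y => (shell (- l%:Z) y)%:R * (xi y * (psi y)^-1)).

(** Common to the ramified and the trivial case: A is the contribution of integral y, and m0 + 1 is
    the depth of the only shell that survives. Vanishing is asked only where xi is trivial on 1 +
    P^(m + 1), since the inner integral is 0 otherwise. *)
Lemma whittaker_w_testf (A : C) (m0 : nat) :
  (forall y, pideal 0 y -> intertwining sym mu chi s testf (P i y) = A) ->
  (forall u, ugroup m0.+1 u -> xi u = 1) ->
  (forall m, m != m0 -> (forall u, ugroup m.+1 u -> xi u = 1) -> Gint m.+1 = 0) ->
  whittaker_w sym mu i psi chi s testf =
  A + if (n %| i + j + m0.+1)%N then K1 * qp (m0.+1%:R * (s - 1)) * Gint m0.+1 else 0.
Proof.
move=> hO triv0 hG.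
have hchiV := character_inv chi_char.
have [sigma hsig] := conv_dom_halfplane (fun x => (chi x)^-1) (n_gt0 n_odd).
have w0 := pf_unif_neq0 F; have sp := spherical_inv psi_spherical.
pose K2 := if (n %| i + j + m0.+1)%N then K1 * qp (m0.+1%:R * (s - 1)) * Gint m0.+1 else 0.
rewrite -/K2 /whittaker_w /whittaker.
(* The flat section has height q^i on integral y and q^(i + m0 + 1) on the surviving shell; both
   powers have exponent -s - z, which vanishes at z = -s. *)
rewrite (@mcont_qpow2 R F _ _ sigma A (- i%:R) (- (i%:R * s)) K2
  (- (i + m0.+1)%:R) (- ((i + m0.+1)%:R * s)) (- s) hsig).
  by rewrite !mulrNN !subrr qpow0 !mulr1.
move=> z hz.
pose T (l : nat) := if `[< forall u, ugroup l u -> xi u = 1 >] && (n %| i + j + l)%N then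
  K1 * qp (l%:R * (s - 1)) * qp ((i + l)%:R * (- s - z)) else 0.
pose tail y := if (y != 0) && (v y < 0) then
  T `|v y|%N * (xi y * (psi y)^-1) else 0.
have splitE : (fun y => flat (- s) (intertwining sym mu chi s testf) z (P i y) * (psi y)^-1) =
    (fun y => A * qp (i%:R * (- s - z)) * (ind 0 0 y)%:C + tail y).
  apply/funext => y; rewrite /flat /tail /ind subr0.
  case: (boolP (pideal 0 y)) => [yO|nyO].
    have -> : (y != 0) && (v y < 0) = false.
      by case: eqVneq => //= y0; move: yO; rewrite pidealE//; lia.
    rewrite hO// height_P_O// cpow_qXz (psi_O psi_spherical yO) invr1 !mulr1 addr0.
    by [].
  have y0 : y != 0 by apply: contraNneq nyO => ->; exact: pideal0.
  have vy : v y < 0 by move: nyO; rewrite pidealE//; lia.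
  have vyE : v y = - `|v y|%N%:Z by lia.
  rewrite y0 vy /= mulr0 add0r (intertwining_low y0 vyE); last by lia.
  rewrite (height_P_low y0 vyE) cpow_qXz /T -/K1; case: ifP => _; last by rewrite !mul0r.
  move: (qp _) (qp _) K1 => *; ring.
have lE (m : nat) : -1 + -1 * m%:Z = - m.+1%:Z by lia.
have shE (m : nat) : (fun y => (shell (-1 + -1 * m%:Z) y)%:R * tail y) =
    fun y => T m.+1 * ((shell (- m.+1%:Z) y)%:R * (xi y * (psi y)^-1)).
  apply/funext => y; rewrite lE; case: (boolP (shell _ y)) => [hy|_]; last by rewrite !mul0r mulr0.
  have [y0 vy] := shellP hy; rewrite /tail y0 vy.
  have -> : (- m.+1%:Z < 0) = true by lia.
  have -> : `|- m.+1%:Z|%N = m.+1 by lia.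
  by rewrite /= !mul1r.
have sch l : schwartz (fun x => (shell l x)%:R * (xi x * (psi x)^-1)).
  apply: (schwartz_char_shell xi_character); exists 0 => x y hy; exact: (psi_lc sp).
have [B B0 hB] := char_unit_bound xi_character.
have rho1 := conv_dom_ratio hchiV (n_gt0 n_odd) hz.
set rho := _ * _ in rho1.
have c0 : chi w != 0 by exact: char_neq0.
have rho0 : 0 < rho by rewrite mulr_gt0// nm_gt0 ?invr_eq0// qpow_neq0.
have [|||||||int_tail cint_tail] := @shell_single R F mu mu_haar (-1) (-1) tail
   (nm K1 * nm (qp (i%:R * (- s - z))) * B * rho) rho m0.
- by right.
- by move=> y; rewrite /tail; case: ifP; [move=> /andP[y0 vy] _; split=> //; lia|rewrite eqxx].
- by move=> m; rewrite shE; apply: schwartzZ.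
- by rewrite !mulr_ge0 ?nm_ge0// ltW.
- by rewrite ltW.
- move=> m y hy; have := hB _ _ hy; have [y0 vy] := shellP hy; rewrite lE in vy *.
  have -> : tail y = T m.+1 * (xi y * (psi y)^-1).
    rewrite /tail y0 vy; have -> : (- m.+1%:Z < 0) = true by lia.
    by have -> : `|- m.+1%:Z|%N = m.+1 by lia.
  rewrite (nmM (T _)) (nmM (xi y)) nmV (nm_psi psi_spherical) invr1 mulr1 xi_unif opprK => h.
  have hT : nm (T m.+1) <= nm K1 * nm (qp (i%:R * (- s - z))) *
      (nm (qp (s - 1)) * nm (qp (- s - z))) ^+ m.+1.
    rewrite /T; case: ifP => _; last first.
      by rewrite nm0 !mulr_ge0 ?nm_ge0// exprn_ge0// mulr_ge0 ?nm_ge0.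
    have -> : qp ((i + m.+1)%:R * (- s - z)) = qp (i%:R * (- s - z)) * qp (- s - z) ^+ m.+1.
      by rewrite -qpowX -qpowD; congr qp; rewrite natrD mulrDl.
    rewrite qpowX (nmM (K1 * _)) (nmM K1) nmX (nmM (qp (i%:R * _))) nmX exprMn.
    by rewrite le_eqVlt mulrACA eqxx.
  have -> : nm K1 * nm (qp (i%:R * (- s - z))) * B * rho * rho ^+ m =
      nm K1 * nm (qp (i%:R * (- s - z))) * (nm (qp (s - 1)) * nm (qp (- s - z))) ^+ m.+1 *
      (B * nm (chi w) ^ (- m.+1%:Z)) * q ^ m.+1%:Z.
    rewrite -mulrA -exprS.
    (* Splitting q^-z as q^(s - 1) q^(-s - z) q matches the ratio with the inner value, the flat
       factor and the volume of the shell. *)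
    have -> : rho = nm (qp (s - 1)) * nm (qp (- s - z)) * (nm (chi w))^-1 * q.
      rewrite /rho nmV; have -> : qp (- z) = qp (s - 1) * qp (- s - z) * qp 1%:~R.
        by rewrite -!qpowD; congr qp; ring.
      rewrite qpow_int expr1z (nmM (_ * _)) (nmM (qp _)) nm_real ger0_norm ?ler0n//.
      by ring.
    rewrite -[_ ^ (- m.+1%:Z)]exprnN -exprVn -[q ^ m.+1%:Z]exprnP.
    move: (nm (qp (s - 1))) (nm (qp (- s - z))) (nm (chi w))^-1 => a b c.
    by rewrite !exprMn; move: (a ^+ _) (b ^+ _) (c ^+ _) (q ^+ _) => *; ring.
  rewrite ler_wpM2r ?exprz_ge0 ?ler0n//.
  by rewrite ler_pM ?nm_ge0.
- move=> m hm; rewrite shE (cintZ mu_haar)// /T; case: ifP; rewrite ?mul0r//.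
  by move=> /andP[/asboolP tr _]; rewrite -/(Gint m.+1) hG// mulr0.
rewrite splitE (cintD)//.
- rewrite (cint_ball mu_haar) oppr0 expr0z vol_1 mulr1 mulr1 cint_tail shE (cintZ mu_haar)//.
  rewrite -/(Gint m0.+1) /T /K2; have -> : `[< forall u, ugroup m0.+1 u -> xi u = 1 >] = true.
    by apply/asboolP.
  have -> : - i%:R * z + - (i%:R * s) = i%:R * (- s - z) :> C by ring.
  have -> : - (i + m0.+1)%:R * z + - ((i + m0.+1)%:R * s) = (i + m0.+1)%:R * (- s - z) :> C by ring.
  rewrite /=; case: ifP => _; last by rewrite !mul0r.
  by congr (_ + _); rewrite -!(mulrA (K1 * _)); congr (_ * _); rewrite mulrC.
- apply: (schwartz_integrable mu_haar); apply: schwartzZ; exact: schwartz_ind.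
Qed.

(** Integral y contribute 0, and the power q^((e + 1) (s - 1)) left by the inner integral is exactly
    the one accompanying the Gauss integral in [epsilon_gauss]. *)
Lemma whittaker_w_ramified (e : nat) (eps : C -> C) :
  is_conductor xi e.+1 -> is_epsilon mu psi xi eps ->
  whittaker_w sym mu i psi chi s testf =
  if (n %| i + j + e.+1)%N then K1 * (eps s)^-1 else 0.
Proof.
move=> hcond heps; have [h1 h2] := hcond.
rewrite (@whittaker_w_testf 0 e) ?add0r//; first last.
- move=> m hm _; apply: (cint_gauss_shell mu_haar psi_spherical xi_character hcond).
  by rewrite eqr_opp eqz_nat eqSS.
- by move=> y yO; apply: intertwining_O_ramified => //; exact: h2.
case: ifP => // _; rewrite -(mulrA K1); congr (_ * _).
have := epsilon_gauss mu_haar vol_1 psi_spherical xi_character hcond s heps.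
rewrite mulrC -[gauss _ _ _ _]/(Gint e.+1).
have -> : e.+1%:R * s - e.+1%:R = e.+1%:R * (s - 1) :> C by ring.
move=> h; have e0 : eps s != 0.
  by apply: contraPneq h => ->; rewrite mulr0 => /esym/eqP; rewrite oner_eq0.
by rewrite (mulrC (qp _)) -[LHS](mulfK e0) h mul1r.
Qed.

(** The subtracted term comes from the shell v y = -1, on which psi^-1 integrates to -1. *)
Lemma whittaker_w_trivial : (forall x, x != 0 -> chi x = 1) -> i = j ->
  qp (- (n%:R * s)) != 1 ->
  whittaker_w sym mu i psi chi s testf =
  (1 - q^-1)%:C * qp ((2 * i)%:R * s - (2 * i %% n)%:R * s) / (1 - qp (- (n%:R * s)))
  - (if (n %| (2 * i).+1)%N then qp ((2 * i).+1%:R * s - 1) else 0).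
Proof.
move=> chi1 ij hs; have w0 := pf_unif_neq0 F.
have N0 : (-1 : F) != 0 by rewrite oppr_eq0 oner_neq0.
have sp := spherical_inv psi_spherical.
have xi1 x : x != 0 -> xi x = 1 by move=> x0; rewrite /xi chi1// ij subrr expr0z mulr1.
have triv l u : ugroup l u -> xi u = 1 by move=> /ugroupP[u0 _]; exact: xi1.
rewrite (whittaker_w_testf (m0 := 0) (fun y yO => intertwining_O_trivial chi1 ij yO hs)); last first.
- move=> m hm _; apply: (cint_char_psi_shell_low mu_haar xi_character sp (ltn0Sn 0) (triv _)).
  by lia.
- exact: triv.
congr (_ + _).
have -> : (i + j + 1)%N = (2 * i).+1 by rewrite -ij; lia.
case: ifP => _; last by rewrite oppr0.
have -> : Gint 1 = -1.
  rewrite -(cint_psi_shellN1 mu_haar vol_1 sp); congr cintegral; apply/funext => y.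
  case: (boolP (shell _ y)) => [hy|_]; last by rewrite !mul0r.
  have [y0 _] := shellP hy; rewrite (xi1 y y0).
  by congr (_ * _); exact: mul1r.
rewrite mulrN1 /K1 !chi1// exp1rz !mul1r -qpowD -ij; congr (- qp _).
by rewrite -natr1 natrM; ring.
Qed.

End TestFunction.

Section CoefficientMatrix.
Context (mu : {measure set (borelF F) -> \bar R}).
Hypothesis mu_haar : is_haar mu.
Hypothesis vol_1 : vol mu = 1.
Context (psi : F -> C).
Hypothesis psi_spherical : spherical psi.

Lemma coefficient_testf (chi : F -> C) (s : C) (tau : 'I_n -> 'I_n -> C) (i j : 'I_n) :
  is_character chi -> is_coefficient_matrix sym mu psi chi s tau ->
  tau i j = whittaker_w sym mu i psi chi s (testf chi s j).
Proof.
move=> hchi /(_ _ (testf_princ_series s j hchi) i) ->.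
rewrite (bigD1 j)//= (whittaker_testf s hchi mu_haar vol_1 psi_spherical)// eqxx mulr1.
rewrite big1 ?addr0// => k kj.
rewrite -val_eqE in kj.
by rewrite (whittaker_testf s hchi mu_haar vol_1 psi_spherical)// (negbTE kj) mulr0.
Qed.

End CoefficientMatrix.
End Cover.

(** * Existence and uniqueness of conductors *)

Section Conductors.
Context {R : realType} {F : padicField} (chi : F -> R[i]).

Lemma conductor_unique a b : is_conductor chi a -> is_conductor chi b -> a = b.
Proof.
move=> [a1 a2] [b1 b2]; have [ab|ba|//] := ltngtP a b.
  by have [u uu] := b2 a ab; rewrite a1// eqxx.
by have [u uu] := a2 b ba; rewrite b1// eqxx.
Qed.

Lemma conductorE m : is_conductor chi m -> conductor chi = m.
Proof. by move=> h; apply: xget_unique => // k /conductor_unique; exact. Qed.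

Lemma conductor_exists : is_character chi -> exists m, is_conductor chi m.
Proof.
move=> hchi; have [e _ he] := char_trivial_pos hchi.
have exP : exists m, `[< forall u, ugroup m u -> chi u = 1 >] by exists e; apply/asboolP.
have [m /asboolP hm hmin] := ex_minnP exP; exists m; split=> // k km.
apply: contrapT => hk; have : (m <= k)%N.
  apply: hmin; apply/asboolP => u uu; apply: contrapT => /eqP hu.
  by apply: hk; exists u.
by rewrite leqNgt km.
Qed.

End Conductors.

(** * Matching the computed values with the stated formulas *)

Section FinalFormulas.
Context {R : realType} {F : padicField} (n : nat).
Local Notation C := R[i].
Local Notation qp := (@qpow R F).
Local Notation q := ((pf_q F)%:R : C).

Lemma qR_complex : ((pf_q F)%:R : R)%:C = q.
Proof. exact: rmorph_nat. Qed.

Lemma Lfactor_trivial s : Lfactor s (fun _ : F => 1) = (1 - qp (- s))^-1.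
Proof. by rewrite /Lfactor; case: asboolP => [_|[]//]; rewrite mul1r. Qed.

(** The remainder of 2 j is 2 j or 2 j - n, which accounts for the factor q^(n s). The extra term
    occurs only for 2 j + 1 = n, where the numerators combine: 1 - q^-1 - q^(n s - 1) (1 - q^(-n s))
    = 1 - q^(n s - 1). *)
Lemma diagonal_formula (j : nat) (s : C) : odd n -> (j < n)%N -> qp (- (n%:R * s)) != 1 ->
  (1 - ((pf_q F)%:R : R)^-1)%:C * qp ((2 * j)%:R * s - (2 * j %% n)%:R * s)
    / (1 - qp (- (n%:R * s)))
  - (if (n %| (2 * j).+1)%N then qp ((2 * j).+1%:R * s - 1) else 0)
  = Lfactor (n%:R * s) (fun _ : F => 1) *
    (if (2 * j < n.-1)%N then 1 - q^-1
     else if (2 * j == n.-1)%N then (Lfactor (1 - n%:R * s) (fun _ : F => 1))^-1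
     else qp (n%:R * s) * (1 - q^-1)).
Proof.
move=> n_odd jn hs.
have -> : (1 - ((pf_q F)%:R : R)^-1)%:C = 1 - q^-1.
  by rewrite rmorphB/= fmorphV/= qR_complex.
rewrite !Lfactor_trivial invrK.
have Y1 : 1 - qp (- (n%:R * s)) != 0 by rewrite subr_eq0 eq_sym.
have n2 : (n %% 2 = 1)%N by rewrite modn2 n_odd.
case: ltngtP => hj.
- rewrite modn_small; last by lia.
  rewrite subrr qpow0 mulr1; have -> : (n %| (2 * j).+1)%N = false.
    by apply/negP => /dvdn_leq; lia.
  by rewrite subr0 mulrC.
- have -> : (2 * j %% n = 2 * j - n)%N.
    have E : (2 * j = (2 * j - n) + n)%N by lia.
    by rewrite {1}E modnDr modn_small//; lia.
  have -> : (2 * j)%:R * s - (2 * j - n)%:R * s = n%:R * s.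
    by rewrite natrB; [ring|lia].
  have -> : (n %| (2 * j).+1)%N = false.
    apply/negP => /dvdnP[k hk]; have k2 : (k < 2)%N by nia.
    by case: k hk k2 => [|[|k]] hk k2; lia.
  by rewrite subr0 mulrC (mulrC (qp _)).
- rewrite modn_small ?subrr ?qpow0 ?mulr1; last by lia.
  have -> : (2 * j).+1 = n by lia.
  rewrite dvdnn; have -> : - (1 - n%:R * s) = n%:R * s - 1 by ring.
  have qN1 : qp (-1) = q^-1 by rewrite qpowN -[1]/(1%:~R) qpow_int expr1z qR_complex.
  rewrite qpowD qN1 qpowN.
  move: Y1 (@qpow_neq0 R F (n%:R * s)); rewrite qpowN; move: (qp _) => X Y1 X0.
  have q0 : q != 0 by rewrite pnatr_eq0 -lt0n ltnW// q_gt1.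
  have X1 : X - 1 != 0.
    apply: contra Y1 => /eqP h; have -> : X = 1 by apply/eqP; rewrite -subr_eq0 h.
    by rewrite invr1 subrr.
  by field; rewrite q0 X0 X1.
Qed.

Lemma qpow_scale (i j : nat) (s x : C) : x != 0 ->
  x ^ (- i%:Z - j%:Z) * qp (j%:R - i%:R + s * (i%:R + j%:R))
  = q ^ (j%:Z - i%:Z) * (x * qp (- s)) ^ (- i%:Z - j%:Z).
Proof.
move=> x0; rewrite expfzMl -qpowXz.
have -> : q ^ (j%:Z - i%:Z) = qp (j%:Z - i%:Z)%:~R.
  by rewrite qpow_int -qR_complex (rmorphXz (real_complex R)) ?unitfE// q_neq0.
have -> : qp (j%:R - i%:R + s * (i%:R + j%:R)) =
    qp (j%:Z - i%:Z)%:~R * qp ((- i%:Z - j%:Z)%:~R * - s).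
  by rewrite -qpowD; congr qp; ring.
by rewrite mulrCA.
Qed.

End FinalFormulas.

Theorem lemma5p2 (R : realType) (F : padicField) (n : nat)
  (n_odd : odd n)
  (coprime_pn : coprime (pf_p F) n)
  (mu_n_F : exists z : F, n.-primitive_root z)
  (hilb : F -> F -> F) (hilbP : is_hilbert_symbol n hilb)
  (iota : F -> R[i]) (iotaP : is_root_identification n iota)
  (psi : F -> R[i]) (psi_spherical : spherical psi)
  (mu : {measure set (borelF F) -> \bar R})
  (mu_haar : is_haar mu) (mu_psi : self_dual mu psi)
  (eps : (F -> R[i]) -> R[i] -> R[i])
  (epsP : forall chi, is_character chi -> is_epsilon mu psi chi (eps chi)) :
  let sym (x y : F) := iota (hilb x y) in
  let eta (k : int) (y : F) := sym (pf_unif F) y ^ k in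
  let q : R[i] := (pf_q F)%:R in
  (forall (s : R[i]) (tau : 'I_n -> 'I_n -> R[i]),
     qpow F (- (n%:R * s)) != 1 ->
     is_coefficient_matrix sym mu psi (fun=> 1) s tau ->
     (forall j : 'I_n,
        tau j j = Lfactor (n%:R * s) (fun _ : F => 1) *
          (if (2 * j < n.-1)%N then 1 - q^-1
           else if (2 * j == n.-1)%N then
             (Lfactor (1 - n%:R * s) (fun _ : F => 1))^-1
           else qpow F (n%:R * s) * (1 - q^-1))) /\
     (forall i j : 'I_n, i != j ->
        tau i j = if (i + j == n.-1)%N then
            qpow F (j%:R - i%:R + s * n.-1%:R) * (eps (eta (i%:Z - j%:Z)) s)^-1
          else 0)) /\
  (forall chi : F -> R[i],
     is_character chi ->
     ~ unramified (fun x => chi x ^+ n) ->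
     forall (s : R[i]) (tau : 'I_n -> 'I_n -> R[i]),
     is_coefficient_matrix sym mu psi chi s tau ->
     forall i j : 'I_n,
       tau i j = if (i + j + conductor chi == 0 %[mod n])%N then
           chi (-1) * q ^ (j%:Z - i%:Z)
           * (chi (pf_unif F) * qpow F (- s)) ^ (- i%:Z - j%:Z)
           * (eps (fun x => chi x * eta (i%:Z - j%:Z) x) s)^-1
         else 0).
Proof.
move=> sym eta q.
have vol_1 := vol1 mu_haar psi_spherical mu_psi.
have w0 := pf_unif_neq0 F.
have etaP (k : int) : is_character (eta k).
  exact: (eta_character n_odd coprime_pn mu_n_F hilbP iotaP k).
have coefE := coefficient_testf n_odd coprime_pn mu_n_F hilbP iotaP mu_haar vol_1 psi_spherical.
have ramE := whittaker_w_ramified n_odd coprime_pn mu_n_F hilbP iotaP.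
split.
- have one_char : is_character (fun _ : F => 1 : R[i]).
    by split=> [*|*|]; [rewrite mulr1|exact: oner_neq0|exists 0%N].
  move=> s tau hs htau; split=> [j|i j ij].
    rewrite (coefE _ s tau j j one_char htau).
    rewrite (whittaker_w_trivial n_odd coprime_pn mu_n_F hilbP iotaP one_char mu_haar vol_1 psi_spherical)//.
    exact: diagonal_formula.
  have ndiv : ~~ (n%:Z %| i%:Z - j%:Z)%Z.
    apply: contraNN ij => /dvdzP[m hm]; apply/eqP/val_inj => /=.
    have := ltn_ord i; have := ltn_ord j => hj hi; have m0 : m = 0 by nia.
    by move: hm; rewrite m0; lia.
  have xiE : xi hilb iota (fun=> 1) j i = eta (i%:Z - j%:Z).
    by apply/funext => y; rewrite /xi mul1r.
  (* For distinct i, j below n the power i - j of eta is nontrivial on units, but it is trivial on 1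
     + P. *)
  have hcond : is_conductor (xi hilb iota (fun=> 1) j i) 1.
    rewrite xiE; split.
      by move=> u uu; rewrite /eta /sym (sym_ugroup1r n_odd coprime_pn mu_n_F hilbP iotaP uu w0) exp1rz.
    by move=> [|//] _; exact: (eta_nontrivial n_odd coprime_pn mu_n_F hilbP iotaP ndiv).
  rewrite (coefE _ s tau i j one_char htau).
  rewrite (ramE _ s j one_char mu mu_haar vol_1 psi psi_spherical i 0 (eps (eta (i%:Z - j%:Z))))//; last first.
    by rewrite xiE; exact: epsP.
  (* The number i + j + 1 lies strictly between 0 and 2 n, so it is divisible by n only when equal
     to n. *)
  have -> : (n %| i + j + 1)%N = (i + j == n.-1)%N.
    have := ltn_ord i; have := ltn_ord j => hj hi; apply/idP/eqP.
      move=> /dvdnP[k hk]; have k2 : (k < 2)%N by nia.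
      by case: k hk k2 => [|[|k]] hk k2; lia.
    by move=> h; have -> : (i + j + 1 = n)%N by lia.
  case: eqP => // hij; congr (_ * _).
  by rewrite /K1 exp1rz !mul1r -hij natrD.
move=> chi chi_char ram s tau htau i j.
have xi_char := xi_character n_odd coprime_pn mu_n_F hilbP iotaP j chi_char i.
have [[|e] he] := conductor_exists chi_char.
  by exfalso; apply: ram => u uu; case: he => h _; rewrite h// expr1n.
(* The twist by eta keeps the conductor: above level 0 eta is trivial. At level 0, triviality of the
   twist on units would make its n-th power, which is chi^n because eta^n = 1, unramified. *)
have hcond : is_conductor (xi hilb iota chi j i) e.+1.
  case: he => h1 h2.
  have eta1 u : ugroup 1 u -> iota (hilb (pf_unif F) u) ^ (i%:Z - j%:Z) = 1.
    by move=> uu; rewrite (sym_ugroup1r n_odd coprime_pn mu_n_F hilbP iotaP uu w0) exp1rz.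
  split=> [u uu|[|k] ke].
  - by rewrite /xi h1// mul1r eta1//; exact: ugroup_le uu.
  - apply: contrapT => hn; apply: ram => u uu; have [u0 _] := ugroupP uu.
    have : xi hilb iota chi j i u = 1.
      by apply: contrapT => /eqP hu; apply: hn; exists u.
    rewrite /xi => /(congr1 (fun z => z ^+ n)); rewrite exprMn expr1n.
    rewrite [X in _ * X]exprnP exprzAC -exprnP (sym_n hilbP iotaP w0 u0) exp1rz.
    by rewrite mulr1.
  - have [u uu hu] := h2 _ ke; exists u => //; rewrite /xi eta1 ?mulr1//.
    exact: ugroup_le uu.
rewrite (coefE _ s tau i j chi_char htau) (conductorE he).
rewrite (ramE _ s j chi_char mu mu_haar vol_1 psi psi_spherical i e
  (eps (fun x => chi x * eta (i%:Z - j%:Z) x)))//; last exact: epsP.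
rewrite mod0n -/(dvdn n _); case: ifP => // _; congr (_ * _).
rewrite /K1 -!mulrA; congr (_ * _).
by apply: qpow_scale; exact: char_neq0.
Qed.
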